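(* Let $k$ be an algebraically closed field, $\Lambda$ a basic finite-dimensional $k$-algebra and $d\geq 1$. Let $\mu,\nu\in T_d(\Lambda)$ be triangular representations, and let $M_1\xrightarrow{i_1}M_2\xrightarrow{i_2}\cdots\xrightarrow{i_{d-1}}M_d$ and $N_1\xrightarrow{j_1}N_2\xrightarrow{j_2}\cdots\xrightarrow{j_{d-1}}N_d$ be the composition series corresponding to $\mu$ and $\nu$ respectively. Then $\nu$ lies in the Zariski closure $\overline{U_d(k)*\mu}$ of the $U_d(k)$-orbit of $\mu$ if and only if there exist $\Lambda$-modules $X_1,\ldots,X_d$, $\Lambda$-homomorphisms $h_l:X_l\to X_{l+1}$ ($1\leq l\leq d-1$), and for each $1\leq l\leq d$ a short exact sequence $0\to X_l\xrightarrow{a_l} X_l\oplus M_l\xrightarrow{b_l} N_l\to 0$, such that for all $1\leq l\leq d-1$ we have $\begin{pmatrix}h_l&0\\0&i_l\end{pmatrix}a_l=a_{l+1}h_l$ and $j_l b_l=b_{l+1}\begin{pmatrix}h_l&0\\0&i_l\end{pmatrix}$ (i.e. the diagram formed by the rows $X_\bullet$, $X_\bullet\oplus M_\bullet$, $N_\bullet$ and these exact columns commutes).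
   Context: A $d$-dimensional representation of $\Lambda$ is a $k$-algebra homomorphism $\rho:\Lambda\to M_d(k)$; it corresponds to the $\Lambda$-module structure on $k^d$ given by $\lambda\cdot v=\rho(\lambda)v$. The set $\mathrm{mod}_d\Lambda$ of such representations is an affine variety. A representation $\rho$ is triangular if $\rho(\Lambda)$ is contained in the algebra of upper triangular $d\times d$ matrices; $T_d(\Lambda)$ denotes the (closed) subvariety of triangular representations. The group $U_d(k)$ of invertible upper triangular $d\times d$ matrices acts on $T_d(\Lambda)$ by conjugation, $(g*\rho)(\lambda)=g\rho(\lambda)g^{-1}$. The composition series corresponding to a triangular $\mu$: let $M_d$ be $k^d$ with the module structure from $\mu$, and for each $i$ let $M_i\subseteq M_d$ be the submodule spanned by the first $i$ unit vectors $u_1,\ldots,u_i$ (a submodule since $\mu$ is triangular), with $i_l:M_l\hookrightarrow M_{l+1}$ the inclusions.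
   Formalization: The modules X_1,…,X_d are taken to be finite-dimensional (the usual convention for modules over a finite-dimensional algebra); with infinite-dimensional X_l allowed, the ''if'' direction would be false. *)

(* Defs.v *)
From HB Require Import structures.
From mathcomp Require Import all_boot all_order all_algebra all_field.
Set Implicit Arguments. Unset Strict Implicit. Unset Printing Implicit Defensive.
Import GRing.Theory.
Local Open Scope ring_scope.

Section Defs.
Variables (k : fieldType) (L : falgType k).

Definition jacobson_rad (x : L) : Prop := forall y : L, (1 - y * x) \is a GRing.unit.

(* L is basic: L / rad L is isomorphic (as a k-algebra) to k x ... x k,
   i.e. there is a surjective k-algebra map L -> k^n whose kernel is rad L. *)
Definition basic_algebra : Prop :=
  exists (n : nat) (pi : L -> 'I_n -> k),
    [/\ (forall (c : k) (a b : L) i, pi (c *: a + b) i = c * pi a i + pi b i),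
        (forall (a b : L) i, pi (a * b) i = pi a i * pi b i),
        (forall i, pi 1 i = 1),
        (forall f : 'I_n -> k, exists a : L, forall i, pi a i = f i) &
        (forall a : L, (forall i, pi a i = 0) <-> jacobson_rad a)].

(* An n-dimensional representation: a k-algebra homomorphism L -> M_n(k).
   It gives the L-module k^n (column vectors), lambda . v = rho lambda *m v. *)
Definition is_rep n (rho : L -> 'M[k]_n) : Prop :=
  [/\ (forall (c : k) (a b : L), rho (c *: a + b) = c *: rho a + rho b),
      (forall a b : L, rho (a * b) = rho a *m rho b) &
      rho 1 = 1%:M].

Definition upper_triangular n (A : 'M[k]_n) : Prop :=
  forall i j : 'I_n, (j < i)%N -> A i j = 0.

Definition triangular_rep d (rho : L -> 'M[k]_d) : Prop :=
  is_rep rho /\ forall a, upper_triangular (rho a).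

Definition in_Ud d (g : 'M[k]_d) : Prop := g \in unitmx /\ upper_triangular g.

Definition conj_rep d (g : 'M[k]_d) (rho : L -> 'M[k]_d) : L -> 'M[k]_d :=
  fun a => g *m rho a *m invmx g.

Definition Ud_orbit d (mu : L -> 'M[k]_d) (rho : L -> 'M[k]_d) : Prop :=
  exists g, in_Ud g /\ rho = conj_rep g mu.

(* Polynomial functions on the affine space Hom_k(L, M_d(k)): the k-algebra
   generated by constants and the coordinate functions rho |-> (rho a) i j. *)
Inductive polyfun d : ((L -> 'M[k]_d) -> k) -> Prop :=
| pf_const (c : k) : polyfun (fun _ => c)
| pf_coord (a : L) (i j : 'I_d) : polyfun (fun rho => rho a i j)
| pf_add f g : polyfun f -> polyfun g -> polyfun (fun rho => f rho + g rho)
| pf_mul f g : polyfun f -> polyfun g -> polyfun (fun rho => f rho * g rho).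

Definition zariski_closure d (S : (L -> 'M[k]_d) -> Prop) (x : L -> 'M[k]_d) : Prop :=
  forall f, polyfun f -> (forall rho, S rho -> f rho = 0) -> f x = 0.

Definition is_hom n m (X : L -> 'M[k]_n) (Y : L -> 'M[k]_m) (F : 'M[k]_(m, n)) : Prop :=
  forall a, F *m X a = Y a *m F.

Definition dsum_rep n m (X : L -> 'M[k]_n) (Y : L -> 'M[k]_m) : L -> 'M[k]_(n + m) :=
  fun a => block_mx (X a) 0 0 (Y a).

Definition short_exact n m p (X : L -> 'M[k]_n) (Y : L -> 'M[k]_m) (Z : L -> 'M[k]_p)
  (A : 'M[k]_(m, n)) (B : 'M[k]_(p, m)) : Prop :=
  [/\ is_hom X Y A, is_hom Y Z B,
      (forall v : 'cV[k]_n, A *m v = 0 -> v = 0),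
      (forall w : 'cV[k]_p, exists v : 'cV[k]_m, B *m v = w) &
      (forall v : 'cV[k]_m, B *m v = 0 <-> exists u : 'cV[k]_n, v = A *m u)].

Definition mx_get d (A : 'M[k]_d) (p q : nat) : k :=
  if insub p : option 'I_d is Some p' then
    if insub q : option 'I_d is Some q' then A p' q' else 0
  else 0.

(* M_l: the submodule of (k^d, mu) spanned by u_1, ..., u_l (for l <= d),
   as an l-dimensional representation (top-left l x l block of mu). *)
Definition sub_rep d (mu : L -> 'M[k]_d) (l : nat) : L -> 'M[k]_l :=
  fun a => \matrix_(p < l, q < l) mx_get (mu a) p q.

Definition incl_mx (l : nat) : 'M[k]_(l.+1, l) :=
  \matrix_(p < l.+1, q < l) ((p : nat) == q)%:R.

End Defs.

(* Main.v *)
(** Sequences to degenerations (Riedtmann): sections of the maps [b_l] compatible with the filtrations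
    split off a complement of the image of [a_l], and the cokernels of the pencils [a_l + t (1, 0)] give
    triangular representations [rho_t], rational in [t], with [rho_0 = nu].  For all but finitely many
    [t] the endomorphism of [X_l] in the pencil is invertible, so that [M_l] maps isomorphically onto
    the cokernel and [rho_t] lies in the orbit of [mu].

    Degenerations to sequences (Zwara): if [nu] is the value at [t = 0] of [g * mu] for a formal curve
    [g(t)], the columns of [t^e g^-1] span a lattice [Q] with [t^h (M (x) k[[t]]) <= Q <= M (x) k[[t]]]
    and [Q / t Q = N].  Put [X = Q / t^h (M (x) k[[t]])].  Multiplication by [t] embeds [X] into
    [Q / t^(h+1) (M (x) k[[t]])] with cokernel [N], and the coefficient of [t^h] retracts the latter onto
    its submodule [t^h M], so it is [X (+) M].  As [g] is triangular all of this respects the filtrations.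

    The formal curve: an ultraproduct over [U_d] gives an algebraically closed field [K] with a point [g]
    of [U_d(K)] such that evaluation at [nu] is well defined on the ring generated by the entries of
    [g * mu]; it extends to a place of [K] by Chevalley.  Adjoining the entries of [g] one at a time to
    the algebraic closure of [k(t)] in [K], where [t] has positive valuation, one moves [g] down this
    tower without changing the value of [g * mu] at the place: a polynomial condition in one variable
    over an algebraically closed valued field can be approximated there, and the algebraic elements
    follow as joint eigenvalues of commuting matrices.  The resulting entries generate a finite
    extension of [k(t)], on which the valuation is discrete. *)
Require Import Defs.
From HB Require Import structures.
From mathcomp Require Import all_boot all_order all_algebra all_field.
From mathcomp Require Import boolp classical_sets functions filter ring.
Set Implicit Arguments. Unset Strict Implicit. Unset Printing Implicit Defensive.
Import GRing.Theory.
Local Open Scope ring_scope.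

(** * Ultrapowers of algebraically closed fields *)

(** The obstacle is that the curve has to lie in the group: the condition on [nu] concerns the orbit
    only, and at the place the entries of [g] may have poles although those of [g * mu] are finite.
    Hence [g] itself is specialized, and the descent carries two kinds of data: the polynomial
    relations among the entries, through a partial homomorphism, and the residues of the entries
    that have one. Algebraic closures are taken at every stage of the tower because polynomials over
    the smaller field then split, which reduces conditions on valuations to distances from finitely
    many points. The element [t] is kept at the bottom so that every stage has a nontrivial value
    group; if no element has positive valuation, all of [K] is finite at the place and [nu] lies in
    the orbit itself. Power series are replaced by polynomial matrices: exactness at each level
    involves the coefficients up to [t^h] only, so congruences modulo [t^(h+1)] suffice.
    Triangularity enters through corner blocks, one pair [P], [Q] serving all levels. *)

Section Ultrapower.
Local Open Scope quotient_scope.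
Variables (k : closedFieldType) (I : pointedType) (F : set_system I).
Hypothesis FU : UltraFilter F.

Definition uzero : {pred I -> k} := fun f => `[< F [set i | f i = 0]%classic >].

Lemma uzeroP f : reflect (F [set i | f i = 0]%classic) (f \in uzero).
Proof. exact: asboolP. Qed.

Lemma uzero_ideal : @idealr_closed (I -> k) uzero.
Proof.
split=> [||f g h /uzeroP gz /uzeroP hz].
- by apply/uzeroP; apply: filterS (@filterT _ F _) => i _.
- apply/negP => /uzeroP F0; apply: (@filter_not_empty _ F).
  by apply: filterS F0 => i /eqP; rewrite oner_eq0.
- apply/uzeroP; apply: filterS (filterI gz hz) => i /= [gi hi].
  by rewrite [LHS](_ : _ = f i * g i + h i) // gi hi mulr0 addr0.
Qed.

HB.instance Definition _ := isIdealr.Build (I -> k) uzero uzero_ideal.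

Definition uideal : idealr (I -> k) := uzero.
Definition ultrapower := {ideal_quot uideal}.
HB.instance Definition _ := GRing.ComNzRing.on ultrapower.

Definition upi : (I -> k) -> ultrapower := \pi_ultrapower.

Lemma upiP f g : reflect (F [set i | f i = g i]%classic) (upi f == upi g).
Proof.
rewrite /upi eqmodE /= Quotient.equivE.
apply: (iffP (uzeroP _)); apply: filterS => i /=.
  by rewrite [LHS](_ : _ = f i - g i) // => /eqP; rewrite subr_eq0 => /eqP.
by move=> fg; rewrite [LHS](_ : _ = f i - g i) // fg subrr.
Qed.

Lemma upiK x : upi (repr x) = x.
Proof. exact: reprK. Qed.

Lemma upi_add f g : upi (fun i => f i + g i) = upi f + upi g.
Proof. exact: (@pi_addr _ _ _ _ _ ultrapower f g). Qed.

Lemma upi_mul f g : upi (fun i => f i * g i) = upi f * upi g.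
Proof. exact: (@Quotient.pi_mul _ uideal f g). Qed.

Lemma upi_cst0 : upi (fun=> 0) = 0.
Proof. exact: (@pi_zeror _ _ _ _ _ ultrapower). Qed.

Lemma upi_cst1 : upi (fun=> 1) = 1.
Proof. exact: (@pi_oner _ _ _ _ _ _ _ ultrapower). Qed.

Definition uinv (x : ultrapower) : ultrapower := upi (fun i => (repr x i)^-1).

Lemma uinv_mul (x : ultrapower) : x != 0 -> uinv x * x = 1.
Proof.
move=> x0; have {}x0 : upi (repr x) != upi (fun=> 0) by rewrite upi_cst0 upiK.
rewrite -{2}[x]upiK /uinv -upi_mul -upi_cst1.
apply/eqP/upiP; have [|] := in_ultra_setVsetC [set i | repr x i = 0]%classic FU.
  by move/upiP => x0'; rewrite x0' in x0.
by apply: filterS => i /= /eqP xi; rewrite mulVf.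
Qed.

Lemma uinv0 : uinv 0 = 0.
Proof.
rewrite -{2}upi_cst0; apply/eqP/upiP.
have /upiP : upi (repr (0 : ultrapower)) == upi (fun=> 0).
  by rewrite upi_cst0 upiK.
by apply: filterS => i /= ->; rewrite invr0.
Qed.

HB.instance Definition _ := GRing.ComNzRing_isField.Build ultrapower uinv_mul uinv0.

Definition usat (e : seq ultrapower) (f : GRing.formula ultrapower) : bool :=
  `[< GRing.holds e f >].

Lemma usatP : GRing.decidable_field_axiom usat.
Proof. by move=> e f; exact: asboolP. Qed.

HB.instance Definition _ := GRing.Field_isDecField.Build ultrapower usatP.

Lemma upi_sum (n : nat) (f : 'I_n -> I -> k) :
  upi (fun i => \sum_(j < n) f j i) = \sum_(j < n) upi (f j).
Proof.
elim: n f => [|n IH] f.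
  by rewrite big_ord0 -upi_cst0; congr upi; apply/funext => i; rewrite big_ord0.
rewrite big_ord_recl -IH -upi_add; congr upi; apply/funext => i.
by rewrite big_ord_recl.
Qed.

Lemma upi_exp (f : I -> k) n : upi (fun i => f i ^+ n) = upi f ^+ n.
Proof.
elim: n => [|n IH]; first by rewrite expr0 -upi_cst1; congr upi.
by rewrite exprS -IH -upi_mul; congr upi; apply/funext => i; rewrite exprS.
Qed.

(** A monic equation over the ultrapower is represented by monic equations of the same degree at
    every index; roots chosen index by index form a root. *)
Lemma ultrapower_closed : GRing.closed_field_axiom ultrapower.
Proof.
move=> n P n0.
have ex i : {x : k | x ^+ n = \sum_(j < n) repr (P j) i * x ^+ j}.
  by apply: cid; exact: (@solve_monicpoly k n (fun j => repr (P j) i) n0).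
exists (upi (fun i => sval (ex i))).
rewrite -upi_exp (_ : (fun i => _) =
  (fun i => \sum_(j < n) repr (P j) i * sval (ex i) ^+ j)); last first.
  by apply/funext => i; exact: (svalP (ex i)).
rewrite (upi_sum (fun (j : 'I_n) i => repr (P j) i * sval (ex i) ^+ j)).
apply: eq_bigr => j _.
rewrite (upi_mul (repr (P j)) (fun i => sval (ex i) ^+ j)) upi_exp.
by rewrite upiK.
Qed.

HB.instance Definition _ :=
  GRing.DecField_isAlgClosed.Build ultrapower ultrapower_closed.

Definition ucst (c : k) : ultrapower := upi (fun=> c).

Lemma ucst_zmod : zmod_morphism ucst.
Proof.
move=> c d; apply/eqP; rewrite eq_sym subr_eq eq_sym /ucst -upi_add.
by apply/eqP; congr upi; apply/funext => i; rewrite subrK.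
Qed.

Lemma ucst_monoid : monoid_morphism ucst.
Proof. by split=> [|c d]; [exact: upi_cst1|rewrite /ucst -upi_mul]. Qed.

HB.instance Definition _ := GRing.isZmodMorphism.Build k ultrapower ucst ucst_zmod.
HB.instance Definition _ := GRing.isMonoidMorphism.Build k ultrapower ucst ucst_monoid.

End Ultrapower.

Theorem ultrapower_ex (k : closedFieldType) (I : pointedType) (F : set_system I) :
  UltraFilter F ->
  exists (K : closedFieldType) (iota : {rmorphism k -> K}) (p : (I -> k) -> K),
    [/\ forall f g, p (fun i => f i + g i) = p f + p g,
        forall f g, p (fun i => f i * g i) = p f * p g,
        forall c, p (fun=> c) = iota c &
        forall f g, p f = p g <-> F [set i | f i = g i]%classic].
Proof.
move=> FU; exists (@ultrapower k I F FU), (@ucst k I F FU), (@upi k I F FU); split=> //.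
- exact: upi_add.
- exact: upi_mul.
- by move=> f g; split => [/eqP/upiP|/upiP/eqP].
Qed.

(** * Partial homomorphisms and extension of places *)

(* The graph of a ring homomorphism from a subring of [K1] to [K2]. *)
Record phom (K1 K2 : fieldType) (G : K1 -> K2 -> Prop) : Prop := Phom {
  phom1 : G 1 1;
  phomB : forall x a y b, G x a -> G y b -> G (x - y) (a - b);
  phomM : forall x a y b, G x a -> G y b -> G (x * y) (a * b);
  phom_fun : forall a, G 0 a -> a = 0 }.

Section PhomTheory.
Variables (K1 K2 : fieldType) (G : K1 -> K2 -> Prop).
Hypothesis hG : phom G.

Lemma phom0 : G 0 0.
Proof. by have := phomB hG (phom1 hG) (phom1 hG); rewrite !subrr. Qed.

Lemma phomN x a : G x a -> G (- x) (- a).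
Proof. by move=> /(phomB hG phom0); rewrite !sub0r. Qed.

Lemma phomD x a y b : G x a -> G y b -> G (x + y) (a + b).
Proof. by move=> gx /phomN/(phomB hG gx); rewrite !opprK. Qed.

Lemma phom_inj x a b : G x a -> G x b -> a = b.
Proof.
move=> ga gb; apply/eqP; rewrite -subr_eq0; apply/eqP/(phom_fun hG).
by rewrite -(subrr x); exact: (phomB hG).
Qed.

Lemma phom_sum (I : Type) (r : seq I) (P : pred I) (F : I -> K1) (F' : I -> K2) :
  (forall i, P i -> G (F i) (F' i)) ->
  G (\sum_(i <- r | P i) F i) (\sum_(i <- r | P i) F' i).
Proof. by move=> h; elim/big_ind2: _ => //; [exact: phom0|move=> *; exact: phomD]. Qed.

Lemma phomX x a n : G x a -> G (x ^+ n) (a ^+ n).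
Proof.
by move=> gx; elim: n => [|n IH]; rewrite ?expr0 ?exprS; [exact: (phom1 hG)|exact: (phomM hG)].
Qed.

Lemma phomV x a b : G x a -> G x^-1 b -> a != 0 -> b = a^-1.
Proof.
move=> gx gx' a0; have x0 : x != 0.
  by apply: contra_neq a0 => x0; rewrite x0 in gx; exact: (phom_fun hG).
apply: (mulfI a0); rewrite mulfV //; apply: (phom_inj _ (phom1 hG)).
by rewrite -(mulfV x0); exact: (phomM hG).
Qed.

Lemma phom_mulmx m n p (A : 'M[K1]_(m, n)) (B : 'M[K1]_(n, p))
    (A' : 'M[K2]_(m, n)) (B' : 'M[K2]_(n, p)) :
  (forall i j, G (A i j) (A' i j)) -> (forall i j, G (B i j) (B' i j)) ->
  forall i j, G ((A *m B) i j) ((A' *m B') i j).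
Proof.
by move=> hA hB i j; rewrite !mxE; apply: phom_sum => l _; exact: (phomM hG).
Qed.

Definition ppoly (P : {poly K1}) (Q : {poly K2}) := forall i, G P`_i Q`_i.

Lemma ppolyC x a : G x a -> ppoly x%:P a%:P.
Proof. by move=> gx i; rewrite !coefC; case: ifP => // _; exact: phom0. Qed.

Lemma ppolyX : ppoly 'X 'X.
Proof. by move=> i; rewrite !coefX; case: eqP => _; [exact: (phom1 hG)|exact: phom0]. Qed.

Lemma ppolyB P Q P' Q' : ppoly P Q -> ppoly P' Q' -> ppoly (P - P') (Q - Q').
Proof. by move=> h h' i; rewrite !coefB; exact: (phomB hG). Qed.

Lemma ppolyM P Q P' Q' : ppoly P Q -> ppoly P' Q' -> ppoly (P * P') (Q * Q').
Proof.
by move=> h h' i; rewrite !coefM; apply: phom_sum => j _; exact: (phomM hG).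
Qed.

Lemma ppoly_prod (I : Type) (r : seq I) (P : pred I) (F : I -> {poly K1}) F' :
  (forall i, P i -> ppoly (F i) (F' i)) ->
  ppoly (\prod_(i <- r | P i) F i) (\prod_(i <- r | P i) F' i).
Proof.
move=> h; elim/big_ind2: _ => //; last by move=> *; exact: ppolyM.
exact: (ppolyC (phom1 hG)).
Qed.

Lemma ppoly_horner P Q x a : ppoly P Q -> G x a -> G P.[x] Q.[a].
Proof.
move=> h gx; rewrite (horner_coef_wide x (leq_maxl (size P) (size Q))).
rewrite (horner_coef_wide a (leq_maxr (size P) (size Q))).
by apply: phom_sum => i _; apply: (phomM hG); [exact: h|exact: phomX].
Qed.

End PhomTheory.

(** * Chevalley's extension theorem *)

Section Chevalley.
Variables (k : closedFieldType) (K : fieldType) (iota : {rmorphism k -> K}).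

Section Maximal.
Variable (G : K -> k -> Prop).
Hypothesis (hG : phom G) (Gk : forall c, G (iota c) c).
Hypothesis Gmax : forall G', phom G' -> (forall x a, G x a -> G' x a) ->
  forall x a, G' x a -> G x a.

(** Fractions whose denominator has nonzero value form a larger partial homomorphism, so by
    maximality they are already in the domain, which is a local ring. *)
Lemma maximal_local x a : G x a -> a != 0 -> G x^-1 a^-1.
Proof.
have den0 u c : G u c -> c != 0 -> u != 0.
  by move=> gu; apply: contra_neq => u0; rewrite u0 in gu; exact: (phom_fun hG).
pose G' x a := exists y b u c, [/\ G y b, G u c, c != 0, x = y / u & a = b / c].
suff hG' : phom G'.
  move=> gx a0; apply: (Gmax hG').
    move=> y b gy; exists y, b, 1, 1; split; rewrite ?divr1 ?oner_eq0 //.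
    exact: (phom1 hG).
  by exists 1, 1, x, a; split; rewrite ?div1r //; exact: (phom1 hG).
split.
- by exists 1, 1, 1, 1; split; rewrite ?divr1 ?oner_eq0 //; exact: (phom1 hG).
- move=> _ _ _ _ [y [b [u [c [gy gu c0 -> ->]]]]] [y' [b' [u' [c' [gy' gu' c0' -> ->]]]]].
  exists (y * u' - y' * u), (b * c' - b' * c), (u * u'), (c * c'); split.
  + by apply: (phomB hG); exact: (phomM hG).
  + exact: (phomM hG).
  + by rewrite mulf_neq0.
  + by rewrite -mulNr addf_div ?(den0 _ _ gu) ?(den0 _ _ gu') // mulNr.
  + by rewrite -mulNr addf_div // mulNr.
- move=> _ _ _ _ [y [b [u [c [gy gu c0 -> ->]]]]] [y' [b' [u' [c' [gy' gu' c0' -> ->]]]]].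
  exists (y * y'), (b * b'), (u * u'), (c * c'); split.
  + exact: (phomM hG).
  + exact: (phomM hG).
  + by rewrite mulf_neq0.
  + by rewrite mulf_div.
  + by rewrite mulf_div.
- move=> _ [y [b [u [c [gy gu c0 /esym/eqP yu ->]]]]].
  move: yu; rewrite mulf_eq0 invr_eq0 (negbTE (den0 _ _ gu c0)) orbF => /eqP y0.
  by rewrite y0 in gy; rewrite (phom_fun hG gy) mul0r.
Qed.

(** [J] is the ideal of reductions of the polynomials over the domain that vanish at [x]. At a
    common root [al] of [J], sending [x] to [al] would extend [G], against maximality; without
    common roots [J] is the unit ideal, as [k] is algebraically closed. *)
Lemma maximal_relation x : ~ (exists a, G x a) ->
  exists2 P, ppoly G P 1 & P.[x] = 0.
Proof.
move=> xG; pose J Q := exists2 P, ppoly G P Q & P.[x] = 0.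
have pC Q : ppoly G (map_poly iota Q) Q by move=> i; rewrite coef_map; exact: Gk.
have Jroot al : exists2 Q, J Q & Q.[al] != 0.
  apply: contrapT => nJ.
  pose G' y b := exists P Q, [/\ ppoly G P Q, y = P.[x] & b = Q.[al]].
  have hG' : phom G'.
    split.
    - exists 1, 1; rewrite !hornerC; split=> //; exact: (ppolyC hG (phom1 hG)).
    - move=> _ _ _ _ [P [Q [h -> ->]]] [P' [Q' [h' -> ->]]].
      by exists (P - P'), (Q - Q'); rewrite !hornerE; split=> //; exact: (ppolyB hG).
    - move=> _ _ _ _ [P [Q [h -> ->]]] [P' [Q' [h' -> ->]]].
      by exists (P * P'), (Q * Q'); rewrite !hornerE; split=> //; exact: (ppolyM hG).
    - move=> _ [P [Q [h /esym Px ->]]]; apply/eqP; apply: contrapT => /negP Q0.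
      by apply: nJ; exists Q => //; exists P.
  apply: xG; exists al; apply: (Gmax hG').
    by move=> y b gy; exists y%:P, b%:P; rewrite !hornerC; split=> //; exact: (ppolyC hG).
  by exists 'X, 'X; rewrite !hornerX; split=> //; exact: (ppolyX hG).
have JB Q Q' : J Q -> J Q' -> J (Q - Q').
  move=> [P h Px] [P' h' Px']; exists (P - P'); first exact: (ppolyB hG).
  by rewrite !hornerE Px Px' subrr.
have JM Q Q' : J Q -> J (Q' * Q).
  move=> [P h Px]; exists (map_poly iota Q' * P); first exact: (ppolyM hG).
  by rewrite !hornerE Px mulr0.
(* A member of least degree in [J] divides every other one, by division with remainder. *)
have exn : exists n, `[< exists Q, [/\ J Q, Q != 0 & size Q = n] >].
  have [Q JQ Q0] := Jroot 0; exists (size Q); apply/asboolP; exists Q; split=> //.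
  by apply: contra_neq Q0 => ->; rewrite horner0.
case: (ex_minnP exn) => n /asboolP[Q [JQ Q0 sQ]] nmin.
have [/size_poly1P[c c0 Qc]|] := boolP (size Q == 1%N).
  by have [P h Px] := JM _ (c^-1)%:P JQ; exists P => //; rewrite Qc -polyCM mulVf in h.
move=> /closed_rootP[al ral]; have [Q' JQ' Q'al] := Jroot al.
have JQQ : J (Q' %% Q) by rewrite (_ : Q' %% Q = Q' - Q' %/ Q * Q); [apply/JB/JM|rewrite {2}(divp_eq Q' Q) addrC addKr].
have [/modp_eq0P Qd|Qn] := eqVneq (Q' %% Q) 0.
  by case/negP: Q'al; apply: (root_dvdp Qd).
have := nmin (size (Q' %% Q)); rewrite leqNgt -sQ ltn_modp Q0 => /(_ _)/negP[] //.
by apply/asboolP; exists (Q' %% Q).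
Qed.

(* Chevalley's lemma: the maximal ideal cannot generate the unit ideal both in [R[x]] and in
   [R[1/x]], since the relation of larger degree can be shortened by means of the other one. *)
Lemma no_relation N n m (x : K) : (n + m <= N)%N -> x != 0 ->
  (exists P : {poly K}, [/\ (size P <= n.+1)%N, ppoly G P 1 & P.[x] = 0]) ->
  (exists P : {poly K}, [/\ (size P <= m.+1)%N, ppoly G P 1 & P.[x^-1] = 0]) -> False.
Proof.
elim: N n m x => [|N IH] n m x; last first.
  wlog mn : n m x / (m <= n)%N.
    move=> H; case: (leqP m n) => [|/ltnW] mn; first exact: H.
    move=> nm x0 ex ex'; apply: (H m n x^-1) => //; first by rewrite addnC.
      by rewrite invr_eq0.
    by rewrite invrK.
  case: n mn => [|n].
    by rewrite leqn0 => /eqP -> _; exact: IH.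
  move=> mn nm x0 [P [sP hP Px]] [P' [sP' hP' Px']].
  apply: (IH n m x) => //; last by exists P'.
  (* This is [x^m P'(1/x)]: the relation for [1/x] becomes one for [x] whose leading coefficient,
     the constant term of [P'], is a unit. *)
  pose Q := \poly_(i < m.+1) P'`_(m - i).
  have p0 : G P'`_0 1 by have := hP' 0%N; rewrite coef1.
  have p0' : G (P'`_0)^-1 1.
    by rewrite -[X in G _ X]invr1; apply: maximal_local; rewrite ?oner_eq0.
  have p0N : P'`_0 != 0.
    by apply/eqP => p00; rewrite p00 in p0; have /eqP := phom_fun hG p0; rewrite oner_eq0.
  have Qx : Q.[x] = 0.
    transitivity (x ^+ m * P'.[x^-1]); last by rewrite Px' mulr0.
    rewrite (horner_coef_wide x (size_poly m.+1 _)) (horner_coef_wide _ sP').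
    rewrite mulr_sumr (reindex_inj rev_ord_inj) /=; apply: eq_bigr => i _.
    have im : (i <= m)%N by rewrite -ltnS.
    rewrite coef_poly subSS ltnS leq_subr subKn // mulrCA; congr (_ * _).
    by rewrite exprVn -[X in x ^+ X / _](subnK im) exprD mulfK // expf_neq0.
  (* The coefficient of degree [n.+1] has value 0, since [P] reduces to the constant 1; the
     subtraction removes it without changing the reduction. *)
  exists (P - (P`_n.+1 / P'`_0) *: ('X^(n.+1 - m) * Q)); split.
  - apply/leq_sizeP => j; rewrite leq_eqVlt => /predU1P[<-|nj]; rewrite coefB coefZ coefXnM.
      rewrite ltnNge leq_subr /= subKn // coef_poly ltnSn subnn divfK // subrr //.
    rewrite ltnNge (leq_trans (leq_subr _ _) (ltnW nj)) /= coef_poly ltnS leq_subLR.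
    by rewrite subnK // leqNgt nj /= mulr0 subr0 nth_default // (leq_trans sP).
  - have hQ : ppoly G Q (\poly_(i < m.+1) (1 : {poly k})`_(m - i)).
      by move=> j; rewrite !coef_poly; case: ifP => _; [exact: hP'|exact: (phom0 hG)].
    have hc : G (P`_n.+1 / P'`_0) 0.
      by rewrite -(mul0r (1 : k)); apply: (phomM hG) => //; have := hP n.+1; rewrite coef1.
    have hX : ppoly G 'X^(n.+1 - m) 'X^(n.+1 - m).
      by move=> j; rewrite !coefXn; case: eqP => _; [exact: (phom1 hG)|exact: (phom0 hG)].
    have := ppolyB hG hP (ppolyM hG (ppolyC hG hc) (ppolyM hG hX hQ)).
    by rewrite mul_polyC polyC0 mul0r subr0.
  - by rewrite hornerD hornerN hornerZ hornerM Px Qx !mulr0 subr0.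
(* For [N = 0] the polynomial [P] is a constant of value 1 and cannot vanish at [x]. *)
rewrite leqn0 addn_eq0 => /andP[/eqP -> _] x0 [P [/size1_polyC -> hP Px]] _.
have := hP 0%N; rewrite coefC coef1 /= -[X in G X](hornerC _ x) Px.
by move/(phom_fun hG)/eqP; rewrite oner_eq0.
Qed.

(** If [x] is outside the domain and [1/x] does not have value 0, then [1/x] is outside too, the
    domain being local; both then satisfy relations, which [no_relation] excludes. *)
Lemma maximal_place x : (exists a, G x a) \/ G x^-1 0.
Proof.
have [->|x0] := eqVneq x 0; first by right; rewrite invr0; exact: (phom0 hG).
apply: contrapT => /not_orP[xG xG'].
have /maximal_relation[P' hP' Px'] : ~ exists a, G x^-1 a.
  move=> [a ga]; have [a0|a0] := eqVneq a 0; first by rewrite a0 in ga.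
  by apply: xG; exists a^-1; rewrite -[x]invrK; exact: maximal_local.
have [P hP Px] := maximal_relation xG.
apply: (@no_relation _ (size P) (size P') x (leqnn _)) => //.
  by exists P; split.
by exists P'; split.
Qed.

End Maximal.

Theorem place_extension (G0 : K -> k -> Prop) :
  phom G0 -> (forall c, G0 (iota c) c) ->
  exists G, [/\ phom G, forall x a, G0 x a -> G x a &
    forall x, (exists a, G x a) \/ G x^-1 0].
Proof.
move=> hG0 G0k.
(* The alternative [set0] is only there for the empty chain. *)
pose P (S : set (K * k)) := S = set0 \/
  (phom (fun x a => S (x, a)) /\ forall x a, G0 x a -> S (x, a)).
have [|S [PS Smax]] := @Zorn_bigcup _ P.
  move=> F FP Ftot; have [[S0 FS0 S0n]|nF] := pselect (exists2 S, F S & S <> set0); last first.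
    left; apply/seteqP; split=> // xa [S FS Sxa].
    by apply: nF; exists S => // S0; rewrite S0 in Sxa.
  right; have hS S : F S -> forall y, S y -> P S /\ S <> set0.
    by move=> FS y Sy; split; [exact: FP|move=> S_0; rewrite S_0 in Sy].
  have two y y' : (\bigcup_(X in F) X)%classic y -> (\bigcup_(X in F) X)%classic y' ->
      exists S, [/\ F S, S y, S y' & phom (fun x a => S (x, a))].
    move=> [S FS Sy] [S' FS' Sy']; have [SS'|S'S] := Ftot _ _ FS FS'.
      exists S'; split=> //; first exact: SS'.
      by have [[//|[]//]] := hS _ FS' _ Sy'.
    exists S; split=> //; first exact: S'S.
    by have [[//|[]//]] := hS _ FS _ Sy.
  have [//|[hS0 GS0]] := FP _ FS0; split; last by move=> x a g0; exists S0 => //; exact: GS0.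
  split.
  - by exists S0 => //; exact: (phom1 hS0).
  - move=> x a y b gx gy; have [S [FS Sx Sy hSS]] := two _ _ gx gy.
    by exists S => //; exact: (phomB hSS).
  - move=> x a y b gx gy; have [S [FS Sx Sy hSS]] := two _ _ gx gy.
    by exists S => //; exact: (phomM hSS).
  - by move=> a g0; have [S [FS Sx _ hSS]] := two _ _ g0 g0; exact: (phom_fun hSS).
have [hS GS] : phom (fun x a => S (x, a)) /\ forall x a, G0 x a -> S (x, a).
  case: PS => // S0; exfalso; apply: (Smax (fun xa => G0 xa.1 xa.2)); last by right; split.
  rewrite S0; split=> // /(_ (1, 1)); apply; exact: (phom1 hG0).
exists (fun x a => S (x, a)); split=> //; apply: maximal_place => //.
  by move=> c; exact: GS.
move=> G' hG' SG' x a; have [//|Sxa g'] := pselect (S (x, a)); exfalso.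
apply: (Smax (fun xa => G' xa.1 xa.2)); last first.
  by right; split => // y b /GS; exact: SG'.
split; first by move=> [y b]; exact: SG'.
by move=> /(_ (x, a) g').
Qed.

End Chevalley.

(** * Approximation with respect to a place *)

(* [G] is the graph of a place of [K] with values in [k]: [G x 0] says that [x] lies in the
   maximal ideal of its valuation ring. *)
Record is_place (k K : fieldType) (iota : k -> K) (G : K -> k -> Prop) : Prop := IsPlace {
  place_phom : phom G;
  place_const : forall c, G (iota c) c;
  place_total : forall x, (exists a, G x a) \/ G x^-1 0 }.

Section PlaceTheory.
Variables (k K : fieldType) (iota : {rmorphism k -> K}) (G : K -> k -> Prop).
Hypothesis pG : is_place iota G.
Let hG := place_phom pG.

(* [vlt x y]: the valuation of [x] is smaller than that of [y]; [veq]: they are equal. *)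
Definition vlt x y := x != 0 /\ G (y / x) 0.
Definition veq x y := exists2 a, a != 0 & G (x / y) a.

Lemma place0N1 : ~ G 1 0.
Proof. by move/(phom_inj hG (phom1 hG))/eqP; rewrite oner_eq0. Qed.

Lemma place_unit x a : G x a -> a != 0 -> x != 0 /\ G x^-1 a^-1.
Proof.
move=> gx a0; have x0 : x != 0.
  by apply: contra_neq a0 => x0; rewrite x0 in gx; exact: (phom_fun hG).
split=> //; have [[b gb]|] := place_total pG x^-1.
  by rewrite -(phomV hG gx gb a0).
by rewrite invrK => /(phom_inj hG gx) ax; rewrite ax eqxx in a0.
Qed.

Lemma placeMl x y : (exists a, G x a) -> G y 0 -> G (x * y) 0.
Proof. by move=> [a gx] gy; rewrite -(mulr0 a); exact: (phomM hG). Qed.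

Lemma place_nunit x : ~ G x 0 -> exists a, G x^-1 a.
Proof.
move=> nx; have [[a gx]|gx] := place_total pG x; last by exists 0.
have [a0|a0] := eqVneq a 0; first by rewrite a0 in gx.
by exists a^-1; have [] := place_unit gx a0.
Qed.

Lemma place_exp0 x n : G (x ^+ n) 0 -> G x 0.
Proof.
move=> gx; apply: contrapT => nx; apply: place0N1.
have x0 : x != 0 by apply/eqP => x0; apply: nx; rewrite x0; exact: (phom0 hG).
rewrite -(mulVf (expf_neq0 n x0)) -exprVn; apply: placeMl => //.
by have [a ga] := place_nunit nx; exists (a ^+ n); exact: phomX.
Qed.

Lemma vlt_irr x : ~ vlt x x.
Proof. by move=> [x0]; rewrite divff //; exact: place0N1. Qed.

Lemma vlt_trans y x z : vlt x y -> vlt y z -> vlt x z.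
Proof.
move=> [x0 xy] [y0 yz]; split=> //; rewrite -(divfK y0 z) -mulrA.
by apply: placeMl xy; exists 0.
Qed.

Lemma vlt_total x y : x != 0 -> y != 0 -> [\/ vlt x y, vlt y x | veq x y].
Proof.
move=> x0 y0; have [[a gx]|] := place_total pG (x / y); last first.
  by rewrite invf_div => gx; constructor 1.
have [a0|a0] := eqVneq a 0; first by constructor 2; rewrite a0 in gx.
by constructor 3; exists a.
Qed.

Lemma vlt0 x : x != 0 -> vlt x 0.
Proof. by split=> //; rewrite mul0r; exact: (phom0 hG). Qed.

Lemma veq_refl x : x != 0 -> veq x x.
Proof. by move=> x0; exists 1; rewrite ?oner_eq0 ?divff //; exact: (phom1 hG). Qed.

Lemma veq_neq0 x y : veq x y -> x != 0 /\ y != 0.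
Proof.
move=> [a a0 /place_unit/(_ a0)[]]; rewrite mulf_eq0 invr_eq0 => /norP[//].
Qed.

Lemma veq_sym x y : veq x y -> veq y x.
Proof.
move=> [a a0 /place_unit/(_ a0)[_]]; rewrite invf_div => gx.
by exists a^-1; rewrite ?invr_eq0.
Qed.

Lemma veq_trans y x z : veq x y -> veq y z -> veq x z.
Proof.
move=> xy yz; have [_ y0] := veq_neq0 xy; move: xy yz => [a a0 xy] [b b0 yz].
by exists (a * b); rewrite ?mulf_neq0 // -(divfK y0 x) -mulrA; exact: (phomM hG).
Qed.

Lemma veq_mul x y x' y' : veq x y -> veq x' y' -> veq (x * x') (y * y').
Proof.
move=> [a a0 xy] [b b0 yz]; exists (a * b); rewrite ?mulf_neq0 //.
by rewrite -mulf_div; exact: (phomM hG).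
Qed.

Lemma vlt_veql x x' y : veq x x' -> vlt x y -> vlt x' y.
Proof.
move=> xx [x0 xy]; have [_ x0'] := veq_neq0 xx; split=> //.
rewrite -(divfK x0 y) -mulrA mulrC; apply: placeMl xy.
by case: xx => a _ ?; exists a.
Qed.

Lemma vlt_veqr x y y' : veq y y' -> vlt x y -> vlt x y'.
Proof.
move=> /veq_sym yy [x0 xy]; have [_ y0] := veq_neq0 yy; split=> //.
rewrite -(divfK y0 y') -mulrA; apply: placeMl xy.
by case: yy => a _ ?; exists a.
Qed.

Lemma veq_addl x y : vlt x y -> veq (x + y) x.
Proof.
move=> [x0 xy]; exists 1; rewrite ?oner_eq0 // mulrDl divff //.
by have := phomD hG (phom1 hG) xy; rewrite addr0.
Qed.

Lemma vlt_max (T : eqType) (f : T -> K) (x : T) (l : seq T) :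
  exists2 m, m \in x :: l & forall y, y \in x :: l -> ~ vlt (f m) (f y).
Proof.
elim: l x => [|a l IH] x.
  by exists x; rewrite ?mem_head // => y; rewrite inE => /eqP ->; exact: vlt_irr.
have [m ml mP] := IH a; have [mx|mx] := pselect (vlt (f m) (f x)).
  exists x; rewrite ?mem_head // => y; rewrite inE => /predU1P[->|yl]; first exact: vlt_irr.
  by move=> /(vlt_trans mx); exact: mP.
exists m; first by rewrite inE ml orbT.
by move=> y; rewrite inE => /predU1P[->//|]; exact: mP.
Qed.

End PlaceTheory.

(** In an algebraically closed [K] such an [S] is algebraically closed itself, so that polynomials
    over [S] split with roots in [S]. *)
Definition relatively_closed (K : fieldType) (S : {pred K}) :=
  forall p x, p \is a polyOver S -> p != 0 -> root p x -> x \in S.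

Section Approximation.
Variables (k : fieldType) (K : closedFieldType) (iota : {rmorphism k -> K}).
Variables (G : K -> k -> Prop) (S : divringClosed K).
Hypothesis pG : is_place iota G.
Hypothesis Sk : forall c, iota c \in S.
Hypothesis Scl : relatively_closed S.
Variable tau : K.
Hypotheses (Stau : tau \in S) (tau0 : tau != 0) (gtau : G tau 0).
Let hG := place_phom pG.
Notation vlt := (vlt G).
Notation veq := (veq G).

Lemma relatively_closed_factor p : p \is a polyOver S -> p != 0 ->
  exists2 rs : seq K, {subset rs <= S} & p = lead_coef p *: \prod_(r <- rs) ('X - r%:P).
Proof.
move=> Sp p0; have [rs Ep] := closed_field_poly_normal p; exists rs => // r rrs.
apply: (Scl Sp p0); rewrite Ep rootZ ?lead_coef_eq0 // root_prod_XsubC //.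
Qed.

Lemma relatively_closed_root n c : (0 < n)%N -> c \in S -> c != 0 ->
  exists f, [/\ f \in S, f != 0 & f ^+ n = c].
Proof.
move=> n0 Sc c0; have szp : size ('X^n - c%:P) = n.+1 by exact: size_XnsubC.
have /closed_rootP[f rf] : size ('X^n - c%:P) != 1%N by rewrite szp -lt0n; case: (n) n0.
have Ef : f ^+ n = c by apply/eqP; move: rf; rewrite rootE !hornerE subr_eq0.
exists f; split=> //; last by apply: contra_neq c0 => f0; rewrite -Ef f0 expr0n; case: (n) n0.
apply: Scl rf; first by rewrite rpredB ?rpredX ?polyOverX ?polyOverC.
by rewrite -size_poly_eq0 szp.
Qed.

Lemma factor_all (L : seq {poly K}) : {in L, forall p, p \is a polyOver S} ->
  exists2 R : seq K, {subset R <= S} & {in L, forall p, p != 0 ->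
    exists2 rs : seq K, {subset rs <= R} & p = lead_coef p *: \prod_(r <- rs) ('X - r%:P)}.
Proof.
elim: L => [|p L IH] SL; first by exists [::].
have [|R RS RL] := IH; first by move=> q qL; apply: SL; rewrite inE qL orbT.
have [p0|p0] := eqVneq p 0.
  by exists R => // q; rewrite inE => /predU1P[->|/RL//]; rewrite p0 eqxx.
have [rs rsS Ep] := relatively_closed_factor (SL p (mem_head _ _)) p0.
exists (rs ++ R); first by move=> r; rewrite mem_cat => /orP[/rsS|/RS].
move=> q; rewrite inE => /predU1P[-> _|/RL qR /qR[rs' rs'R Eq]].
  by exists rs => // r rrs; rewrite mem_cat rrs.
by exists rs' => // r /rs'R rR; rewrite mem_cat rR orbT.
Qed.

(* Every [z - a] has the valuation of an element of [S]: a point of [S] closer to [z] than all the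
   roots in play has the same distances to these roots. *)
Section Immediate.
Variable z : K.
Hypothesis zS : z \notin S.
Hypothesis zim : forall a, a \in S -> exists e, e \in S /\ veq (z - a) e.

Lemma approx_immediate (R : seq K) : {subset R <= S} ->
  exists2 z', z' \in S & forall r, r \in R -> veq (z' - r) (z - r).
Proof.
move=> RS; have [a0 a0R a0max] := vlt_max pG (fun r => z - r) 0 R.
have Sa0 : a0 \in S by move: a0R; rewrite inE => /predU1P[->|/RS//]; rewrite rpred0.
have [e [Se [u u0 gu]]] := zim Sa0.
have za0 : z - a0 != 0 by rewrite subr_eq0; apply: contraNneq zS => ->.
have e0 : e != 0 by have [] := @veq_neq0 _ _ _ _ pG (z - a0) e; [exists u|].
(* As [(z - a0) / e] has residue [u], the leading term of [z - a0] is [e * iota u]; adding it to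
   [a0] gives a point strictly closer to [z]. *)
exists (a0 + e * iota u); first by rewrite rpredD ?rpredM.
set z' := a0 + _.
have zz' : vlt (z - a0) (z - z').
  split=> //; have -> : (z - z') / (z - a0) = (z - a0)^-1 * e * ((z - a0) / e - iota u).
    have -> : z - z' = (z - a0) - e * iota u by rewrite /z' opprD addrA.
    by move: (z - a0) za0 => x x0; field; rewrite e0 x0.
  apply: (placeMl pG); last by rewrite -(subrr u); apply: (phomB hG) => //; exact: (place_const pG).
  by exists u^-1; have [_] := place_unit pG gu u0; rewrite invf_div mulrC.
move=> r rR; have nzr := a0max r; rewrite inE rR orbT in nzr; have {}nzr := nzr isT.
have zr0 : z - r != 0 by rewrite subr_eq0; apply: contraNneq zS => ->; exact: RS.
have -> : z' - r = (z - r) + - (z - z') by ring.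
apply: (veq_addl pG) => //; split=> //; rewrite mulNr -[X in G _ X]oppr0; apply: (phomN hG).
have -> : (z - z') / (z - r) = (z - a0) / (z - r) * ((z - z') / (z - a0)).
  by rewrite [RHS]mulrC mulrA divfK.
apply: (placeMl pG); last by case: zz'.
have [[a ga]|gi] := place_total pG ((z - a0) / (z - r)); first by exists a.
by case: nzr; split=> //; rewrite -invf_div.
Qed.

End Immediate.

(* The valuation of [z - a0] is not attained on [S]: polynomials behave like monomials in [z - a0],
   and [z - a0] may be replaced by any element of [S] in the same cut of the value group. *)
Section NonImmediate.
Variables (z a0 : K).
Hypothesis Sa0 : a0 \in S.
Let w := z - a0.
Hypothesis w0 : w != 0.
Hypothesis wS : forall e, e \in S -> ~ veq w e.

(* [e] and [w] lie in the same cut with respect to [d]. *)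
Definition same_side e d := (vlt w d -> vlt e d) /\ (vlt d w -> vlt d e).

Lemma same_side_total d : d \in S -> d != 0 -> vlt w d \/ vlt d w.
Proof.
by move=> Sd d0; have [|| /wS] := vlt_total pG w0 d0; [left|right|].
Qed.

(** The elements of [fs] lie below or above [w] in valuation. The square root of the product of the
    nearest ones, [l] and [u], lies strictly between them; if one side is empty, [l * tau] or
    [u / tau] goes past the other. *)
Lemma same_side_dense (fs : seq K) : {in fs, forall f, f \in S /\ f != 0} ->
  exists e, [/\ e \in S, e != 0 & {in fs, forall f, same_side e f}].
Proof.
move=> fsS.
have lo : (exists l, [/\ l \in S, vlt l w & {in fs, forall f, vlt f w -> ~ vlt l f}]) \/
    {in fs, forall f, ~ vlt f w}.
  have [[f0 f0fs f0w]|nf] := pselect (exists2 f, f \in fs & vlt f w); last first.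
    by right=> f ffs fw; apply: nf; exists f.
  left; pose gs := [seq f <- fs | `[< vlt f w >]].
  have [m mg mmax] := vlt_max pG id f0 gs.
  have [mfs mw] : m \in fs /\ vlt m w.
    move: mg; rewrite inE => /predU1P[->//|]; rewrite mem_filter => /andP[/asboolP]//.
  exists m; split=> //; first by have [] := fsS m mfs.
  by move=> f ffs /asboolP fw; apply: mmax; rewrite inE mem_filter fw ffs orbT.
have hi : (exists u, [/\ u \in S, u != 0, vlt w u & {in fs, forall f, vlt w f -> ~ vlt f u}]) \/
    {in fs, forall f, ~ vlt w f}.
  have [[f0 f0fs f0w]|nf] := pselect (exists2 f, f \in fs & vlt w f); last first.
    by right=> f ffs fw; apply: nf; exists f.
  left; pose gs := [seq f <- fs | `[< vlt w f >]].
  have [m mg mmax] := vlt_max pG (fun x => x^-1) f0 gs.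
  have [mfs mw] : m \in fs /\ vlt w m.
    move: mg; rewrite inE => /predU1P[->//|]; rewrite mem_filter => /andP[/asboolP]//.
  have [mS m0] := fsS m mfs.
  exists m; split=> // f ffs /asboolP fw [f00 mf]; apply: (mmax f).
    by rewrite inE mem_filter fw ffs orbT.
  by split; rewrite ?invr_eq0 // invrK mulrC.
have vM f l x : f != 0 -> ~ vlt l f -> vlt l x -> vlt f x.
  move=> f0 nlf lx; have [l0 _] := lx; have [fl|//|lf] := vlt_total pG f0 l0.
    exact: (vlt_trans pG fl).
  by apply: (vlt_veql pG) lx; exact: (veq_sym pG).
have vM' f u x : f != 0 -> u != 0 -> ~ vlt f u -> vlt x u -> vlt x f.
  move=> f0 u0 nfu xu; have [//|uf|fu] := vlt_total pG f0 u0.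
    exact: (vlt_trans pG xu).
  by apply: (vlt_veqr pG) xu; exact: (veq_sym pG).
have vtau x : x != 0 -> vlt x (x * tau).
  by move=> x0; split; rewrite // mulrAC divff // mul1r.
case: lo hi => [[l [lS lw lmax]]|nl] [[u [uS u0 wu umin]]|nu].
- have [l0 _] := lw; have [|||e [eS e0 ee]] := @relatively_closed_root 2 (l * u).
  + by [].
  + exact: rpredM.
  + exact: mulf_neq0.
  have lu : G (u / l) 0 by have [] := vlt_trans pG lw wu.
  have le : vlt l e.
    split=> //; apply: (place_exp0 pG (n := 2)); rewrite expr_div_n ee.
    by rewrite expr2 -mulf_div divff // mul1r.
  have eu : vlt e u.
    split=> //; apply: (place_exp0 pG (n := 2)); rewrite expr_div_n ee.
    by rewrite expr2 -mulf_div divff // mulr1.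
  exists e; split=> // f ffs; have [fS f0] := fsS f ffs; split=> hf.
    by apply: vM' eu => //; exact: umin.
  by apply: vM le => //; exact: lmax.
- have [l0 _] := lw; exists (l * tau); split; rewrite ?rpredM ?mulf_neq0 //.
  move=> f ffs; have [fS f0] := fsS f ffs; split=> hf; first by case: (nu f ffs).
  by apply: vM (vtau _ l0) => //; exact: lmax.
- exists (u / tau); split; rewrite ?rpred_div ?mulf_neq0 ?invr_eq0 //.
  move=> f ffs; have [fS f0] := fsS f ffs; split=> hf; last by case: (nl f ffs).
  apply: (vM' f u) => //; first exact: umin.
  by have := vtau (u / tau); rewrite divfK //; apply; rewrite ?mulf_neq0 ?invr_eq0.
- exists 1; split; rewrite ?rpred1 ?oner_eq0 // => f ffs; have [fS f0] := fsS f ffs.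
  by have [/(nu f ffs)|/(nl f ffs)] := same_side_total fS f0.
Qed.

(** Each factor [e + (a0 - r)] has the valuation of its smaller summand, and the cut of [w] decides
    which one that is: [n] counts the factors led by [e], and [c] collects the other differences
    [a0 - r]. *)
Lemma leading_monomial (rs : seq K) : {subset rs <= S} ->
  exists c n, [/\ c \in S, c != 0 & forall e, e != 0 ->
    {in rs, forall r, same_side e (a0 - r)} ->
    veq (\prod_(r <- rs) (a0 + e - r)) (c * e ^+ n)].
Proof.
elim: rs => [|r rs IH] rsS.
  exists 1, 0%N; split; rewrite ?rpred1 ?oner_eq0 // => e e0 _.
  by rewrite big_nil expr0 mulr1; apply: (veq_refl pG); exact: oner_neq0.
have [|c [n [cS c0 cP]]] := IH; first by move=> x xrs; apply: rsS; rewrite inE xrs orbT.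
have Sd : a0 - r \in S by rewrite rpredB // rsS // mem_head.
have E e : a0 + e - r = e + (a0 - r) by rewrite addrAC addrC.
have hyp e : {in r :: rs, forall r, same_side e (a0 - r)} ->
    same_side e (a0 - r) /\ {in rs, forall r, same_side e (a0 - r)}.
  by move=> h; split=> [|x xrs]; apply: h; rewrite ?mem_head // inE xrs orbT.
have [d0|d0] := eqVneq (a0 - r) 0.
  exists c, n.+1; split=> // e e0 /hyp[_ he].
  rewrite big_cons E d0 addr0 exprS mulrCA; apply: (veq_mul pG); last exact: cP.
  exact: (veq_refl pG).
have [wd|dw] := same_side_total Sd d0.
  exists c, n.+1; split=> // e e0 /hyp[[he _] hes].
  rewrite big_cons E exprS mulrCA; apply: (veq_mul pG); last exact: cP.
  by apply: (veq_addl pG); exact: he.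
exists ((a0 - r) * c), n; split; rewrite ?rpredM ?mulf_neq0 // => e e0 /hyp[[_ he] hes].
rewrite big_cons E -mulrA; apply: (veq_mul pG); last exact: cP.
by rewrite addrC; apply: (veq_addl pG); exact: he.
Qed.

(** After cancellation of powers the condition compares [w] with a root [f] of [c] or of its
    inverse, which exists in [S]; only the side of [w] with respect to [f] enters. *)
Lemma monomial_cut c m n : c \in S -> c != 0 ->
  exists f, [/\ f \in S, f != 0 & forall e, e != 0 -> same_side e f ->
    G (c * w ^+ m / w ^+ n) 0 -> G (c * e ^+ m / e ^+ n) 0].
Proof.
move=> cS c0; have [mn|nm|->] := ltngtP m n; last first.
- exists 1; split; rewrite ?rpred1 ?oner_eq0 // => e e0 _.
  by rewrite !mulfK // expf_neq0.
- have [|||f [fS f0 Ef]] := @relatively_closed_root (m - n) c^-1.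
  + by rewrite subn_gt0.
  + by rewrite rpredV.
  + by rewrite invr_eq0.
  have E x : x != 0 -> c * x ^+ m / x ^+ n = (x / f) ^+ (m - n).
    move=> x0; rewrite expr_div_n Ef invrK -{1}(subnK (ltnW nm)) exprD mulrA.
    by rewrite mulfK ?expf_neq0 // mulrC.
  exists f; split=> // e e0 [_ he]; rewrite !E // => /(place_exp0 pG) gw.
  have [_ ge] : vlt f e by apply: he; split.
  by have := phomX hG (m - n) ge; rewrite expr0n subn_eq0 leqNgt nm.
have [|||f [fS f0 Ef]] := @relatively_closed_root (n - m) c.
- by rewrite subn_gt0.
- by [].
- by [].
have E x : x != 0 -> c * x ^+ m / x ^+ n = (f / x) ^+ (n - m).
  move=> x0; rewrite expr_div_n Ef -mulrA; congr (_ * _).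
  by rewrite -{1}(subnK (ltnW mn)) exprD invfM mulrCA mulfV ?expf_neq0 // mulr1.
exists f; split=> // e e0 [he _]; rewrite !E // => /(place_exp0 pG) gw.
have [_ ge] : vlt e f by apply: he; split.
by have := phomX hG (n - m) ge; rewrite expr0n subn_eq0 leqNgt mn.
Qed.

End NonImmediate.

(** As the polynomials split over [S], the conditions depend only on the valuations of the
    differences of [z] and finitely many roots. A point of [S] reproduces them exactly if every
    [z - a] has a valuation attained on [S], and up to the relevant cuts otherwise. *)
Theorem place_approximation z (L : seq ({poly K} * {poly K})) : z \notin S ->
  {in L, forall pq, [/\ pq.1 \is a polyOver S, pq.2 \is a polyOver S,
     pq.2.[z] != 0 & G (pq.1.[z] / pq.2.[z]) 0]} ->
  exists2 z', z' \in S & {in L, forall pq, pq.2.[z'] != 0 /\ G (pq.1.[z'] / pq.2.[z']) 0}.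
Proof.
move=> zS LS.
have [|R RS RL] := @factor_all (map fst L ++ map snd L).
  by move=> p; rewrite mem_cat => /orP[]/mapP[pq /LS[? ? _ _] ->].
have hornE (x : K) (p : {poly K}) (rs : seq K) : p = lead_coef p *: \prod_(r <- rs) ('X - r%:P) ->
    p.[x] = lead_coef p * \prod_(r <- rs) (x - r).
  move=> Ep; rewrite [in LHS]Ep hornerZ; congr (_ * _).
  by rewrite horner_prod; apply: eq_bigr => r _; rewrite hornerXsubC.
have [zim|] := pselect (forall a, a \in S -> exists e, e \in S /\ veq (z - a) e).
  have [z' Sz' hz'] := approx_immediate zS zim RS.
  exists z' => // -[p q] pqL; have [/= Sp Sq q0 gpq] := LS _ pqL.
  have hv u : u \in map fst L ++ map snd L -> u != 0 -> veq u.[z'] u.[z].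
    move=> uL u0; have [rs rsR Eu] := RL u uL u0.
    rewrite !(hornE _ _ _ Eu); apply: (veq_mul pG).
      by apply: (veq_refl pG); rewrite lead_coef_eq0.
    rewrite !big_seq; apply: (big_ind2 veq) => [|*|r /rsR/hz'//].
      by apply: (veq_refl pG); exact: oner_neq0.
    exact: (veq_mul pG).
  have qq : veq q.[z'] q.[z].
    apply: hv; first by rewrite mem_cat (map_f snd pqL) orbT.
    by apply: contra_neq q0 => ->; rewrite horner0.
  have [q'0 _] := veq_neq0 pG qq; split=> //.
  have [->|p0] := eqVneq p 0; first by rewrite horner0 mul0r; exact: (phom0 hG).
  have pp : veq p.[z'] p.[z] by apply: hv => //; rewrite mem_cat (map_f fst pqL).
  suff [] : vlt q.[z'] p.[z'] by [].
  apply: (vlt_veql pG (veq_sym pG qq)); apply: (vlt_veqr pG (veq_sym pG pp)).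
  by split.
move=> /existsNP[a0 /not_implyP[Sa0 nza0]].
have w0 : z - a0 != 0 by rewrite subr_eq0; apply: contraNneq zS => ->.
have wS e : e \in S -> ~ veq (z - a0) e by move=> eS ve; apply: nza0; exists e.
have mono u : u \in map fst L ++ map snd L -> u != 0 ->
    exists c n, [/\ c \in S, c != 0 & forall e, e != 0 ->
      {in R, forall r, same_side z a0 e (a0 - r)} -> veq u.[a0 + e] (c * e ^+ n)].
  move=> uL u0; have [rs rsR Eu] := RL u uL u0.
  have [|c [n [cS c0 cP]]] := @leading_monomial z a0 Sa0 w0 wS rs.
    by move=> r /rsR/RS.
  have Su : u \is a polyOver S.
    by move: uL; rewrite mem_cat => /orP[]/mapP[pq /LS[? ? _ _] ->].
  exists (lead_coef u * c), n; split.
  - by rewrite rpredM // (polyOverP Su).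
  - by rewrite mulf_neq0 ?lead_coef_eq0.
  - move=> e e0 he; rewrite (hornE _ _ _ Eu) -mulrA; apply: (veq_mul pG).
      by apply: (veq_refl pG); rewrite lead_coef_eq0.
    by apply: cP => // r /rsR; exact: he.
have q0L pq : pq \in L -> pq.2 != 0.
  by move=> /LS[_ _ q0 _]; apply: contra_neq q0 => ->; rewrite horner0.
have pair pq : pq \in L -> exists f, [/\ f \in S, f != 0 & forall e, e != 0 ->
    {in R, forall r, same_side z a0 e (a0 - r)} -> same_side z a0 e f ->
    pq.2.[a0 + e] != 0 /\ G (pq.1.[a0 + e] / pq.2.[a0 + e]) 0].
  move=> pqL; have [Sp Sq qz0 gpq] := LS _ pqL.
  have [|c [n [cS c0 cP]]] := mono pq.2 _ (q0L _ pqL); first by rewrite mem_cat (map_f snd pqL) orbT.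
  have [p0|p0] := eqVneq pq.1 0.
    exists 1; split; rewrite ?rpred1 ?oner_eq0 // => e e0 he _.
    have [q0 _] := veq_neq0 pG (cP e e0 he); split=> //.
    by rewrite p0 horner0 mul0r; exact: (phom0 hG).
  have [|d [m [dS d0 dP]]] := mono pq.1 _ p0; first by rewrite mem_cat (map_f fst pqL).
  have [||f [fS f0 fP]] := @monomial_cut z a0 w0 (d / c) m n.
  - by rewrite rpred_div.
  - by rewrite mulf_neq0 ?invr_eq0.
  exists f; split=> // e e0 he hf.
  have qe := cP e e0 he; have pe := dP e e0 he; have [q0 _] := veq_neq0 pG qe; split=> //.
  suff [] : vlt pq.2.[a0 + e] pq.1.[a0 + e] by [].
  apply: (vlt_veql pG (veq_sym pG qe)); apply: (vlt_veqr pG (veq_sym pG pe)).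
  have E x : d * x ^+ m / (c * x ^+ n) = d / c * x ^+ m / x ^+ n.
    by rewrite invfM mulrACA !mulrA.
  split; first by rewrite mulf_neq0 ?expf_neq0.
  rewrite E; apply: fP => //; rewrite -E.
  have Ez : a0 + (z - a0) = z by rewrite addrCA subrr addr0.
  have hw : {in R, forall r, same_side z a0 (z - a0) (a0 - r)} by [].
  have qw := cP _ w0 hw; have pw := dP _ w0 hw; rewrite Ez in qw pw.
  suff [] : vlt (c * (z - a0) ^+ n) (d * (z - a0) ^+ m) by [].
  by apply: (vlt_veql pG qw); apply: (vlt_veqr pG pw); split.
have /choice[F FP] : forall pq, exists f, pq \in L ->
    [/\ f \in S, f != 0 & forall e, e != 0 ->
    {in R, forall r, same_side z a0 e (a0 - r)} -> same_side z a0 e f ->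
    pq.2.[a0 + e] != 0 /\ G (pq.1.[a0 + e] / pq.2.[a0 + e]) 0].
  by move=> pq; have [/pair[f hf]|] := boolP (pq \in L); [exists f|exists 0].
(* Comparisons with the [a0 - r] fix the leading monomials, and comparisons with the [F pq] fix the
   sign of the valuation of each quotient. *)
pose fs := [seq a0 - r | r <- R & a0 - r != 0] ++ map F L.
have [|e [eS e0 he]] := @same_side_dense z a0 w0 wS fs.
  move=> f; rewrite mem_cat => /orP[]/mapP[x].
    rewrite mem_filter => /andP[x0 /RS xS] ->; split=> //; exact: rpredB.
  by move=> /FP[? ? _] ->.
exists (a0 + e); first exact: rpredD.
move=> pq pqL; have [_ _ hF] := FP _ pqL; apply: hF => //.
  move=> r rR; have [->|d0] := eqVneq (a0 - r) 0.
    by split=> [_|[]]; [exact: (vlt0 pG)|rewrite eqxx].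
  by apply: he; rewrite mem_cat (map_f (fun r => a0 - r)) // mem_filter d0.
by apply: he; rewrite mem_cat (map_f F pqL) orbT.
Qed.

End Approximation.

(** * Relative algebraic closures *)

Section AlgebraicClosureIn.
Variables (K : fieldType) (T : divringClosed K).

(** [T] as a field in its own right, so that facts on algebraic elements and on kernels of matrices
    apply over [T]. *)
Record subfield_of := SubfieldOf { subfield_val : K; _ : subfield_val \in T }.
HB.instance Definition _ := [isSub for subfield_val].
HB.instance Definition _ := [Choice of subfield_of by <:].
HB.instance Definition _ := [SubChoice_isSubIntegralDomain of subfield_of by <:].
HB.instance Definition _ := [SubIntegralDomain_isSubField of subfield_of by <:].

Definition subfield_inj : {rmorphism subfield_of -> K} := val.

Definition alg_over (x : K) : Prop := exists p, [/\ p \is a polyOver T, p != 0 & root p x].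

Lemma polyOver_lift p : p \is a polyOver T -> exists q, p = map_poly subfield_inj q.
Proof.
move=> Tp; exists (\poly_(i < size p) insubd 0 p`_i).
apply/polyP => i; rewrite coef_map coef_poly; case: ltnP => ip.
  by rewrite /= /subfield_inj val_insubd (polyOverP Tp).
by rewrite nth_default // [RHS](rmorph0 subfield_inj).
Qed.

Lemma map_subfield_polyOver q : map_poly subfield_inj q \is a polyOver T.
Proof. by apply/polyOverP => i; rewrite coef_map; exact: (valP (q`_i)). Qed.

Lemma alg_overP x : alg_over x <-> algebraicOver subfield_inj x.
Proof.
split=> [[p [/polyOver_lift[q ->] q0 r]]|[q q0 r]].
  by exists q => //; apply: contra_neq q0 => ->; exact: rmorph0.
exists (map_poly subfield_inj q); split=> //; first exact: map_subfield_polyOver.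
by rewrite map_poly_eq0.
Qed.

Definition acl : {pred K} := fun x => `[< alg_over x >].

Lemma aclP x : reflect (alg_over x) (x \in acl).
Proof. exact: asboolP. Qed.

Lemma acl_sub x : x \in T -> x \in acl.
Proof.
move=> Tx; apply/aclP; exists ('X - x%:P).
by rewrite rpredB ?polyOverX ?polyOverC // polyXsubC_eq0 root_XsubC.
Qed.

Lemma acl_divring : divring_closed acl.
Proof.
split=> [|x y /aclP/alg_overP hx /aclP/alg_overP hy|x y /aclP/alg_overP hx /aclP/alg_overP hy].
- by apply: acl_sub; exact: rpred1.
- by apply/aclP/alg_overP; exact: algebraic_sub.
- by apply/aclP/alg_overP; exact: algebraic_div.
Qed.
HB.instance Definition _ := GRing.isDivringClosed.Build K acl acl_divring.

Lemma acl_closed : relatively_closed acl.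
Proof.
move=> p x /polyOverP Tp p0 px; apply/aclP/alg_overP/integral_algebraic.
apply: (integral_root p0 px) => c /(nthP 0)[i _ <-].
by apply/integral_algebraic/alg_overP/aclP.
Qed.

End AlgebraicClosureIn.

Section Rational.
Variables (K : fieldType) (S : divringClosed K) (z : K).

Definition adjoin : {pred K} := fun x => `[< exists p q,
  [/\ p \is a polyOver S, q \is a polyOver S, q.[z] != 0 & q.[z] * x = p.[z]] >].

Lemma adjoinP x : reflect (exists p q,
  [/\ p \is a polyOver S, q \is a polyOver S, q.[z] != 0 & q.[z] * x = p.[z]]) (x \in adjoin).
Proof. exact: asboolP. Qed.

Lemma adjoin_poly p : p \is a polyOver S -> p.[z] \in adjoin.
Proof.
by move=> Sp; apply/adjoinP; exists p, 1; rewrite Sp rpred1 hornerC oner_eq0 mul1r.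
Qed.

Lemma adjoin_divring : divring_closed adjoin.
Proof.
split.
- by rewrite -(hornerC 1 z); apply: adjoin_poly; rewrite polyOverC rpred1.
- move=> x y /adjoinP[p [q [Sp Sq q0 E]]] /adjoinP[p' [q' [Sp' Sq' q0' E']]].
  apply/adjoinP; exists (p * q' - p' * q), (q * q').
  rewrite rpredB ?rpredM // !hornerE mulf_neq0 // -E -E'; split=> //; ring.
- move=> x y /adjoinP[p [q [Sp Sq q0 E]]] /adjoinP[p' [q' [Sp' Sq' q0' E']]].
  have [->|y0] := eqVneq y 0.
    by rewrite invr0 mulr0 -(horner0 z); apply: adjoin_poly; exact: rpred0.
  apply/adjoinP; exists (p * q'), (q * p').
  by rewrite !rpredM // !hornerM -E -E' !mulf_neq0 //; split=> //; field.
Qed.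
HB.instance Definition _ := GRing.isDivringClosed.Build K adjoin adjoin_divring.

Lemma adjoin_sub x : x \in S -> x \in adjoin.
Proof. by move=> Sx; rewrite -(hornerC x z); apply: adjoin_poly; rewrite polyOverC. Qed.

Lemma adjoin_gen : z \in adjoin.
Proof. by rewrite -[X in X \in _](hornerX z); apply: adjoin_poly; exact: polyOverX. Qed.

Lemma adjoin_common_denominator (xs : seq K) : {in xs, forall x, x \in adjoin} ->
  exists q, [/\ q \is a polyOver S, q.[z] != 0 & {in xs, forall x,
    exists2 p, p \is a polyOver S & q.[z] * x = p.[z]}].
Proof.
elim: xs => [|x xs IH] xsA.
  by exists 1; rewrite rpred1 hornerC oner_eq0.
have [|q [Sq q0 qP]] := IH; first by move=> y yxs; apply: xsA; rewrite inE yxs orbT.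
have /adjoinP[p' [q' [Sp' Sq' q0' E]]] := xsA x (mem_head _ _).
exists (q * q'); rewrite rpredM // hornerM mulf_neq0 //; split=> // y.
rewrite inE => /predU1P[->|/qP[p Sp Ep]].
  by exists (q * p'); rewrite ?rpredM // hornerM -E mulrA.
by exists (p * q'); rewrite ?rpredM // hornerM -Ep mulrAC.
Qed.

End Rational.

(** * Finite extensions as stable spans *)

Section FiniteExtension.
Variables (K : fieldType) (T : divringClosed K).

Inductive tspan (v : seq K) : K -> Prop :=
| tspan0 : tspan v 0
| tspan_cons c x w : c \in T -> x \in v -> tspan v w -> tspan v (c * x + w).

Lemma tspan_add v x y : tspan v x -> tspan v y -> tspan v (x + y).
Proof.
by elim=> [|c u w cT uv _ IH hy]; rewrite ?add0r // -addrA; constructor => //; exact: IH.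
Qed.

Lemma tspan_scale v c x : c \in T -> tspan v x -> tspan v (c * x).
Proof.
move=> cT; elim=> [|d u w dT uv _ IH]; first by rewrite mulr0; constructor.
by rewrite mulrDr mulrA; constructor; rewrite ?rpredM.
Qed.

Lemma tspan_mem v x : x \in v -> tspan v x.
Proof.
by move=> xv; rewrite -(addr0 x) -(mul1r x); constructor; rewrite ?rpred1 //; constructor.
Qed.

Lemma tspan_sum v (I : Type) (r : seq I) (F : I -> K) :
  (forall i, tspan v (F i)) -> tspan v (\sum_(i <- r) F i).
Proof.
by move=> h; elim/big_ind: _ => //; [constructor|exact: tspan_add].
Qed.

Lemma tspan_coef v x : tspan v x ->
  exists c : 'I_(size v) -> K, (forall i, c i \in T) /\ x = \sum_i c i * v`_i.
Proof.
elim=> [|d u w dT uv _ [c [cT ->]]].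
  by exists (fun=> 0); split=> [i|]; rewrite ?rpred0 // big1 // => i _; rewrite mul0r.
move: uv => /(nthP 0)[i iv <-].
exists (fun j => c j + d *+ (j == Ordinal iv)); split=> [j|].
  by rewrite rpredD ?rpredMn.
under [RHS]eq_bigr do rewrite mulrDl; rewrite big_split /= addrC; congr (_ + _).
rewrite (bigD1 (Ordinal iv)) //= eqxx big1 ?addr0 // => j /negbTE ->.
by rewrite mulr0n mul0r.
Qed.

(** The products of the elements of [v] with the powers of [y] below the degree of its equation span
    a module stable under [y] as well, the equation rewriting [y^n]. *)
Lemma alg_tspan (ys : seq K) : {in ys, forall y, alg_over T y} ->
  exists2 v, 1 \in v & {in ys & v, forall y x, tspan v (y * x)}.
Proof.
elim: ys => [|y ys IH] ysA; first by exists [:: 1]; rewrite ?mem_head.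
have [|v v1 hv] := IH; first by move=> u uys; apply: ysA; rewrite inE uys orbT.
have [p [Tp p0 py]] := ysA y (mem_head _ _).
have sp : (1 < size p)%N by apply: root_size_gt1 py.
pose n := (size p).-1.
pose v' := [seq y ^+ i * x | i <- iota 0 n, x <- v].
have v'P i x : (i < n)%N -> x \in v -> y ^+ i * x \in v'.
  by move=> iv xv; apply/allpairsP; exists (i, x); rewrite mem_iota.
have spanM i w : (i < n)%N -> tspan v w -> tspan v' (y ^+ i * w).
  move=> ilt; elim=> [|c x u cT xv _ IHu]; first by rewrite mulr0; constructor.
  by rewrite mulrDr mulrCA; constructor => //; exact: v'P.
exists v'; first by rewrite -[1](mulr1 1) -(expr0 y); apply: v'P => //; rewrite /n -ltnS prednK // ltnW.
move=> u _ /[swap] /allpairsP[[i x] /= [+ xv ->]]; rewrite mem_iota /= add0n => ilt.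
rewrite inE => /predU1P[->|uys]; last by rewrite mulrCA; apply: spanM => //; exact: hv.
rewrite mulrA -exprS; have [ilt'|] := ltnP i.+1 n; first exact/tspan_mem/v'P.
rewrite leq_eqVlt ltnS leqNgt ilt orbF => /eqP <-.
have -> : y ^+ n = \sum_(j < n) (- (p`_j / lead_coef p)) * y ^+ j.
  apply: (mulfI (x := lead_coef p)); first by rewrite lead_coef_eq0.
  rewrite mulr_sumr; apply/eqP; rewrite -subr_eq0 -sumrN; apply/eqP.
  move/rootP: py; rewrite horner_coef -[size p]prednK ?(ltnW sp) // big_ord_recr /= => py.
  rewrite addrC -[RHS]py; congr (_ + _); apply: eq_bigr => j _.
  by rewrite mulNr mulrN opprK mulrA mulrCA mulfV ?lead_coef_eq0 // mulr1.
rewrite mulr_suml; apply: tspan_sum => j; rewrite -mulrA; apply: tspan_scale.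
  by rewrite rpredN rpred_div // ?lead_coefE (polyOverP Tp).
exact/tspan_mem/v'P.
Qed.

Definition mx_in m n (A : 'M[K]_(m, n)) := forall i j, A i j \in T.

Lemma mx_in_mul m n p (A : 'M[K]_(m, n)) (B : 'M[K]_(n, p)) :
  mx_in A -> mx_in B -> mx_in (A *m B).
Proof. by move=> hA hB i j; rewrite mxE; apply: rpred_sum => l _; rewrite rpredM. Qed.

Theorem finite_extension_basis (ys : seq K) : {in ys, forall y, alg_over T y} ->
  exists (r : nat) (b : 'cV[K]_r), [/\ b != 0,
    forall c : 'rV[K]_r, mx_in c -> c *m b = 0 -> c = 0 &
    {in ys, forall y, exists2 M : 'M[K]_r, mx_in M & y *: b = M *m b}].
Proof.
move=> ysA; pose good r := exists b : 'cV[K]_r, b != 0 /\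
  {in ys, forall y, exists2 M : 'M[K]_r, mx_in M & y *: b = M *m b}.
have exr : exists r, `[< good r >].
  have [v v1 hv] := alg_tspan ysA; exists (size v); apply/asboolP.
  exists (\col_i v`_i); split.
    move: v1 => /(nthP 0)[i iv vi]; apply/eqP => /matrixP/(_ (Ordinal iv) 0)/eqP.
    by rewrite !mxE vi oner_eq0.
  move=> y yys; have /choice[c cP] : forall i : 'I_(size v), exists c : 'I_(size v) -> K,
      (forall j, c j \in T) /\ y * v`_i = \sum_j c j * v`_j.
    by move=> i; apply: tspan_coef; apply: hv => //; exact: mem_nth.
  exists (\matrix_(i, j) c i j); first by move=> i j; rewrite mxE; have [] := cP i.
  apply/matrixP => i j; rewrite !mxE; have [_ ->] := cP i.
  by apply: eq_bigr => l _; rewrite !mxE.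
case: (ex_minnP exr) => r /asboolP[b [b0 bys]] rmin; exists r, b; split=> // c Tc cb.
apply: contrapT => /eqP c0.
have {c0} [i ci0] : exists i, c 0 i != 0.
  apply: contrapT => nc; case/eqP: c0; apply/rowP => i; rewrite mxE; apply/eqP.
  by apply: contrapT => ci; apply: nc; exists i; apply/negP.
case: r b b0 bys rmin c Tc cb i ci0 => [|r] b b0 bys rmin c Tc cb i ci0; first by case: i ci0.
suff /rmin : `[< good r >] by rewrite ltnn.
(* [N] fixes [b] because [c *m b = 0], and its column [i] vanishes by the normalization; hence it
   factors through [F], which drops the entry [i]. *)
apply/asboolP; pose N := 1%:M - (c 0 i)^-1 *: (delta_mx i 0 *m c) : 'M[K]_r.+1.
have Nb : N *m b = b by rewrite mulmxBl mul1mx -scalemxAl -mulmxA cb mulmx0 scaler0 subr0.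
pose F := row' i 1%:M : 'M[K]_(r, r.+1); pose E := col' i N.
have Ni0 l : N l i = 0.
  rewrite !mxE big_ord1 !mxE eqxx andbT; have [_|_] := eqVneq l i.
    by rewrite mul1r mulVf // subrr.
  by rewrite mul0r mulr0 subr0.
have EF : E *m F = N.
  apply/matrixP => l m; transitivity ((N *m 1%:M) l m); last by rewrite mulmx1.
  rewrite [RHS]mxE (bigD1_ord i) //= Ni0 mul0r add0r mxE.
  by apply: eq_bigr => j _; rewrite /E /F !mxE.
have TN : mx_in N.
  move=> l m; rewrite !mxE big_ord1 !mxE rpredB ?rpred_nat //.
  by rewrite rpredM ?rpredV // rpredM // rpred_nat.
have TE : mx_in E by move=> l m; rewrite mxE; exact: TN.
have TF : mx_in F by move=> l m; rewrite !mxE rpred_nat.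
exists (F *m b); split.
  by apply: contra_neq b0 => Fb; rewrite -Nb -EF -mulmxA Fb mulmx0.
move=> y /bys[M TM Eb]; exists (F *m M *m E); first by do 2![apply: mx_in_mul => //].
by rewrite -!mulmxA (mulmxA E) EF Nb scalemxAr Eb.
Qed.

End FiniteExtension.

(** Induction on the list: the first matrix has an eigenvector in [U], found from its matrix [X] in
    a basis of [U], and commutation makes the part of [U] in the eigenspace stable under the other
    matrices. *)
Lemma common_eigenvector_in (K : closedFieldType) n (As : seq 'M[K]_n) (U : 'M[K]_n) :
  {in As &, forall A B, A *m B = B *m A} -> U != 0 ->
  {in As, forall A, stablemx U A} ->
  exists v : 'rV[K]_n, [/\ v != 0, (v <= U)%MS &
    {in As, forall A, exists l, v *m A = l *: v}].
Proof.
elim: As U => [|A As IH] U comm U0 stab.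
  exists (nz_row U); rewrite nz_row_eq0 nz_row_sub; split=> //.
have sA := stab A (mem_head _ _); pose R := row_base U.
have rk : (0 < \rank U)%N by rewrite lt0n mxrank_eq0.
pose X := R *m A *m pinvmx R.
have EX : R *m A = X *m R.
  rewrite /X mulmxKpV //; apply: submx_trans (_ : (U <= R)%MS); last by rewrite eq_row_base.
  by apply: submx_trans sA; rewrite submxMr // eq_row_base.
have /closed_rootP[l rl] : size (char_poly X) != 1%N.
  by rewrite size_char_poly eqSS -lt0n.
have /eigenvalueP[x Ex x0] : eigenvalue X l by rewrite eigenvalue_root_char.
pose U' := (U :&: eigenspace A l)%MS.
have U'0 : U' != 0.
  apply/eqP => U'0; have : (x *m R <= U')%MS.
    rewrite sub_capmx; apply/andP; split.
      by apply: submx_trans (submxMl _ _) _; rewrite eq_row_base.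
    by apply/eigenspaceP; rewrite -mulmxA EX mulmxA Ex scalemxAl.
  rewrite U'0 submx0 mulmx_free_eq0 ?row_base_free //; exact/negP.
have [|//|B BAs|v [v0 vU' hv]] := IH U'.
- by move=> B C hB hC; apply: comm; rewrite inE ?hB ?hC orbT.
- have hAB : comm_mx A B by apply: comm; rewrite inE ?eqxx ?BAs ?orbT.
  rewrite sub_capmx; apply/andP; split.
    apply: submx_trans (submxMr _ (capmxSl _ _)) _.
    by apply: stab; rewrite inE BAs orbT.
  apply: submx_trans (submxMr _ (capmxSr _ _)) _.
  exact: comm_mx_stable_eigenspace.
move: vU'; rewrite sub_capmx => /andP[vU /eigenspaceP vA].
exists v; split=> // B; rewrite inE => /predU1P[->|/hv//].
by exists l.
Qed.

Lemma pigeonhole_fibre (m N : nat) (T : finType) (f : 'I_m -> T) :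
  (#|T| * N < m)%N -> exists t, (N < #|[set i | f i == t]|)%N.
Proof.
move=> h; apply: contrapT => nex.
have : (\sum_(t : T) #|[set i | f i == t]| <= \sum_(t : T) N)%N.
  by apply: leq_sum => t _; rewrite leqNgt; apply/negP => ht; apply: nex; exists t.
rewrite sum_nat_const leqNgt; apply/negP/negPn; apply: leq_trans h _.
rewrite -[X in (X <= _)%N]card_ord -sum1_card (partition_big f predT) //=.
by apply: leq_sum => t _; rewrite -sum1_card; apply/eq_leq/eq_bigl => i; rewrite inE.
Qed.

Lemma closed_field_infinite (k : closedFieldType) (m : nat) :
  exists s : seq k, uniq s /\ size s = m.
Proof.
elim: m => [|m [s [us ss]]]; first by exists [::].
suff [x xs] : exists x, x \notin s by exists (x :: s); rewrite /= xs us ss.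
pose p := \prod_(a <- s) ('X - a%:P) : {poly k}.
pose q : {poly k} := 'X * p + 1.
have sq : size q != 1%N.
  rewrite /q size_polyDl size_mul ?polyX_eq0 ?monic_neq0 ?monic_prod_XsubC //;
    by rewrite size_polyX size_prod_XsubC // size_poly1.
have /closed_rootP[x rx] := sq; exists x; apply/negP => xs.
move: rx; rewrite rootE /q hornerD hornerM hornerC (rootP (_ : root p x)).
  by rewrite mulr0 add0r oner_eq0.
by rewrite root_prod_XsubC.
Qed.

(** * Reduction of polynomials at a place *)

Section PlacePolynomials.
Variables (k : fieldType) (K : closedFieldType) (iota : {rmorphism k -> K}).
Variables (G : K -> k -> Prop).
Hypothesis pG : is_place iota G.
Let hG := place_phom pG.

(** Division by a coefficient of least valuation makes all coefficients finite and that one equal to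
    1, so the reduction is nonzero. *)
Lemma place_normalize (P : {poly K}) : P != 0 ->
  exists i Q, [/\ P`_i != 0, ppoly G ((P`_i)^-1 *: P) Q & Q != 0].
Proof.
move=> P0; pose l := [seq i <- seq.iota 0 (size P) | P`_i != 0].
have [i il imax] := vlt_max pG (fun i => (P`_i)^-1) (size P).-1 l.
have Pi0 : P`_i != 0.
  move: il; rewrite inE mem_filter => /predU1P[->|/andP[//]].
  by rewrite -lead_coefE lead_coef_eq0.
have /choice[q qP] : forall j, exists a, G ((P`_i)^-1 * P`_j) a.
  move=> j; have [Pj0|Pj0] := eqVneq P`_j 0; first by exists 0; rewrite Pj0 mulr0; exact: (phom0 hG).
  rewrite -[X in G X]invrK invfM invrK; apply: (place_nunit pG) => gj.
  apply: (imax j); last by split; rewrite ?invr_eq0 // invrK mulrC.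
  rewrite inE mem_filter Pj0 mem_iota add0n ltnNge /= orbC.
  by apply/orP; left; rewrite -ltnNge ltnNge; apply: contra Pj0 => /(nth_default 0) ->.
exists i, (\poly_(j < size P) q j); split=> //.
  move=> j; rewrite coefZ coef_poly; case: ltnP => [_|jP]; first exact: qP.
  by rewrite [P`_j]nth_default // mulr0; exact: (phom0 hG).
apply/eqP => /polyP/(_ i); rewrite coef0 coef_poly ltnNge.
have -> /= : ~~ (size P <= i)%N by apply: contra Pi0 => /(nth_default 0) ->.
have := qP i; rewrite mulVf // => /(phom_inj hG (phom1 hG)) <- /eqP.
by rewrite oner_eq0.
Qed.

(** Up to a constant, [P] is a product of factors [X - r] for the finite roots and [1 - X / r] for
    the infinite ones. The latter reduce to 1, so every root of [Q] is the residue of a finite root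
    of [P]. *)
Lemma place_root (P : {poly K}) Q c : ppoly G P Q -> Q != 0 -> root Q c ->
  exists2 th, root P th & G th c.
Proof.
move=> PQ Q0 rQ; have P0 : P != 0.
  apply: contra_neq Q0 => P0; apply/polyP => i; rewrite coef0.
  by apply: (phom_fun hG); have := PQ i; rewrite P0 coef0.
have [rs EP] := closed_field_poly_normal P.
have /choice[av avP] : forall r, exists a, (exists b, G r b) -> G r a.
  by move=> r; have [[b gb]|nb] := pselect (exists b, G r b); [exists b|exists 0].
pose u r : {poly K} := if `[< exists b, G r b >] then 'X - r%:P else 1 - r^-1 *: 'X.
pose v r : {poly k} := if `[< exists b, G r b >] then 'X - (av r)%:P else 1.
have uv r : ppoly G (u r) (v r).
  rewrite /u /v; case: asboolP => [gr|nr].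
    by apply: (ppolyB hG); [exact: (ppolyX hG)|exact/(ppolyC hG)/avP].
  rewrite -[X in ppoly G _ X]subr0; apply: (ppolyB hG).
    by rewrite -!polyC1; apply: (ppolyC hG); exact: (phom1 hG).
  rewrite -(mul0r ('X : {poly k})) -mul_polyC -polyC0.
  apply: (ppolyM hG); last exact: (ppolyX hG).
  by apply: (ppolyC hG); have [] := place_total pG r.
have aux (s : seq K) (lc : K) : lc != 0 -> exists a, a != 0 /\
    lc *: \prod_(r <- s) ('X - r%:P) = a *: \prod_(r <- s) u r.
  elim: s lc => [|r s IH] lc lc0; first by exists lc; rewrite !big_nil.
  have [b [b0 Eb]] := IH lc lc0; rewrite !big_cons scalerAr Eb.
  have [gr|nr] := pselect (exists b, G r b).
    by exists b; rewrite {2}/u asboolT // -scalerAr.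
  have r0 : r != 0 by apply/eqP => r0; apply: nr; exists 0; rewrite r0; exact: (phom0 hG).
  exists (- r * b); rewrite mulf_neq0 ?oppr_eq0 //; split=> //.
  have -> : 'X - r%:P = - r *: (1 - r^-1 *: 'X).
    by rewrite scalerBr scalerA mulNr mulfV // scaleN1r opprK addrC scaleNr -mul_polyC mulr1.
  by rewrite {2}/u asboolF // -scalerAl -scalerAr scalerA.
have [a [a0 Ea]] := aux rs (lead_coef P) ltac:(by rewrite lead_coef_eq0).
rewrite -EP in Ea.
pose Qu := \prod_(r <- rs) u r; pose Qv := \prod_(r <- rs) v r.
have Quv : ppoly G Qu Qv by apply: (ppoly_prod hG) => r _; exact: uv.
have v0 r : v r != 0.
  by rewrite /v; case: asboolP => _; rewrite ?polyXsubC_eq0 ?oner_eq0.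
have Qv0 : Qv != 0 by rewrite /Qv prodf_seq_neq0; apply/allP => r _ /=; exact: v0.
(* If the constant were infinite, its inverse times [P] would reduce both to 0 and to [Qv]. *)
have [al ga] : exists al, G a al.
  apply: contrapT => na; have [//|ga] := place_total pG a.
  case/eqP: Qv0; apply/polyP => i; rewrite coef0; apply: (phom_inj hG (Quv i)).
  have -> : Qu = a^-1%:P * P by rewrite mul_polyC Ea scalerA mulVf // scale1r.
  have := ppolyM hG (ppolyC hG ga) PQ i.
  by rewrite polyC0 mul0r coef0.
have EQ : Q = al *: Qv.
  apply/polyP => i; apply: (phom_inj hG (PQ i)); rewrite Ea -!mul_polyC.
  exact: (ppolyM hG (ppolyC hG ga) Quv).
have al0 : al != 0 by apply: contra_neq Q0 => al0; rewrite EQ al0 scale0r.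
move: rQ; rewrite EQ rootZ // /Qv /root horner_prod prodf_seq_eq0 => /hasP[r rrs /=].
rewrite /v; case: asboolP => [gr|_]; last by rewrite hornerC oner_eq0.
rewrite hornerXsubC subr_eq0 => /eqP ->; exists r; last exact: avP.
by rewrite -rootE EP rootZ ?lead_coef_eq0 // root_prod_XsubC.
Qed.

(** The [u j] are recovered from the sums by the inverse of a Vandermonde matrix over [k], whose
    entries are finite at the place. *)
Lemma place_interpolation n (s : 'I_n -> k) (u : 'I_n -> K) (a : 'I_n -> k) :
  injective s ->
  (forall i, G (\sum_(j < n) iota (s i) ^+ j * u j) (\sum_(j < n) s i ^+ j * a j)) ->
  forall j, G (u j) (a j).
Proof.
move=> sinj h; pose V := (Vandermonde n (\row_i s i))^T.
have Vu : V \in unitmx.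
  rewrite unitmxE det_tr det_Vandermonde unitfE; apply/prodf_neq0 => i _.
  apply/prodf_neq0 => j ij; rewrite !mxE subr_eq0; apply: contraTneq ij => /sinj ->.
  by rewrite ltnn.
have E (F : fieldType) (W : 'M[F]_n) (w : 'cV[F]_n) : W \in unitmx -> invmx W *m (W *m w) = w.
  by move=> Wu; rewrite mulmxA mulVmx // mul1mx.
have Vu' : map_mx iota V \in unitmx by rewrite map_unitmx.
move=> j; have := @phom_mulmx _ _ _ hG _ _ _ (invmx (map_mx iota V))
  (map_mx iota V *m \col_j u j) (invmx V) (V *m \col_j a j) _ _ j 0.
rewrite !E // !mxE; apply.
  by move=> i l; rewrite -map_invmx mxE; exact: (place_const pG).
move=> i l; rewrite !mxE; have := h i.
rewrite -(@eq_bigr _ _ _ _ _ _ (fun j => (map_mx iota V) i j * (\col_j u j) j l)); last first.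
  by move=> x _; rewrite !mxE rmorphXn.
by rewrite -(@eq_bigr _ _ _ _ _ _ (fun j => V i j * (\col_j a j) j l)) // => x _; rewrite !mxE.
Qed.

End PlacePolynomials.

(** * Specialization *)

Section Specialization.
Variables (k K : closedFieldType) (iota : {rmorphism k -> K}).
Variables (G : K -> k -> Prop) (S : divringClosed K).
Hypothesis pG : is_place iota G.
Hypothesis Sk : forall c, iota c \in S.
Hypothesis Scl : relatively_closed S.
Variable tau : K.
Hypotheses (Stau : tau \in S) (tau0 : tau != 0) (gtau : G tau 0).
Let hG := place_phom pG.

Notation ev x A := (map_mx (horner_eval x) A).
Definition poly_mx_over m n (A : 'M[{poly K}]_(m, n)) := forall i j, A i j \is a polyOver S.

(* The [y j] act on the span of the entries of [b] by the commuting matrices [D j / q]; after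
   replacing [z] by [z'], joint eigenvalues of these matrices are the specializations of the [y j]. *)
Section Generic.
Variables (z : K) (N r : nat) (y : 'I_N -> K) (b : 'cV[K]_r) (q : {poly K}).
Variable D : 'I_N -> 'M[{poly K}]_r.
Hypothesis zS : z \notin S.
Hypothesis b0 : b != 0.
Hypothesis bfree : forall c : 'rV[{poly K}]_r, poly_mx_over c -> ev z c *m b = 0 -> c = 0.
Hypotheses (Sq : q \is a polyOver S) (qz0 : q.[z] != 0).
Hypothesis SD : forall j, poly_mx_over (D j).
Hypothesis yb : forall j, (q.[z] * y j) *: b = ev z (D j) *m b.

Lemma mx_free (A : 'M[{poly K}]_r) : poly_mx_over A -> ev z A *m b = 0 -> A = 0.
Proof.
move=> SA Ab; apply/row_matrixP => i; rewrite row0; apply: bfree.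
  by move=> l j; rewrite mxE.
by rewrite map_row -row_mul Ab row0.
Qed.

Lemma poly_mx_overM m n p (A : 'M[{poly K}]_(m, n)) (B : 'M[{poly K}]_(n, p)) :
  poly_mx_over A -> poly_mx_over B -> poly_mx_over (A *m B).
Proof. by move=> hA hB i j; rewrite mxE; apply: rpred_sum => l _; rewrite rpredM. Qed.

Lemma poly_mx_overB m n (A B : 'M[{poly K}]_(m, n)) :
  poly_mx_over A -> poly_mx_over B -> poly_mx_over (A - B).
Proof. by move=> hA hB i j; rewrite !mxE rpredB. Qed.

Lemma poly_mx_overZ m n c (A : 'M[{poly K}]_(m, n)) :
  c \is a polyOver S -> poly_mx_over A -> poly_mx_over (c *: A).
Proof. by move=> hc hA i j; rewrite !mxE rpredM. Qed.

Lemma poly_mx_over_scalar n c : c \is a polyOver S -> poly_mx_over (c%:M : 'M_n).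
Proof. by move=> hc i j; rewrite mxE rpredMn. Qed.

(** Both products multiply [b] by the same scalar, and freeness of [b] makes a matrix over [S[X]]
    determined by this action. *)
Lemma D_comm i j : D i *m D j = D j *m D i.
Proof.
apply/eqP; rewrite -subr_eq0; apply/eqP/mx_free.
  by apply: poly_mx_overB; exact: poly_mx_overM.
have E l m : ev z (D l *m D m) *m b = (q.[z] * y l * (q.[z] * y m)) *: b.
  by rewrite map_mxM -mulmxA -yb -scalemxAr -yb scalerA mulrC.
by rewrite map_mxB mulmxBl !E mulrC subrr.
Qed.

Variables (J : pred 'I_N) (a : 'I_N -> k).
Hypothesis Ja : forall j, J j -> G (y j) (a j).

Definition comb_mx (s : k) : 'M[{poly K}]_r := \sum_(j | J j) (iota s ^+ j)%:P *: D j.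
Definition comb_val (s : k) : k := \sum_(j | J j) s ^+ j * a j.
Definition comb_elt (s : k) : K := \sum_(j | J j) iota s ^+ j * y j.

(** The outer variable stands for the eigenvalue and the inner one for [z], so that one polynomial
    can be evaluated at [z] and at [z']. *)
Definition comb_poly (s : k) : {poly {poly K}} :=
  \det ((q%:P * 'X)%:M - map_mx polyC (comb_mx s)).

Lemma comb_mx_over s : poly_mx_over (comb_mx s).
Proof.
move=> i j; rewrite summxE; apply: rpred_sum => l _; rewrite mxE rpredM ?SD //.
by rewrite polyOverC rpredX // Sk.
Qed.

Lemma ev_comb_mx x s : ev x (comb_mx s) = \sum_(j | J j) iota s ^+ j *: ev x (D j).
Proof.
rewrite (raddf_sum (map_mx (horner_eval x))) /=; apply: eq_bigr => j _.
by rewrite map_mxZ; congr (_ *: _); exact: hornerC.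
Qed.

Lemma comb_polyE x s th : (map_poly (horner_eval x) (comb_poly s)).[th] =
  \det ((q.[x] * th)%:M - ev x (comb_mx s)).
Proof.
rewrite /comb_poly -det_map_mx -[LHS]/(horner_eval th _) -det_map_mx.
congr (\det _); apply/matrixP => i j; rewrite !mxE.
rewrite /= !raddfB /= map_polyC rmorphMn /= rmorphM /= map_polyC map_polyX.
by rewrite /horner_eval /= hornerMn hornerM hornerX !hornerC.
Qed.

Lemma comb_poly_over s i : (comb_poly s)`_i \is a polyOver S.
Proof.
suff /polyOverP : comb_poly s \is a polyOver (polyOver_pred S) by [].
rewrite /comb_poly /determinant; apply: rpred_sum => p _; apply: rpredM.
  by rewrite rpredX // rpredN1.
apply: rpred_prod => l _; rewrite !mxE rpredB ?polyOverC ?comb_mx_over //.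
by rewrite rpredMn // rpredM ?polyOverX // polyOverC.
Qed.

Lemma det_eigenvalue (F : fieldType) n (A : 'M[F]_n) (c th : F) : c != 0 ->
  (\det ((c * th)%:M - A) == 0) = eigenvalue A (c * th).
Proof.
move=> c0; apply/det0P/eigenvalueP => [[v v0 Ev]|[v Ev v0]]; exists v => //.
  by apply/eqP; rewrite eq_sym -subr_eq0 -mul_mx_scalar -mulmxBr Ev.
by rewrite mulmxBr Ev mul_mx_scalar subrr.
Qed.

Lemma comb_poly_neq0 s : map_poly (horner_eval z) (comb_poly s) != 0.
Proof.
apply/eqP => F0; have /closed_nonrootP[th] : char_poly (ev z (comb_mx s)) != 0.
  by rewrite monic_neq0 // char_poly_monic.
rewrite -eigenvalue_root_char -(mulfVK qz0 th) mulrC -det_eigenvalue // => /negP; apply.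
by rewrite -comb_polyE F0 horner0.
Qed.

Lemma comb_eltP s : G (comb_elt s) (comb_val s).
Proof.
apply: (phom_sum hG) => j Jj; apply: (phomM hG); last exact: Ja.
by apply: (phomX hG); exact: (place_const pG).
Qed.

Lemma comb_elt_root s : root (map_poly (horner_eval z) (comb_poly s)) (comb_elt s).
Proof.
rewrite rootE comb_polyE -det_tr; apply/det0P; exists b^T; first by rewrite trmx_eq0.
rewrite -trmx_mul mulmxBl mul_scalar_mx ev_comb_mx mulmx_suml.
rewrite [X in _ - X](_ : _ = (q.[z] * comb_elt s) *: b) ?subrr ?trmx0 //.
rewrite /comb_elt mulr_sumr scaler_suml; apply: eq_bigr => j _.
by rewrite -scalemxAl -yb scalerA mulrCA.
Qed.

(* Reducing the whole characteristic polynomial of a combination [\sum_j s^j y_j], suitably scaled,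
   to the same polynomial over [k] at [z] and at [z'] keeps the value of the combination, but for an
   eigenvalue that depends on [s]. *)
Lemma specialize_values (ss : seq k) : exists z', [/\ z' \in S, q.[z'] != 0 &
  forall s, s \in ss -> exists2 th,
    \det ((q.[z'] * th)%:M - ev z' (comb_mx s)) = 0 & G th (comb_val s)].
Proof.
have /choice[i /choice[Q hQ]] : forall s, exists i Q,
    [/\ (map_poly (horner_eval z) (comb_poly s))`_i != 0,
    ppoly G (((map_poly (horner_eval z) (comb_poly s))`_i)^-1 *:
      map_poly (horner_eval z) (comb_poly s)) Q & Q != 0].
  by move=> s; exact: (place_normalize pG (comb_poly_neq0 s)).
(* The pair expresses that the coefficient of index [l] divided by that of index [i s] has residue
   [(Q s)_l]: the quotient minus this constant has value 0. *)
pose pr s l := ((comb_poly s)`_l - (iota (Q s)`_l)%:P * (comb_poly s)`_(i s), (comb_poly s)`_(i s)).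
(* The pair [(0, q)] only demands that [q] not vanish at [z']. *)
pose L := (0, q) :: [seq pr s l | s <- ss, l <- seq.iota 0 (size (comb_poly s))].
have [|z' Sz' hz'] := place_approximation pG Sk Scl Stau tau0 gtau (L := L) zS.
  move=> pq; rewrite inE => /predU1P[->|/allpairsPdep[s [l [_ _ ->]]]] /=.
    by split; rewrite ?rpred0 // horner0 mul0r; exact: (phom0 hG).
  have [Pi0 PQ _] := hQ s; rewrite coef_map in Pi0.
  split; rewrite ?comb_poly_over //.
    by rewrite rpredB ?rpredM ?polyOverC ?comb_poly_over ?Sk.
  rewrite hornerD hornerN hornerM hornerC mulrBl mulfK //.
  have gl : G (((comb_poly s)`_l).[z] / ((comb_poly s)`_(i s)).[z]) (Q s)`_l.
    by have := PQ l; rewrite coefZ !coef_map /= mulrC.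
  by have := phomB hG gl (place_const pG (Q s)`_l); rewrite subrr.
exists z'; split=> //; first by have [] := hz' _ (mem_head _ _).
move=> s sss; have [Pi0 PQ Q0] := hQ s.
pose P' := map_poly (horner_eval z') (comb_poly s).
have isz : (i s < size (comb_poly s))%N.
  by rewrite ltnNge; apply: contra Pi0 => h; rewrite coef_map nth_default //= /horner_eval horner0.
have inL l : (l < size (comb_poly s))%N -> pr s l \in L.
  by move=> lsz; rewrite inE; apply/orP; right; apply/allpairsPdep; exists s, l; rewrite mem_iota.
have [/= Pi0' _] := hz' _ (inL _ isz).
have P'Q : ppoly G ((P'`_(i s))^-1 *: P') (Q s).
  move=> l; rewrite coefZ !coef_map /=; case: (ltnP l (size (comb_poly s))) => lsz.
    have [/= _] := hz' _ (inL _ lsz); rewrite hornerD hornerN hornerM hornerC mulrBl mulfK //.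
    move=> /(phomD hG)/(_ (place_const pG (Q s)`_l)).
    by rewrite subrK add0r mulrC.
  have := PQ l; rewrite coefZ !coef_map /= [(comb_poly s)`_l]nth_default //.
  by rewrite /horner_eval !horner0 !mulr0.
have rQ : root (Q s) (comb_val s).
  apply/eqP/(phom_fun hG); have := ppoly_horner hG PQ (comb_eltP s).
  by rewrite hornerZ (rootP (comb_elt_root s)) mulr0.
have [th rth gth] := place_root pG P'Q Q0 rQ; exists th => //.
by rewrite -comb_polyE; apply/rootP; move: rth; rewrite rootZ // invr_eq0 coef_map.
Qed.

(** The eigenspace of the combination is stable under the commuting [D j], hence contains a joint
    eigenvector, whose eigenvalues combine to [th]. *)
Lemma joint_eigenvector z' s th : q.[z'] != 0 ->
  \det ((q.[z'] * th)%:M - ev z' (comb_mx s)) = 0 ->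
  exists (v : 'rV[K]_r) (psi : 'I_N -> K), [/\ v != 0,
    forall j, v *m ev z' (D j) = (q.[z'] * psi j) *: v &
    th = \sum_(j | J j) iota s ^+ j * psi j].
Proof.
move=> q0 /eqP; rewrite det_eigenvalue // => /eigenvalueP[u Eu u0].
have evC i j : ev z' (D i) *m ev z' (D j) = ev z' (D j) *m ev z' (D i).
  by rewrite -!map_mxM D_comm.
pose U := eigenspace (ev z' (comb_mx s)) (q.[z'] * th).
have U0 : U != 0 by apply/eigenvalueP; exists u.
have [||v [v0 vU hv]] := @common_eigenvector_in K r [seq ev z' (D j) | j <- enum 'I_N] U _ U0.
- by move=> _ _ /mapP[i _ ->] /mapP[j _ ->].
- move=> _ /mapP[j _ ->]; apply: comm_mx_stable_eigenspace.
  rewrite /comm_mx ev_comb_mx mulmx_suml mulmx_sumr; apply: eq_bigr => l _.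
  by rewrite -scalemxAl -scalemxAr evC.
have /choice[l hl] : forall j, exists l, v *m ev z' (D j) = l *: v.
  by move=> j; apply/hv/mapP; exists j; rewrite ?mem_enum.
exists v, (fun j => l j / q.[z']); split=> // [j|].
  by rewrite mulrC divfK.
have [i vi] : exists i, v 0 i != 0.
  apply: contrapT => nv; case/eqP: v0; apply/rowP => i; rewrite mxE; apply/eqP.
  by apply: contrapT => vi; apply: nv; exists i; apply/negP.
apply: (mulfI q0); apply: (mulIf vi); rewrite mulr_sumr mulr_suml.
have /eigenspaceP/rowP/(_ i) := vU; rewrite ev_comb_mx mulmx_sumr summxE => /esym.
rewrite mxE => ->; apply: eq_bigr => j _.
by rewrite -scalemxAr hl scalerA mxE mulrCA [_ * (_ / _)]mulrC divfK.
Qed.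

(* There are finitely many joint eigenvalues, so one of them serves enough values of [s] for
   Vandermonde to separate the [y j]. *)
Lemma joint_specialization : exists (z' : K) (v : 'rV[K]_r) (psi : 'I_N -> K),
  [/\ z' \in S, q.[z'] != 0, v != 0,
    forall j, v *m ev z' (D j) = (q.[z'] * psi j) *: v &
    forall j, J j -> G (psi j) (a j)].
Proof.
(* A joint eigenvalue is recorded by its positions in the lists of eigenvalues of the single
   matrices; [m] is large enough for more than [N] parameters to share one record. *)
pose T := {ffun 'I_N -> 'I_r.+1}; pose m := (#|{: T}| * N).+1.
have [ss [uss sss]] := closed_field_infinite k m.
have [z' [Sz' q0 hz']] := specialize_values ss.
pose s_ (i : 'I_m) := ss`_i.
have /choice[v /choice[psi hv]] : forall i : 'I_m, exists (v : 'rV[K]_r) (psi : 'I_N -> K),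
   [/\ v != 0, forall j, v *m ev z' (D j) = (q.[z'] * psi j) *: v &
     G (\sum_(j | J j) iota (s_ i) ^+ j * psi j) (comb_val (s_ i))].
  move=> i; have [|th dth gth] := hz' (s_ i); first by rewrite mem_nth // sss.
  have [v [psi [v0 hv E]]] := joint_eigenvector q0 dth.
  by exists v, psi; split=> //; rewrite -E.
have /choice[rs hrs] : forall j, exists rs : seq K,
    char_poly (ev z' (D j)) = \prod_(x <- rs) ('X - x%:P).
  move=> j; have [rs E] := closed_field_poly_normal (char_poly (ev z' (D j))).
  by exists rs; rewrite E (monicP (char_poly_monic _)) scale1r.
have in_rs i j : q.[z'] * psi i j \in rs j.
  have [v0 vD _] := hv i; rewrite -root_prod_XsubC -hrs -eigenvalue_root_char.
  by apply/eigenvalueP; exists (v i).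
have size_rs j : size (rs j) = r.
  by apply: succn_inj; rewrite -(size_prod_XsubC _ id) -hrs size_char_poly.
pose f (i : 'I_m) : T := [ffun j => inord (index (q.[z'] * psi i j) (rs j))].
have f_inj i i' j : f i = f i' -> psi i j = psi i' j.
  move=> /ffunP/(_ j); rewrite !ffunE => /(congr1 val) /=.
  have lt (i0 : 'I_m) : (index (q.[z'] * psi i0 j)%R (rs j) < r.+1)%N.
    by rewrite ltnS -[X in (_ <= X)%N](size_rs j) index_size.
  rewrite !inordK // => E; apply: (mulfI q0).
  by rewrite -(nth_index 0 (in_rs i j)) E nth_index.
have [t ht] := pigeonhole_fibre f (leqnn _ : (#|{: T}| * N < m)%N).
set A := [set i | f i == t] in ht.
pose e (i : 'I_N) : 'I_m := enum_val (widen_ord (ltnW ht) i).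
have fe i : f (e i) = t by have := enum_valP (widen_ord (ltnW ht) i); rewrite inE => /eqP.
pose i0 : 'I_m := enum_val (Ordinal (leq_ltn_trans (leq0n _) ht)).
have fi0 : f i0 = t.
  by have := enum_valP (Ordinal (leq_ltn_trans (leq0n _) ht)); rewrite inE => /eqP.
have [v0 vD _] := hv i0; exists z', (v i0), (psi i0); split=> // j Jj.
have einj : injective (fun i => s_ (e i)).
  move=> i i' /eqP; rewrite /s_ nth_uniq ?sss // => /eqP/val_inj/enum_val_inj.
  by move=> /(congr1 val) /= ii; exact: val_inj.
(* Indices outside [J] carry 0 on both sides, so that Vandermonde applies to all [N] of them. *)
have := @place_interpolation _ _ _ _ pG N (fun i => s_ (e i))
  (fun j => if J j then psi i0 j else 0) (fun j => if J j then a j else 0) einj _ j.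
rewrite Jj; apply => i; have [_ _] := hv (e i); rewrite /comb_val.
move=> gi; apply: (eq_ind _ id gi); congr G; rewrite big_mkcond; apply: eq_bigr => l _.
  by case: ifP => _; rewrite ?mulr0 // (f_inj (e i) i0) // fe fi0.
by case: ifP => _; rewrite ?mulr0.
Qed.

End Generic.

End Specialization.

(** * Descent along a tower of algebraic closures *)

Section Tower.
Variables (k K : closedFieldType) (iota : {rmorphism k -> K}) (G : K -> k -> Prop).
Hypothesis pG : is_place iota G.
Let hG := place_phom pG.
Notation ev x A := (map_mx (horner_eval x) A).

Lemma relatively_closed_root0 (S : divringClosed K) z (p : {poly K}) :
  relatively_closed S -> z \notin S -> p \is a polyOver S -> p.[z] = 0 -> p = 0.
Proof.
move=> Scl zS Sp pz; apply: contraNeq zS => p0; apply: Scl Sp p0 _.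
exact/rootP.
Qed.

(** [H] carries the relations among the [ys] down to [S], and the last clause keeps their finite
    values. Off the trivial case [z \in S], it comes from evaluating matrices over [S[X]] at [z'] on
    a joint eigenvector. *)
Theorem acl_specialization (S : divringClosed K) (tau z : K) (ys : seq K) :
  (forall c, iota c \in S) -> relatively_closed S ->
  tau \in S -> tau != 0 -> G tau 0 ->
  {in ys, forall y, y \in acl (adjoin S z)} ->
  exists H : K -> K -> Prop, [/\ phom H, forall s, s \in S -> H s s &
    {in ys, forall y, exists y', [/\ H y y', y' \in S & forall a, G y a -> G y' a]}].
Proof.
move=> Sk Scl Stau tau0 gtau ysA; have [zS|zS] := boolP (z \in S).
  exists (fun x x' => x = x' /\ x \in S); split=> //.
    split=> [|x _ y _ [<- Sx] [<- Sy]|x _ y _ [<- Sx] [<- Sy]|a [->]//].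
    - by rewrite rpred1.
    - by rewrite rpredB.
    - by rewrite rpredM.
  move=> y /ysA/aclP[p [Tp p0 py]]; exists y.
  suff Sy : y \in S by [].
  apply: Scl p0 py; apply/polyOverP => i; have /adjoinP[u [v [Su Sv v0 E]]] := polyOverP Tp i.
  rewrite -(mulKf v0 p`_i) E rpredM ?rpredV ?rpred_horner //.
have [r [b [b0 bfree bM]]] := finite_extension_basis (fun y h => elimT (aclP _ _) (ysA y h)).
pose N := size ys; pose y (j : 'I_N) := ys`_j.
have yys j : y j \in ys by exact: mem_nth.
have /choice[M hM] : forall j, exists M : 'M[K]_r, mx_in (adjoin S z) M /\ y j *: b = M *m b.
  by move=> j; have [M TM E] := bM _ (yys j); exists M.
have [|q [Sq q0 qP]] := @adjoin_common_denominator _ S z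
    [seq M p.1.1 p.1.2 p.2 | p <- enum [set: 'I_N * 'I_r * 'I_r]].
  by move=> _ /mapP[p _ ->]; have [TM _] := hM p.1.1; exact: TM.
have /choice[d hd] : forall p : 'I_N * 'I_r * 'I_r, exists d,
    d \is a polyOver S /\ q.[z] * M p.1.1 p.1.2 p.2 = d.[z].
  move=> p; have [|d Sd E] := qP (M p.1.1 p.1.2 p.2); last by exists d.
  by apply/mapP; exists p; rewrite ?mem_enum ?inE.
pose D j := \matrix_(i, l) d (j, i, l).
have SD j : poly_mx_over S (D j) by move=> i l; rewrite mxE; have [] := hd (j, i, l).
have bfree' (c : 'rV[{poly K}]_r) : poly_mx_over S c -> ev z c *m b = 0 -> c = 0.
  move=> Sc /bfree E; apply/rowP => i; rewrite mxE.
  apply: (relatively_closed_root0 Scl zS) => //.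
  have /rowP/(_ i) : ev z c = 0.
    by apply: E => i' l; rewrite mxE; exact: adjoin_poly.
  by rewrite !mxE.
have EqD j : q.[z] *: M j = ev z (D j).
  by apply/matrixP => i l; rewrite !mxE; have [_ E] := hd (j, i, l); exact: E.
have yb j : (q.[z] * y j) *: b = ev z (D j) *m b.
  by have [_ E] := hM j; rewrite -scalerA E scalemxAl EqD.
(* Only the finite [y j] have a residue to be kept. *)
pose J := [pred j | `[< exists a, G (y j) a >]].
have /choice[a ha] : forall j, exists a, J j -> G (y j) a.
  move=> j; have [[a ga]|nj] := pselect (exists a, G (y j) a); first by exists a.
  by exists 0 => /asboolP.
have [z' [v [psi [Sz' q0' v0 vD gpsi]]]] :=
  joint_specialization pG Sk Scl Stau tau0 gtau zS b0 bfree' Sq q0 SD yb ha.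
(* [x] acts on [b] as [A(z) / q(z)^n]; its image is the eigenvalue of [A(z') / q(z')^n] at [v]. *)
pose H x x' := exists n (A : 'M[{poly K}]_r), [/\ poly_mx_over S A,
  (q.[z] ^+ n * x) *: b = ev z A *m b & v *m ev z' A = (q.[z'] ^+ n * x') *: v].
have Spow n : q ^+ n \is a polyOver S by rewrite rpredX.
exists H; split.
- split.
  + exists 0%N, 1%:M; rewrite !map_mx1 mul1mx mulmx1 !expr0 !mulr1 !scale1r; split=> //.
    by apply: poly_mx_over_scalar; exact: rpred1.
  + move=> x x' u u' [n [A [SA Ab vA]]] [m [B [SB Bb vB]]].
    exists (n + m)%N, (q ^+ m *: A - q ^+ n *: B); split.
    * by apply: poly_mx_overB; exact: poly_mx_overZ.
    * rewrite map_mxB !map_mxZ mulmxBl -!scalemxAl -Ab -Bb !scalerA -scalerBl !rmorphXn /= /horner_eval.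
      by congr (_ *: _); rewrite exprD; ring.
    * rewrite map_mxB !map_mxZ mulmxBr -!scalemxAr vA vB !scalerA -scalerBl !rmorphXn /= /horner_eval.
      by congr (_ *: _); rewrite exprD; ring.
  + move=> x x' u u' [n [A [SA Ab vA]]] [m [B [SB Bb vB]]].
    exists (n + m)%N, (A *m B); split; first exact: poly_mx_overM.
    * rewrite map_mxM -mulmxA -Bb -scalemxAr -Ab scalerA.
      by congr (_ *: _); rewrite exprD; ring.
    * rewrite map_mxM mulmxA vA -scalemxAl vB scalerA.
      by congr (_ *: _); rewrite exprD; ring.
  (* For [x = 0] freeness of [b] gives [A = 0], which makes images unique. *)
  + move=> x' [n [A [SA]]]; rewrite mulr0 scale0r => /esym Ab vA.
    have A0 : A = 0 by apply: mx_free Ab => //.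
    move: vA; rewrite A0 map_mx0 mulmx0 => /esym/eqP.
    by rewrite scaler_eq0 (negbTE v0) orbF mulf_eq0 (negbTE (expf_neq0 n q0')) => /eqP.
- move=> s Ss; exists 0%N, (s%:P)%:M; split.
  + by apply: poly_mx_over_scalar; rewrite polyOverC.
  + by rewrite map_scalar_mx /= /horner_eval hornerC mul_scalar_mx expr0 mul1r.
  + by rewrite map_scalar_mx /= /horner_eval hornerC mul_mx_scalar expr0 mul1r.
- move=> _ /(nthP 0)[i iN <-]; pose j : 'I_N := Ordinal iN.
  exists (psi j); split.
  + exists 1%N, (D j); rewrite !expr1; split; [exact: SD|exact: (yb j)|exact: (vD j)].
  (* This is an eigenvalue of a matrix with entries in [S]. *)
  + have Sl : q.[z'] * psi j \in S.
      apply: (Scl (char_poly (ev z' (D j)))).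
      * rewrite /char_poly /determinant; apply: rpred_sum => p _; apply: rpredM.
          by rewrite rpredX // rpredN1.
        apply: rpred_prod => l _; rewrite !mxE rpredB ?rpredMn ?polyOverX // polyOverC.
        by rewrite /horner_eval rpred_horner //; exact: (hd _).1.
      * by rewrite monic_neq0 // char_poly_monic.
      * by rewrite -eigenvalue_root_char; apply/eigenvalueP; exists v.
    by rewrite -(mulKf q0' (psi j)) rpredM ?rpredV ?rpred_horner.
  + move=> a' ga'; have Jj : J j by apply/asboolP; exists a'.
    by rewrite (phom_inj hG ga' (ha j Jj)); exact: gpsi.
Qed.

(** The head of [zs] is adjoined last. Closing up after every adjunction makes each level relatively
    closed, as one step of the descent requires. *)
Definition tower (S : divringClosed K) (zs : seq K) : divringClosed K :=
  foldr (fun z (T : divringClosed K) => acl (adjoin T z)) S zs.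

Lemma tower_sub (S : divringClosed K) zs x : x \in S -> x \in tower S zs.
Proof.
by move=> Sx; elim: zs => [//|z zs IH] /=; apply: acl_sub; exact: adjoin_sub.
Qed.

Lemma tower_mem (S : divringClosed K) zs z : z \in zs -> z \in tower S zs.
Proof.
elim: zs => [//|x zs IH]; rewrite inE => /predU1P[->|/IH h] /=; apply: acl_sub.
  exact: adjoin_gen.
exact: adjoin_sub.
Qed.

Lemma tower_closed (S : divringClosed K) zs : relatively_closed S -> relatively_closed (tower S zs).
Proof. by move=> Scl; case: zs => [//|z zs]; exact: acl_closed. Qed.

Theorem tower_specialization (S : divringClosed K) (tau : K) (zs ys : seq K) :
  (forall c, iota c \in S) -> relatively_closed S ->
  tau \in S -> tau != 0 -> G tau 0 ->
  {in ys, forall y, y \in tower S zs} ->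
  exists H : K -> K -> Prop, [/\ phom H, forall s, s \in S -> H s s &
    {in ys, forall y, exists y', [/\ H y y', y' \in S & forall a, G y a -> G y' a]}].
Proof.
move=> Sk Scl Stau tau0 gtau; elim: zs ys => [|z zs IH] ys ysT.
  exists (fun x x' => x = x' /\ x \in S); split=> //; last by move=> y /ysT Sy; exists y.
  split=> [|x _ y _ [<- Sx] [<- Sy]|x _ y _ [<- Sx] [<- Sy]|a [->]//].
  - by rewrite rpred1.
  - by rewrite rpredB.
  - by rewrite rpredM.
have [||||||H1 [hH1 H1S H1y]] := @acl_specialization (tower S zs) tau z ys.
- by move=> c; apply: tower_sub.
- exact: tower_closed.
- exact: tower_sub.
- by [].
- by [].
- exact: ysT.
have /choice[f hf] : forall y, exists y', y \in ys ->
    [/\ H1 y y', y' \in tower S zs & forall a, G y a -> G y' a].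
  by move=> y; have [/H1y[y' hy']|] := boolP (y \in ys); [exists y'|exists 0].
have [|H2 [hH2 H2S H2y]] := IH (map f ys).
  by move=> _ /mapP[y yys ->]; have [] := hf y yys.
exists (fun x x' => exists2 u, H1 x u & H2 u x'); split.
- split.
  + by exists 1; [exact: (phom1 hH1)|exact: (phom1 hH2)].
  + by move=> x x' y y' [u ? ?] [w ? ?]; exists (u - w); [exact: (phomB hH1)|exact: (phomB hH2)].
  + by move=> x x' y y' [u ? ?] [w ? ?]; exists (u * w); [exact: (phomM hH1)|exact: (phomM hH2)].
  + by move=> a [u /(phom_fun hH1) ->]; exact: (phom_fun hH2).
- by move=> s Ss; exists s; [apply: H1S; exact: tower_sub|exact: H2S].
- move=> y yys; have [H1f _ gf] := hf y yys.
  have [y' [H2f Sy' gy']] := H2y _ (map_f f yys); exists y'; split=> //; first by exists (f y).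
  by move=> a /gf/gy'.
Qed.

End Tower.

(** * Uniformizers in finite extensions of k(t) *)

Section RangeField.
Variables (k K : fieldType) (iota : {rmorphism k -> K}).

Definition range_field : {pred K} := fun x => `[< exists c, x = iota c >].

Lemma range_fieldP x : reflect (exists c, x = iota c) (x \in range_field).
Proof. exact: asboolP. Qed.

Lemma range_field_divring : divring_closed range_field.
Proof.
split=> [|x y /range_fieldP[c ->] /range_fieldP[d ->]|x y /range_fieldP[c ->] /range_fieldP[d ->]];
  apply/range_fieldP.
- by exists 1; rewrite rmorph1.
- by exists (c - d); rewrite rmorphB.
- by exists (c / d); rewrite fmorph_div.
Qed.
HB.instance Definition _ := GRing.isDivringClosed.Build K range_field range_field_divring.

Lemma range_field_mem c : iota c \in range_field.
Proof. by apply/range_fieldP; exists c. Qed.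

Lemma polyOver_range p : p \is a polyOver range_field -> exists P, p = map_poly iota P.
Proof.
move=> /polyOverP Sp; have /choice[f hf] : forall i, exists c, p`_i = iota c.
  by move=> i; exact/range_fieldP.
exists (\poly_(i < size p) f i); apply/polyP => i; rewrite coef_map coef_poly.
by case: ltnP => ip; [exact: hf|rewrite nth_default // [RHS](rmorph0 iota)].
Qed.

End RangeField.

Section Uniformizer.
Variables (k : fieldType) (K : closedFieldType) (iota : {rmorphism k -> K}).
Variable (G : K -> k -> Prop).
Hypothesis pG : is_place iota G.
Let hG := place_phom pG.
Notation vlt := (vlt G).
Notation veq := (veq G).
Variable t : K.
Hypotheses (t0 : t != 0) (gt : G t 0).

Lemma veq_exp x y n : veq x y -> veq (x ^+ n) (y ^+ n).
Proof.
move=> xy; elim: n => [|n IH]; first by rewrite !expr0; apply: (veq_refl pG); exact: oner_neq0.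
by rewrite !exprS; exact: (veq_mul pG).
Qed.

Lemma veq_sum_distinct (I : eqType) (s : seq I) (F : I -> K) : s != [::] -> uniq s ->
  {in s, forall i, F i != 0} ->
  {in s &, forall i j, i != j -> ~ veq (F i) (F j)} ->
  exists2 m, m \in s & veq (\sum_(i <- s) F i) (F m).
Proof.
elim: s => [//|i s IH] _ /= /andP[nis us] F0 Fd; have Fi0 := F0 i (mem_head _ _).
have [s0|s0] := eqVneq s [::].
  by exists i; rewrite ?mem_head // s0 big_seq1; exact: (veq_refl pG).
have [||m ms Em] := IH s0 us.
- by move=> j js; apply: F0; rewrite inE js orbT.
- by move=> j l js ls; apply: Fd; rewrite inE ?js ?ls orbT.
have mis : m \in i :: s by rewrite inE ms orbT.
have im : i != m by apply: contraNneq nis => ->.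
rewrite big_cons; have [lt|lt|eq] := vlt_total pG Fi0 (F0 m mis); last first.
- by case: (Fd i m (mem_head _ _) mis im).
- exists m => //; apply: (veq_trans pG _ Em); rewrite addrC; apply: (veq_addl pG).
  exact: (vlt_veql pG (veq_sym pG Em)).
- exists i; rewrite ?mem_head //; apply: (veq_addl pG).
  exact: (vlt_veqr pG (veq_sym pG Em)).
Qed.

(** On [k[t]] the valuation is the order at 0: a polynomial with nonzero constant term has that
    constant as its residue. *)
Lemma veq_poly (P : {poly k}) : P != 0 -> exists n, veq (map_poly iota P).[t] (t ^+ n).
Proof.
elim/poly_ind: P => [|P c IH]; first by rewrite eqxx.
rewrite rmorphD rmorphM /= map_polyX map_polyC /= hornerMXaddC.
have [->|c0] := eqVneq c 0.
  rewrite polyC0 addr0 rmorph0 addr0 => PX0.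
  have /IH[n hn] : P != 0 by apply: contra_neq PX0 => ->; rewrite mul0r.
  exists n.+1; rewrite exprSr; apply: (veq_mul pG) => //; exact: (veq_refl pG).
move=> _; exists 0%N; exists c; rewrite ?c0 // expr0 divr1 -[c in G _ c]add0r.
apply: (phomD hG); last exact: (place_const pG).
apply: (placeMl pG) => //; exists P.[0]; apply: (ppoly_horner hG) => // i.
by rewrite coef_map; exact: (place_const pG).
Qed.

Section Finite.
Variables (r : nat) (b : 'cV[K]_r).
Let T := adjoin (range_field iota) t.
Hypothesis b0 : b != 0.
Hypothesis bfree : forall c : 'rV[K]_r, mx_in T c -> c *m b = 0 -> c = 0.

(** These elements preserve the [T]-span of the entries of [b] by multiplication; they form a field
    of dimension at most [r] over [T]. *)
Definition finite_ext : {pred K} := fun x =>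
  `[< exists2 X : 'M[K]_r, mx_in T X & x *: b = X *m b >].

Lemma finite_extP x :
  reflect (exists2 X : 'M[K]_r, mx_in T X & x *: b = X *m b) (x \in finite_ext).
Proof. exact: asboolP. Qed.

Lemma lift_mx_in m n (X : 'M[K]_(m, n)) : mx_in T X ->
  exists X' : 'M[subfield_of T]_(m, n), X = map_mx (subfield_inj T) X'.
Proof.
move=> TX; exists (\matrix_(i, j) insubd 0 (X i j)); apply/matrixP => i j.
by rewrite !mxE /= /subfield_inj val_insubd TX.
Qed.

Lemma finite_ext_divring : divring_closed finite_ext.
Proof.
have T1 : mx_in T (1%:M : 'M_r) by move=> i j; rewrite mxE rpred_nat.
split.
- by apply/finite_extP; exists 1%:M; rewrite ?scale1r ?mul1mx.
- move=> x y /finite_extP[X TX Ex] /finite_extP[Y TY Ey]; apply/finite_extP.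
  exists (X - Y); first by move=> i j; rewrite !mxE rpredB.
  by rewrite scalerBl Ex Ey mulmxBl.
- move=> x y /finite_extP[X TX Ex] /finite_extP[Y TY Ey]; apply/finite_extP.
  have [->|y0] := eqVneq y 0.
    exists 0; first by move=> i j; rewrite mxE rpred0.
    by rewrite invr0 mulr0 scale0r mul0mx.
  (* A row in the kernel of [Y'] annihilates [y *: b], hence [b], and is 0 by freeness. *)
  have [Y' EY] := lift_mx_in TY; have uY : Y' \in unitmx.
    rewrite -row_free_unit -kermx_eq0; apply/eqP/row_matrixP => i; rewrite row0.
    apply: (map_mx_inj (f := subfield_inj T)); rewrite map_mx0; apply: bfree.
      by move=> l j; rewrite mxE; exact: valP.
    apply: (scalerI y0); rewrite scaler0 scalemxAr Ey mulmxA EY -map_mxM.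
    by rewrite (sub_kermxP (row_sub _ _)) map_mx0 mul0mx.
  have EV : y^-1 *: b = map_mx (subfield_inj T) (invmx Y') *m b.
    apply: (scalerI y0); rewrite scalerA mulfV // scale1r scalemxAr Ey mulmxA EY -map_mxM.
    by rewrite mulVmx // map_mx1 mul1mx.
  exists (X *m map_mx (subfield_inj T) (invmx Y')).
    by apply: mx_in_mul => // i j; rewrite mxE; exact: valP.
  by rewrite -mulmxA -EV -scalemxAr -Ex scalerA mulrC.
Qed.
HB.instance Definition _ := GRing.isDivringClosed.Build K finite_ext finite_ext_divring.
Definition finite_ext_subfield : divringClosed K := finite_ext.

Lemma finite_ext_sub x : x \in T -> x \in finite_ext.
Proof.
move=> Tx; apply/finite_extP; exists x%:M; last by rewrite mul_scalar_mx.
by move=> i j; rewrite mxE rpredMn.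
Qed.

(* Otherwise the terms of a linear relation with coefficients in [k[t]] would have pairwise distinct
   valuations. *)
Lemma finite_ext_dependent (x : 'I_r.+1 -> K) :
  (forall i, x i \in finite_ext) -> (forall i, x i != 0) ->
  exists (i j : 'I_r.+1) (n m : nat), (i < j)%N /\ veq (t ^+ n * x i) (t ^+ m * x j).
Proof.
move=> Lx x0; have /choice[X hX] : forall i, exists X : 'M[K]_r, mx_in T X /\ x i *: b = X *m b.
  by move=> i; have /finite_extP[X] := Lx i; exists X.
have [l bl] : exists l, b l 0 != 0.
  apply: contrapT => nb; case/eqP: b0; apply/colP => l; rewrite mxE; apply/eqP.
  by apply: contrapT => bl; apply: nb; exists l; apply/negP.
pose C := \matrix_(i < r.+1, j < r) X i l j.
have TC : mx_in T C by move=> i j; rewrite mxE; have [TX _] := hX i; exact: TX.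
have [C' EC] := lift_mx_in TC.
(* There are [r + 1] rows of length [r]; a relation among them is one among the [x i], because
   [b l 0] is nonzero. *)
have kC : kermx C' != 0.
  by rewrite -mxrank_eq0 mxrank_ker subn_eq0 -ltnNge ltnS rank_leq_col.
pose e' := nz_row (kermx C'); pose e := map_mx (subfield_inj T) e'.
have e0 : e != 0 by rewrite map_mx_eq0 nz_row_eq0.
have eC : e *m C = 0.
  by rewrite EC -map_mxM (sub_kermxP (nz_row_sub _)) map_mx0.
have Te i : e 0 i \in T by rewrite mxE; exact: valP.
have ex0 : \sum_i e 0 i * x i = 0.
  apply: (mulIf bl); rewrite mul0r mulr_suml.
  transitivity ((e *m C *m b) 0 0); last by rewrite eC mul0mx mxE.
  rewrite -mulmxA mxE; apply: eq_bigr => i _; rewrite -mulrA; congr (_ * _).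
  have [_ /colP/(_ l)] := hX i; rewrite !mxE => ->; apply: eq_bigr => j _.
  by rewrite mxE.
have [|q [Sq q0 qP]] := @adjoin_common_denominator _ (range_field iota) t [seq e 0 i | i <- enum 'I_r.+1].
  by move=> _ /mapP[i _ ->]; exact: Te.
have /choice[P hP] : forall i, exists P, q.[t] * e 0 i = (map_poly iota P).[t].
  move=> i; have [|p /polyOver_range[P ->] E] := qP (e 0 i); last by exists P.
  by rewrite map_f // mem_enum.
have Pe i : (P i == 0) = (e 0 i == 0).
  apply/idP/idP => [/eqP Pi0|/eqP ei0].
    by have /eqP := hP i; rewrite Pi0 rmorph0 horner0 mulf_eq0 (negbTE q0).
  apply: contrapT => /negP/veq_poly[n]; rewrite -hP ei0 mulr0.
  by move=> /(veq_neq0 pG)[]; rewrite eqxx.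
have /choice[n hn] : forall i, exists n, P i != 0 -> veq (map_poly iota (P i)).[t] (t ^+ n).
  move=> i; have [Pi0|/veq_poly[n hn]] := eqVneq (P i) 0; first by exists 0%N.
  by exists n.
apply: contrapT => nex.
pose s := [seq i <- enum 'I_r.+1 | P i != 0]; pose F i := (map_poly iota (P i)).[t] * x i.
have tx i : i \in s -> veq (F i) (t ^+ n i * x i).
  rewrite mem_filter => /andP[Pi0 _]; apply: (veq_mul pG); first exact: hn.
  exact: (veq_refl pG).
have [||||m ms Em] := @veq_sum_distinct _ s F.
- apply: contra_neq e0 => s0; apply/rowP => i; rewrite [RHS]mxE; apply/eqP; rewrite -Pe.
  apply: contrapT => /negP Pi0; have : i \in s by rewrite mem_filter Pi0 mem_enum.
  by rewrite s0.
- by rewrite filter_uniq // enum_uniq.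
- by move=> i /tx/(veq_neq0 pG)[].
- move=> i j /tx hi /tx hj ij Fij.
  have hij := veq_trans pG (veq_trans pG (veq_sym pG hi) Fij) hj.
  apply: nex; have [lt|lt|/val_inj E] := ltngtP i j; last by rewrite E eqxx in ij.
    by exists i, j, (n i), (n j).
  by exists j, i, (n j), (n i); split=> //; exact: (veq_sym pG).
have [+ _] := veq_neq0 pG Em; case/negP; apply/eqP.
transitivity (q.[t] * \sum_i e 0 i * x i); last by rewrite ex0 mulr0.
rewrite /s big_filter big_enum_cond /= mulr_sumr big_mkcond /=.
apply: eq_bigr => i _; rewrite mulrA hP /F; case: ifP => // /negbFE/eqP ->.
by rewrite rmorph0 horner0 mul0r.
Qed.

(** A dependence among the powers of [x] makes the valuations of [t] and [x] commensurable; as both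
    are positive, the exponents have the right signs. *)
Lemma finite_ext_power x : x \in finite_ext -> x != 0 -> G x 0 ->
  exists n m, [/\ (0 < n)%N, (0 < m)%N & veq (t ^+ n) (x ^+ m)].
Proof.
move=> Lx x0 gx.
have [i|i|i [j [n [m [ij E]]]]] := @finite_ext_dependent (fun i => x ^+ i).
- by rewrite rpredX.
- by rewrite expf_neq0.
have [nm|mn] := leqP n m.
  exfalso; suff lt : vlt (t ^+ n * x ^+ i) (t ^+ m * x ^+ j).
    by apply: (vlt_irr pG (x := t ^+ m * x ^+ j)); apply: (vlt_veql pG E).
  have c0 : t ^+ n * x ^+ i != 0 by rewrite mulf_neq0 ?expf_neq0.
  split=> //; rewrite -(subnK nm) -(subnK (ltnW ij)) !exprD mulrACA mulfK //.
  apply: (placeMl pG); first by exists (0 ^+ (m - n)); exact: (phomX hG).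
  by have := phomX hG (j - i) gx; rewrite expr0n subn_eq0 leqNgt ij.
exists (n - m)%N, (j - i)%N; rewrite !subn_gt0; split=> //.
have c0 : t ^+ m * x ^+ i != 0 by rewrite mulf_neq0 ?expf_neq0.
have {}E : veq ((t ^+ m * x ^+ i) * t ^+ (n - m)) ((t ^+ m * x ^+ i) * x ^+ (j - i)).
  by rewrite mulrAC -exprD -mulrA -exprD !subnKC // ltnW.
case: E => a a0 E; exists a => //.
by move: E; rewrite -mulf_div divff // mul1r.
Qed.

(** Otherwise there is a sequence of strictly decreasing positive valuations starting at [t]. Two of
    its first [r + 1] terms have valuations differing by a multiple of that of [t], although the
    difference is positive and smaller than the valuation of [t]. *)
Lemma finite_ext_uniformizer : exists s, [/\ s \in finite_ext, s != 0, G s 0 &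
  forall x, x \in finite_ext -> G x 0 -> exists c, G (x / s) c].
Proof.
apply: contrapT => nex.
have /choice[f hf] : forall s, exists s', s \in finite_ext -> s != 0 -> G s 0 ->
    [/\ s' \in finite_ext, s' != 0, G s' 0 & G (s / s') 0].
  move=> s; have [[Ls [s0 gs]]|ns] := pselect (s \in finite_ext /\ s != 0 /\ G s 0); last first.
    by exists 0 => *; case: ns.
  apply: contrapT => ns; apply: nex; exists s; split=> // x Lx gx.
  apply: contrapT => nx; apply: ns; exists x => _ _ _; split=> //.
    apply/eqP => x0; apply: nx; exists 0; rewrite x0 mul0r; exact: (phom0 hG).
  by have [//|] := place_total pG (x / s); rewrite invf_div.
pose x i := iter i f t.
have xP i : [/\ x i \in finite_ext, x i != 0, G (x i) 0 & exists c, G (t / x i) c].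
  elim: i => [|i [Lx x0 gx [c gc]]].
    split=> //; first by apply: finite_ext_sub; exact: adjoin_gen.
    by exists 1; rewrite divff //; exact: (phom1 hG).
  have [Lx' x0' gx' gxx] := hf _ Lx x0 gx; split=> //.
  have -> : t / x i.+1 = t / x i * (x i / x i.+1) by rewrite mulrA divfK.
  by exists 0; apply: (placeMl pG) gxx; exists c.
have lt i j : (i < j)%N -> G (x i / x j) 0.
  elim: j => [//|j IH]; rewrite ltnS leq_eqVlt => /predU1P[->|/IH gij].
    by have [Lx x0 gx _] := xP j; have [] := hf _ Lx x0 gx.
  have [Lx x0 gx _] := xP j; have [_ _ _ gjj] := hf _ Lx x0 gx.
  have -> : x i / x j.+1 = x i / x j * (x j / x j.+1) by rewrite mulrA divfK.
  by apply: (placeMl pG) gjj; exists 0.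
have [i|i|i [j [n [m [ij E]]]]] := @finite_ext_dependent (fun i => x i).
- by have [] := xP i.
- by have [] := xP i.
have [_ xi0 gxi [c gc]] := xP i; have [_ xj0 gxj _] := xP j.
have [mn|nm] := leqP m n.
  suff lt' : vlt (t ^+ m * x j) (t ^+ n * x i).
    by apply: (vlt_irr pG (x := t ^+ n * x i)); apply: (vlt_veql pG (veq_sym pG E)).
  split; first by rewrite mulf_neq0 ?expf_neq0.
  rewrite -{1}(subnK mn) exprD -mulrA mulrCA -mulf_div divff ?expf_neq0 // mul1r -mulrA.
  apply: (placeMl pG); last exact: lt.
  by exists (0 ^+ (n - m)); exact: (phomX hG).
suff lt' : vlt (t ^+ n * x i) (t ^+ m * x j).
  by apply: (vlt_irr pG (x := t ^+ m * x j)); apply: (vlt_veql pG E).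
split; first by rewrite mulf_neq0 ?expf_neq0.
have -> : t ^+ m * x j / (t ^+ n * x i) = t ^+ (m - n.+1) * (t / x i) * x j.
  rewrite -{1}(subnK nm) exprD exprS.
  move: (t ^+ n) (expf_neq0 n t0) => u u0; move: (t ^+ _) => v.
  by field; rewrite u0 xi0.
apply: (placeMl pG) => //; exists (0 ^+ (m - n.+1) * c); apply: (phomM hG) => //.
exact: (phomX hG).
Qed.

(** For [x] of positive valuation, both [s] and [x] have valuations commensurable with that of [t],
    so some multiple of the first reaches the second. *)
Lemma finite_ext_archimedean s : s \in finite_ext -> s != 0 -> G s 0 ->
  forall x, x \in finite_ext -> x != 0 -> exists n, exists c, G (s ^+ n / x) c.
Proof.
move=> Ls s0 gs x Lx x0.
have [[c gx]|gx] := place_total pG x; last first.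
  by exists 0%N, 0; rewrite expr0 div1r.
have [c0|c0] := eqVneq c 0; last first.
  by exists 0%N, c^-1; rewrite expr0 div1r; have [] := place_unit pG gx c0.
rewrite c0 in gx; have [a [b' [a0 b0' Es]]] := finite_ext_power Ls s0 gs.
have [u [v [u0 v0 Ex]]] := finite_ext_power Lx x0 gx.
have E : veq (s ^+ (b' * u)) (x ^+ (v * a)).
  rewrite !exprM; apply: (veq_trans pG _ (veq_exp a Ex)).
  by apply: (veq_trans pG (veq_exp u (veq_sym pG Es))); rewrite -!exprM mulnC; apply: (veq_refl pG); rewrite expf_neq0.
exists (b' * u)%N; case: E => e e0 E.
have -> : s ^+ (b' * u) / x = s ^+ (b' * u) / x ^+ (v * a) * x ^+ (v * a).-1.
  have va : (0 < v * a)%N by rewrite muln_gt0 v0.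
  rewrite -{1}(prednK va) exprS; move: (x ^+ _) (expf_neq0 (v * a).-1 x0) => y y0.
  by field; rewrite x0 y0.
exists (e * 0 ^+ (v * a).-1); apply: (phomM hG) => //; exact: (phomX hG).
Qed.

End Finite.

Theorem finite_uniformizer (xs : seq K) :
  {in xs, forall x, x \in acl (adjoin (range_field iota) t)} ->
  exists (F : divringClosed K) (s : K), [/\ {in xs, forall x, x \in F},
    forall c, iota c \in F, [/\ s \in F, s != 0 & G s 0],
    forall x, x \in F -> G x 0 -> exists c, G (x / s) c &
    forall x, x \in F -> x != 0 -> exists n, exists c, G (s ^+ n / x) c].
Proof.
move=> xsA.
have [r [b [b0 bfree bM]]] := finite_extension_basis (fun x h => elimT (aclP _ _) (xsA x h)).
have [s [Ls s0 gs sP]] := finite_ext_uniformizer b0.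
exists (finite_ext_subfield bfree), s; split=> //.
- by move=> x /bM hx; apply/finite_extP.
- move=> c; apply: finite_ext_sub; apply: adjoin_sub; exact: range_field_mem.
- exact: (finite_ext_archimedean b0 bfree).
Qed.

End Uniformizer.

(** * Expansions in powers of a uniformizer *)

Section Truncation.
Variables (k K : fieldType) (iota : {rmorphism k -> K}) (G : K -> k -> Prop).
Hypothesis pG : is_place iota G.
Let hG := place_phom pG.
Variables (F : divringClosed K) (s : K).
Hypothesis Fk : forall c, iota c \in F.
Hypotheses (Fs : s \in F) (s0 : s != 0) (gs : G s 0).
Hypothesis sP : forall x, x \in F -> G x 0 -> exists c, G (x / s) c.

(* [P] is the expansion of [x] in powers of the uniformizer [s], up to order [N]. *)
Definition trunc (N : nat) (x : K) (P : {poly k}) : Prop :=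
  exists w, (exists c, G w c) /\ x = (map_poly iota P).[s] + s ^+ N * w.

Lemma poly_integral P : exists c, G (map_poly iota P).[s] c.
Proof.
exists P.[0]; apply: (ppoly_horner hG) => // i; rewrite coef_map; exact: (place_const pG).
Qed.

Lemma trunc_ex N x : x \in F -> (exists c, G x c) -> exists P, trunc N x P.
Proof.
(* The remainder is kept in [F], so that its residue can be subtracted and [s] divided out once
   more. *)
suff H : x \in F -> (exists c, G x c) -> exists P w, [/\ w \in F, exists c, G w c &
    x = (map_poly iota P).[s] + s ^+ N * w].
  by move=> Fx gx; have [P [w [_ gw E]]] := H Fx gx; exists P, w.
elim: N x => [|N IH] x Fx [c gx].
  by exists 0, x; rewrite rmorph0 horner0 add0r expr0 mul1r; split=> //; exists c.
have gxc : G (x - iota c) 0 by rewrite -(subrr c); exact: (phomB hG gx (place_const pG c)).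
have Fxc : x - iota c \in F by rewrite rpredB.
have [|P [w [Fw gw E]]] := IH _ _ (sP Fxc gxc); first by rewrite rpred_div.
exists (P * 'X + c%:P), w; split=> //.
rewrite rmorphD rmorphM /= map_polyX map_polyC /= hornerMXaddC.
rewrite -[LHS](subrK (iota c)) -[x - _](divfK s0) E mulrDl addrAC; congr (_ + _).
by rewrite exprS; ring.
Qed.

Lemma trunc_const N c : trunc N (iota c) c%:P.
Proof.
exists 0; rewrite map_polyC hornerC mulr0 addr0; split=> //; exists 0; exact: (phom0 hG).
Qed.

Lemma trunc_B N x P y Q : trunc N x P -> trunc N y Q -> trunc N (x - y) (P - Q).
Proof.
move=> [w [[c gw] ->]] [v [[d gv] ->]]; exists (w - v); split.
  by exists (c - d); exact: (phomB hG).
by rewrite rmorphB hornerD hornerN mulrBr; ring.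
Qed.

Lemma trunc_D N x P y Q : trunc N x P -> trunc N y Q -> trunc N (x + y) (P + Q).
Proof.
move=> hx hy; have := trunc_B hx (trunc_B (trunc_const N 0) hy).
by rewrite rmorph0 polyC0 !sub0r !opprK.
Qed.

Lemma trunc_M N x P y Q : trunc N x P -> trunc N y Q -> trunc N (x * y) (P * Q).
Proof.
move=> [w [[c gw] ->]] [v [[d gv] ->]].
have [p gp] := poly_integral P; have [q gq] := poly_integral Q.
exists ((map_poly iota P).[s] * v + w * (map_poly iota Q).[s] + s ^+ N * w * v); split.
  exists (p * d + c * q + 0 ^+ N * c * d); apply: (phomD hG).
    by apply: (phomD hG); exact: (phomM hG).
  by do 2![apply: (phomM hG) => //]; exact: (phomX hG).
by rewrite rmorphM hornerM; ring.
Qed.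

Lemma trunc_sum N (I : Type) (r : seq I) (x : I -> K) (P : I -> {poly k}) :
  (forall i, trunc N (x i) (P i)) -> trunc N (\sum_(i <- r) x i) (\sum_(i <- r) P i).
Proof.
move=> h; elim/big_ind2: _ => //; last by move=> *; exact: trunc_D.
by rewrite -(rmorph0 iota) -polyC0; exact: trunc_const.
Qed.

Lemma trunc_X N : trunc N s 'X.
Proof.
exists 0; rewrite map_polyX hornerX mulr0 addr0; split=> //; exists 0; exact: (phom0 hG).
Qed.

Lemma trunc_exp N n : trunc N (s ^+ n) 'X^n.
Proof.
elim: n => [|n IH]; first by rewrite !expr0 -(rmorph1 iota) -polyC1; exact: trunc_const.
by rewrite !exprS; apply: trunc_M => //; exact: trunc_X.
Qed.

Lemma trunc_eq0 N P : trunc N 0 P -> forall i, (i < N)%N -> P`_i = 0.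
Proof.
elim: N P => [//|N IH] P [w [[c gw] E]].
have EP : (map_poly iota P).[s] = s ^+ N.+1 * (- w).
  by apply/eqP; rewrite mulrN -addr_eq0 -E.
have P0 : P`_0 = 0.
  rewrite -horner_coef0; apply: (phom_inj hG (x := (map_poly iota P).[s])).
    by apply: (ppoly_horner hG) => // i; rewrite coef_map; exact: (place_const pG).
  rewrite EP exprS -mulrA mulrC; apply: (placeMl pG) => //.
  by exists (0 ^+ N * - c); apply: (phomM hG); [exact: (phomX hG)|exact: (phomN hG)].
have EPX : P = drop_poly 1 P * 'X.
  rewrite -[LHS](poly_take_drop 1) expr1 (_ : take_poly 1 P = 0) ?add0r //.
  by apply/polyP => i; rewrite coef_take_poly coef0; case: i.
move=> [//|i] iN; rewrite EPX coefMX /=; apply: IH => //; exists w; split; first by exists c.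
have E2 : (map_poly iota P).[s] = (map_poly iota (drop_poly 1 P)).[s] * s.
  by rewrite [in LHS]EPX rmorphM /= map_polyX hornerMX.
by apply: (mulIf s0); rewrite mul0r mulrDl -E2 EP exprS; ring.
Qed.

Lemma trunc_coef0 N x P c : trunc N.+1 x P -> G x c -> P`_0 = c.
Proof.
move=> [w [[d gw] Ex]] gx; rewrite -horner_coef0.
have gP : G (map_poly iota P).[s] P.[0].
  by apply: (ppoly_horner hG) => // i; rewrite coef_map; exact: (place_const pG).
have gsw : G (s ^+ N.+1 * w) 0.
  rewrite exprS -mulrA mulrC; apply: (placeMl pG) => //.
  by exists (0 ^+ N * d); apply: (phomM hG) => //; exact: (phomX hG).
by apply: (phom_inj hG _ gx); rewrite Ex -[P.[0]]addr0; exact: (phomD hG).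
Qed.

End Truncation.

(** * Curve selection *)

Definition upper_mx (R : nmodType) n (A : 'M[R]_n) := forall i j : 'I_n, (j < i)%N -> A i j = 0.

Lemma upper_mxM (R : pzSemiRingType) n (A B : 'M[R]_n) : upper_mx A -> upper_mx B -> upper_mx (A *m B).
Proof.
move=> hA hB i j ji; rewrite mxE big1 // => l _.
have [li|il] := ltnP l i; first by rewrite hA ?mul0r.
by rewrite hB ?mulr0 // (leq_trans ji).
Qed.

Lemma upper_mx_inv (k : fieldType) n (g : 'M[k]_n) :
  g \in unitmx -> upper_mx g -> upper_mx (invmx g).
Proof.
move=> ug hg; have gii i : g i i != 0.
  move: ug; rewrite unitmxE -det_tr det_trig ?unitfE.
    by move/prodf_neq0/(_ i isT); rewrite mxE.
  by apply/is_trig_mxP => a b ab; rewrite mxE hg.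
move=> i j; have [m] := ubnP (j : nat); elim: m j => [//|m IH] j jm ji.
have : (invmx g *m g) i j = 0.
  by rewrite mulVmx // mxE; case: eqP ji => // ->; rewrite ltnn.
rewrite mxE (bigD1 j) //= big1 ?addr0 => [/eqP|l lj].
  by rewrite mulf_eq0 (negbTE (gii j)) orbF => /eqP.
have [{}lj|jl|E] := ltngtP l j; last by rewrite (val_inj E) eqxx in lj.
  by rewrite IH ?mul0r //; [exact: leq_trans lj _|exact: ltn_trans lj _].
by rewrite hg ?mulr0.
Qed.

Definition eqm (k : fieldType) m n N (A B : 'M[{poly k}]_(m, n)) :=
  forall i j l, (l < N)%N -> (A i j)`_l = (B i j)`_l.

(* A curve in [U_d] over [k((t))] along which [mu] tends to [nu], truncated at order [h + 1]: with [P]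
   standing for [t^e g^-1] and [Q] for [t^(h - e) g], the matrix [R] is the truncation of [g mu(a) g^-1]. *)
Definition formal_degeneration (k : fieldType) (L : falgType k) d (mu nu : L -> 'M[k]_d) :=
  exists (h : nat) (P Q : 'M[{poly k}]_d),
  [/\ upper_mx P /\ upper_mx Q, eqm h.+1 (P *m Q) ('X^h)%:M, eqm h.+1 (Q *m P) ('X^h)%:M &
    forall a, exists R, [/\ upper_mx R,
      eqm h.+1 (map_mx polyC (mu a) *m P) (P *m R) & forall i j, (R i j)`_0 = nu a i j]].

Lemma rep_sum (k : fieldType) (L : falgType k) d (rho : L -> 'M[k]_d) (I : Type) (r : seq I)
  (c : I -> k) (v : I -> L) :
  is_rep rho -> rho (\sum_(i <- r) c i *: v i) = \sum_(i <- r) c i *: rho (v i).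
Proof.
move=> [lin _ _]; have r0 : rho 0 = 0.
  by have := lin (-1) 0 0; rewrite scaler0 addr0 scaleN1r addNr.
by elim: r => [|i r IH]; rewrite ?big_nil // !big_cons lin IH.
Qed.

Section Selection.
Variables (k : closedFieldType) (L : falgType k) (d : nat) (mu nu : L -> 'M[k]_d).
Hypotheses (mu_tri : triangular_rep mu) (nu_tri : triangular_rep nu).

Section PlaceGiven.
Variables (K : closedFieldType) (iota : {rmorphism k -> K}) (G : K -> k -> Prop).
Hypothesis pG : is_place iota G.
Let hG := place_phom pG.
Notation muK a := (map_mx iota (mu a)).

Variables (g g' : 'M[K]_d).
Hypotheses (gg' : g *m g' = 1%:M) (ug : upper_mx g) (ug' : upper_mx g').
Hypothesis gnu : forall a i j, G ((g *m muK a *m g') i j) (nu a i j).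

Let g'g : g' *m g = 1%:M. Proof. exact: mulmx1C. Qed.

Lemma umu a : upper_mx (mu a).
Proof. by case: mu_tri => _; exact. Qed.

(** Without elements of positive valuation the place is a homomorphism on all of [K]; the residues
    of [g] and its inverse conjugate [mu] into [nu], so constant matrices and [h = 0] suffice. *)
Lemma selection_trivial : ~ (exists t, t != 0 /\ G t 0) -> formal_degeneration mu nu.
Proof.
move=> nt; have tot x : exists a, G x a.
  have [//|gx] := place_total pG x; exists 0.
  have [->|x0] := eqVneq x 0; first exact: (phom0 hG).
  by case: nt; exists x^-1; rewrite invr_eq0.
have /choice[f hf] := tot.
pose P0 := map_mx f g'; pose Q0 := map_mx f g.
have PQ : Q0 *m P0 = 1%:M.
  apply/matrixP => i j; apply: (phom_inj hG (x := (g *m g') i j)).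
    by apply: (phom_mulmx hG) => ? ?; rewrite mxE.
  by rewrite gg' !mxE -(rmorph_nat iota); exact: (place_const pG).
have f0 : f 0 = 0 by exact: (phom_fun hG (hf 0)).
have upC (A : 'M[k]_d) : upper_mx A -> upper_mx (map_mx polyC A).
  by move=> hA i j ij; rewrite mxE hA // polyC0.
have uP : upper_mx P0 by move=> i j ij; rewrite mxE ug'.
have uQ : upper_mx Q0 by move=> i j ij; rewrite mxE ug.
exists 0%N, (map_mx polyC P0), (map_mx polyC Q0); split.
- by split; exact: upC.
- by rewrite -map_mxM (mulmx1C PQ) map_scalar_mx expr0.
- by rewrite -map_mxM PQ map_scalar_mx expr0.
- move=> a; exists (map_mx polyC (Q0 *m mu a *m P0)); split.
  + by apply: upC; do 2![apply: upper_mxM => //]; exact: umu.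
  + by rewrite -!map_mxM !mulmxA (mulmx1C PQ) mul1mx.
  + move=> i j; rewrite mxE coefC /=; apply: (phom_inj hG _ (gnu a i j)).
    apply: (phom_mulmx hG) => ? ?; last by rewrite mxE.
    by apply: (phom_mulmx hG) => ? ?; rewrite mxE //; exact: (place_const pG).
Qed.

Variables (F : divringClosed K) (s : K).
Hypothesis Fk : forall c, iota c \in F.
Hypotheses (Fs : s \in F) (s0 : s != 0) (gs : G s 0).
Hypothesis sP : forall x, x \in F -> G x 0 -> exists c, G (x / s) c.
Hypothesis sA : forall x, x \in F -> x != 0 -> exists n, exists c, G (s ^+ n / x) c.
Hypotheses (Fg : forall i j, g i j \in F) (Fg' : forall i j, g' i j \in F).

Lemma common_power (xs : seq K) : {in xs, forall x, x \in F} ->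
  exists e, {in xs, forall x, exists c, G (s ^+ e * x) c}.
Proof.
elim: xs => [|x xs IH] xsF; first by exists 0%N.
have [|e he] := IH; first by move=> y yxs; apply: xsF; rewrite inE yxs orbT.
have [n [c gc]] : exists n, exists c, G (s ^+ n * x) c.
  have [->|x0] := eqVneq x 0; first by exists 0%N, 0; rewrite mulr0; exact: (phom0 hG).
  have [||n [c gc]] := @sA x^-1; rewrite ?rpredV ?invr_eq0 ?xsF ?mem_head //.
  by exists n, c; rewrite invrK in gc.
exists (n + e)%N => y; rewrite inE => /predU1P[->|/he[c' gc']].
  by exists (0 ^+ e * c); rewrite exprD mulrAC mulrC; apply: (phomM hG) => //; exact: (phomX hG).
by exists (0 ^+ n * c'); rewrite exprD -mulrA; apply: (phomM hG) => //; exact: (phomX hG).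
Qed.

Lemma selection_uniformizer : formal_degeneration mu nu.
Proof.
have [|e he] := @common_power ([seq g p.1 p.2 | p <- enum [set: 'I_d * 'I_d]] ++
    [seq g' p.1 p.2 | p <- enum [set: 'I_d * 'I_d]]).
  by move=> x; rewrite mem_cat => /orP[]/mapP[p _ ->].
have hg i j : exists c, G (s ^+ e * g i j) c.
  by apply: he; rewrite mem_cat; apply/orP; left; apply/mapP; exists (i, j); rewrite ?mem_enum ?inE.
have hg' i j : exists c, G (s ^+ e * g' i j) c.
  by apply: he; rewrite mem_cat; apply/orP; right; apply/mapP; exists (i, j); rewrite ?mem_enum ?inE.
(* [P] and [Q] come from [s^e] times the inverse of [g] and [s^e] times [g], whose product is
   [s^(e + e)]. *)
pose h := (e + e)%N; pose N := h.+1.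
(* Truncations are chosen elementwise with 0 sent to 0, which preserves triangularity. *)
have /choice[tr htr] : forall x, exists P, (x = 0 -> P = 0) /\
    (x \in F -> (exists c, G x c) -> trunc iota G s N x P).
  move=> x; have [->|x0] := eqVneq x 0.
    exists 0; split=> // _ _; exists 0; rewrite rmorph0 horner0 add0r mulr0; split=> //.
    by exists 0; exact: (phom0 hG).
  have [[Fx gx]|nx] := pselect (x \in F /\ exists c, G x c).
    have [P hP] := trunc_ex pG Fk Fs s0 sP N Fx gx; exists P; split=> // x00.
    by rewrite x00 eqxx in x0.
  by exists 0; split=> // Fx gx; case: nx.
have tr0 : tr 0 = 0 by have [-> //] := htr 0.
have utr (A : 'M[K]_d) : upper_mx A -> upper_mx (map_mx tr A).
  by move=> hA i j ij; rewrite mxE hA // tr0.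
have upZ c (A : 'M[K]_d) : upper_mx A -> upper_mx (c *: A).
  by move=> hA i j ij; rewrite mxE hA // mulr0.
have trmul (A B : 'M[K]_d) (A' B' : 'M[{poly k}]_d) :
    (forall i j, trunc iota G s N (A i j) (A' i j)) ->
    (forall i j, trunc iota G s N (B i j) (B' i j)) ->
    forall i j, trunc iota G s N ((A *m B) i j) ((A' *m B') i j).
  by move=> hA hB i j; rewrite !mxE; apply: (trunc_sum pG) => l; exact: (trunc_M pG gs).
have treq (A : 'M[K]_d) (A' B' : 'M[{poly k}]_d) :
    (forall i j, trunc iota G s N (A i j) (A' i j)) ->
    (forall i j, trunc iota G s N (A i j) (B' i j)) -> eqm N A' B'.
  move=> hA hB i j l lN; apply/eqP; rewrite -subr_eq0 -coefB; apply/eqP.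
  apply: (trunc_eq0 pG s0 gs (N := N)) => //; rewrite -(subrr (A i j)).
  exact: (trunc_B pG).
pose PK := s ^+ e *: g'; pose QK := s ^+ e *: g.
have hP i j : trunc iota G s N (PK i j) (map_mx tr PK i j).
  rewrite [map_mx _ _ i j]mxE; have [_] := htr (PK i j); apply; first by rewrite mxE rpredM ?rpredX.
  by rewrite mxE.
have hQ i j : trunc iota G s N (QK i j) (map_mx tr QK i j).
  rewrite [map_mx _ _ i j]mxE; have [_] := htr (QK i j); apply; first by rewrite mxE rpredM ?rpredX.
  by rewrite mxE.
have sc i j : trunc iota G s N (((s ^+ h)%:M : 'M[K]_d) i j) ((('X^h)%:M : 'M[{poly k}]_d) i j).
  rewrite !mxE; case: eqP => _; first by rewrite !mulr1n; exact: (trunc_exp pG gs).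
  by rewrite !mulr0n -(rmorph0 iota) -polyC0; exact: (trunc_const pG).
have EPQ : PK *m QK = (s ^+ h)%:M.
  by rewrite -scalemxAl -scalemxAr g'g scalerA -exprD scalemx1.
have EQP : QK *m PK = (s ^+ h)%:M.
  by rewrite -scalemxAl -scalemxAr gg' scalerA -exprD scalemx1.
exists h, (map_mx tr PK), (map_mx tr QK); split.
- by split; apply: utr; exact: upZ.
- by apply: (treq (PK *m QK)); [exact: trmul|rewrite EPQ].
- by apply: (treq (QK *m PK)); [exact: trmul|rewrite EQP].
- move=> a; pose RK := g *m muK a *m g'.
  have FR i j : RK i j \in F.
    rewrite mxE; apply: rpred_sum => l _; rewrite rpredM // mxE.
    by apply: rpred_sum => m _; rewrite rpredM // mxE.
  have hR i j : trunc iota G s N (RK i j) (map_mx tr RK i j).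
    rewrite [map_mx _ _ i j]mxE; have [_] := htr (RK i j); apply; first exact: FR.
    by exists (nu a i j); exact: gnu.
  exists (map_mx tr RK); split.
  + apply: utr; do 2![apply: upper_mxM => //].
    by move=> i j ij; rewrite mxE umu // rmorph0.
  + apply: (treq (muK a *m PK)).
      by apply: trmul => // i j; rewrite !mxE; exact: (trunc_const pG).
    have -> : muK a *m PK = PK *m RK.
      by rewrite /RK -scalemxAl -scalemxAr !mulmxA g'g mul1mx.
    exact: trmul.
  + by move=> i j; apply: (trunc_coef0 pG gs (hR i j)); exact: gnu.
Qed.

End PlaceGiven.

(* For an ultrafilter containing these sets, a polynomial function vanishing at the generic point of
   the orbit also vanishes at [nu]. *)
Definition rep_filter : set_system 'M[k]_d := fun A => exists f,
  [/\ @polyfun k L d f, f nu != 0 &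
    forall g, in_Ud g -> f (conj_rep g mu) != 0 -> A g].

Lemma rep_filter_proper : zariski_closure (Ud_orbit mu) nu -> ProperFilter rep_filter.
Proof.
move=> nu_cl; split.
  move=> [f [pf fnu fA]]; case/eqP: fnu; apply: nu_cl pf _ => _ [g [Ug ->]].
  by apply/eqP; apply: contrapT => /negP; exact: fA.
split.
- by exists (fun=> 1); split; rewrite ?oner_eq0 //; exact: pf_const.
- move=> A B [f [pf fnu fA]] [f' [pf' fnu' fB]]; exists (fun rho => f rho * f' rho).
  split; rewrite ?mulf_neq0 //; first exact: pf_mul.
  by move=> g Ug; rewrite mulf_eq0 => /norP[f0 f0']; split; [exact: fA|exact: fB].
- by move=> A B AB [f [pf fnu fA]]; exists f; split=> // g Ug f0; apply: AB; exact: fA.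
Qed.

Theorem curve_selection : zariski_closure (Ud_orbit mu) nu -> formal_degeneration mu nu.
Proof.
move=> /rep_filter_proper/ultraFilterLemma[U [UU FU]].
pose I : pointedType := HB.pack 'M[k]_d (isPointed.Build 'M[k]_d 0).
have [K [iota [p [pD pM pc pP]]]] := @ultrapower_ex k I U UU.
have U_Ud : U [set g | in_Ud g]%classic.
  by apply: FU; exists (fun=> 1); split; rewrite ?oner_eq0 //; exact: pf_const.
have p0 : p (fun=> 0) = 0 by rewrite pc rmorph0.
have pN f : p (fun x => - f x) = - p f.
  by apply/eqP; rewrite -addr_eq0 -pD -p0; apply/eqP; congr p; apply/funext => x; rewrite addNr.
have psum n (f : 'I_n -> I -> k) : p (fun x => \sum_(j < n) f j x) = \sum_(j < n) p (f j).
  elim: n f => [|n IH] f; first by rewrite big_ord0 -p0; congr p; apply/funext => x; rewrite big_ord0.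
  rewrite big_ord_recl -IH -pD; congr p; apply/funext => x; by rewrite big_ord_recl.
pose pm (A : I -> 'M[k]_d) : 'M[K]_d := \matrix_(i, j) p (fun x => A x i j).
have pmM A B : pm (fun x => A x *m B x) = pm A *m pm B.
  apply/matrixP => i j; rewrite !mxE (_ : (fun x => _) = (fun x => \sum_(l < d) A x i l * B x l j)).
    by rewrite (psum d (fun l x => A x i l * B x l j)); apply: eq_bigr => l _; rewrite pM !mxE.
  by apply/funext => x; rewrite mxE.
have pmE A B : U [set x | A x = B x]%classic -> pm A = pm B.
  move=> AB; apply/matrixP => i j; rewrite !mxE; apply/pP.
  by apply: filterS AB => x /= ->.
have pmc A : pm (fun=> A) = map_mx iota A by apply/matrixP => i j; rewrite !mxE pc.
pose g := pm id; pose g' := pm (fun x => invmx x).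
have gg' : g *m g' = 1%:M.
  rewrite -pmM -(map_mx1 iota) -pmc; apply: pmE.
  by apply: filterS U_Ud => x [ux _]; rewrite /= mulmxV.
have ug : upper_mx g.
  move=> i j ij; rewrite mxE -p0; apply/pP; apply: filterS U_Ud => x [_ hx] /=; exact: hx.
have ug' : upper_mx g'.
  move=> i j ij; rewrite mxE -p0; apply/pP; apply: filterS U_Ud => x [ux hx] /=.
  exact: upper_mx_inv.
have grho a : g *m map_mx iota (mu a) *m g' = pm (fun x => conj_rep x mu a).
  by rewrite -pmc -!pmM.
pose G0 x c := exists f, [/\ @polyfun k L d f, x = p (fun y => f (conj_rep y mu)) & c = f nu].
have hG0 : phom G0.
  split.
  - by exists (fun=> 1); split=> //; [exact: pf_const|rewrite pc rmorph1].
  - move=> _ _ _ _ [f [pf -> ->]] [f' [pf' -> ->]].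
    exists (fun rho => f rho + (-1) * f' rho); split.
    + by apply: pf_add pf _; apply: pf_mul pf'; exact: pf_const.
    + by rewrite -pN -pD; congr p; apply/funext => y; rewrite mulN1r.
    + by rewrite mulN1r.
  - move=> _ _ _ _ [f [pf -> ->]] [f' [pf' -> ->]].
    by exists (fun rho => f rho * f' rho); split; [exact: pf_mul|rewrite pM|].
  - move=> _ [f [pf + ->]]; rewrite -p0 => /esym/pP f0; apply/eqP; apply: contrapT => /negP fnu.
    (* If [f] did not vanish at [nu], the ultrafilter would contain both its nonvanishing set and
       its vanishing set on the orbit. *)
    have Uf : U [set y | f (conj_rep y mu) != 0]%classic.
      by apply: FU; exists f; split.
    apply: (@filter_not_empty _ U); apply: filterS (filterI f0 Uf) => y [/= -> /eqP].
    exact.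
have [|G [hG G0G Gtot]] := @place_extension k K iota G0 hG0.
  by move=> c; exists (fun=> c); split=> //; exact: pf_const.
have pG : is_place iota G.
  by split=> // c; apply: G0G; exists (fun=> c); split=> //; exact: pf_const.
have gnu a i j : G ((g *m map_mx iota (mu a) *m g') i j) (nu a i j).
  rewrite grho; apply: G0G; exists (fun rho => rho a i j); split=> //; first exact: pf_coord.
  by rewrite mxE.
have [[t [t0 gt]]|nt] := pselect (exists t, t != 0 /\ G t 0); last first.
  exact: (selection_trivial pG gg' ug ug' gnu nt).
pose S0 : divringClosed K := acl (adjoin (range_field iota) t).
have tS0 : t \in S0 by apply: acl_sub; exact: adjoin_gen.
have kS0 c : iota c \in S0.
  by apply: acl_sub; apply: adjoin_sub; exact: range_field_mem.
pose pairs := enum [set: 'I_d * 'I_d].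
have inpairs i j : (i, j) \in pairs by rewrite mem_enum inE.
pose ent (A : 'M[K]_d) := [seq A q.1 q.2 | q <- pairs].
have entP (A : 'M[K]_d) i j : A i j \in ent A by apply/mapP; exists (i, j).
(* A basis of [L] reduces the entries of all the conjugates to finitely many. *)
pose e_ (i : 'I_(\dim {:L})) := (vbasis {:L})`_i.
pose rhoK a := g *m map_mx iota (mu a) *m g'.
(* The entries of [g] and its inverse generate the tower; those of the conjugates are specialized
   along with them because their residues have to be kept. *)
pose zs := ent g ++ ent g'; pose ys := zs ++ flatten [seq ent (rhoK (e_ i)) | i <- enum 'I_(\dim {:L})].
have zsT i j : g i j \in tower S0 zs /\ g' i j \in tower S0 zs.
  by split; apply: tower_mem; rewrite mem_cat entP ?orbT.
have [||||||H [hH HS Hy]] := @tower_specialization k K iota G pG S0 t zs ys.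
- exact: kS0.
- exact: acl_closed.
- exact: tS0.
- exact: t0.
- exact: gt.
- move=> y; rewrite mem_cat => /orP[|/flatten_mapP[i _ /mapP[q _ ->]]]; first exact: tower_mem.
  rewrite mxE; apply: rpred_sum => l _; apply: rpredM; last by have [] := zsT l q.2.
  rewrite mxE; apply: rpred_sum => m _; apply: rpredM; first by have [] := zsT q.1 m.
  by rewrite mxE; apply: tower_sub.
have spec (A : 'M[K]_d) : {subset ent A <= ys} -> exists B : 'M[K]_d,
    [/\ forall i j, H (A i j) (B i j), forall i j, B i j \in S0 &
      forall i j c, G (A i j) c -> G (B i j) c].
  move=> Ays; have /choice[f hf] : forall q : 'I_d * 'I_d, exists y',
      [/\ H (A q.1 q.2) y', y' \in S0 & forall c, G (A q.1 q.2) c -> G y' c].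
    by move=> q; apply: Hy; apply: Ays.
  exists (\matrix_(i, j) f (i, j)); split=> i j; rewrite mxE; have [] := hf (i, j) => //.
have [|gs [Hgs Sgs _]] := spec g.
  by move=> x xg; rewrite mem_cat mem_cat xg.
have [|gs' [Hgs' Sgs' _]] := spec g'.
  by move=> x xg; rewrite mem_cat mem_cat xg orbT.
have /choice[R hR] : forall i, exists B : 'M[K]_d,
    [/\ forall l j, H (rhoK (e_ i) l j) (B l j), forall l j, B l j \in S0 &
      forall l j c, G (rhoK (e_ i) l j) c -> G (B l j) c].
  move=> i; apply: spec => x xi; rewrite mem_cat; apply/orP; right.
  by apply/flatten_mapP; exists i; rewrite ?mem_enum.
have Hmap (A : 'M[k]_d) i j : H (map_mx iota A i j) (map_mx iota A i j) by rewrite mxE; apply: HS.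
have ggs : gs *m gs' = 1%:M.
  apply/matrixP => i j; apply: (phom_inj hH (phom_mulmx hH Hgs Hgs' i j)).
  by rewrite gg' !mxE; apply: HS; rewrite rpred_nat.
have ugs : upper_mx gs by move=> i j ij; apply: (phom_fun hH); rewrite -(ug i j).
have ugs' : upper_mx gs' by move=> i j ij; apply: (phom_fun hH); rewrite -(ug' i j).
have RE i : R i = gs *m map_mx iota (mu (e_ i)) *m gs'.
  apply/matrixP => l j; have [HR _ _] := hR i; apply: (phom_inj hH (HR l j)).
  by apply: (phom_mulmx hH) => //; exact: (phom_mulmx hH).
have gnus a i j : G ((gs *m map_mx iota (mu a) *m gs') i j) (nu a i j).
  have [repmu _] := mu_tri; have [repnu _] := nu_tri.
  rewrite (coord_vbasis (memvf a)) !rep_sum // (raddf_sum (map_mx iota)) /=.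
  rewrite mulmx_sumr mulmx_suml !summxE; apply: (phom_sum (place_phom pG)) => l _.
  rewrite map_mxZ -scalemxAr -scalemxAl -RE !mxE; apply: (phomM (place_phom pG)).
    exact: (place_const pG).
  by have [_ _ gR] := hR l; apply: gR; exact: gnu.
have [|F [s [FX Fk [Fs s0 gs0] sP sA]]] := @finite_uniformizer k K iota G pG t t0 gt (ent gs ++ ent gs').
  by move=> x; rewrite mem_cat => /orP[]/mapP[q _ ->]; [exact: Sgs|exact: Sgs'].
apply: (selection_uniformizer pG ggs ugs ugs' gnus Fk Fs s0 gs0 sP sA).
- by move=> i j; apply: FX; rewrite mem_cat entP.
- by move=> i j; apply: FX; rewrite mem_cat entP orbT.
Qed.

End Selection.

(** * From a formal curve to exact sequences *)

Section ColumnMaps.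
Variable k : fieldType.

Definition col_lin n m (f : 'cV[k]_n -> 'cV[k]_m) : 'M[k]_(m, n) :=
  \matrix_(i, j) f (delta_mx j 0) i 0.

Lemma col_linE n m (f : 'cV[k]_n -> 'cV[k]_m) : linear f -> forall v, col_lin f *m v = f v.
Proof.
move=> lf v; have f0 : f 0 = 0 by have := lf (-1) 0 0; rewrite scaler0 addr0 scaleN1r addNr.
rewrite {2}(_ : v = \sum_j v j 0 *: delta_mx j 0); last first.
  by rewrite [LHS]matrix_sum_delta; apply: eq_bigr => j _; rewrite big_ord1.
have -> (r : seq 'I_n) : f (\sum_(j <- r) v j 0 *: delta_mx j 0) = \sum_(j <- r) v j 0 *: f (delta_mx j 0).
  by elim: r => [|j r IH]; rewrite ?big_nil // !big_cons lf IH.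
apply/colP => i; rewrite mxE summxE; apply: eq_bigr => j _.
by rewrite !mxE mulrC.
Qed.

Lemma mulmx_ext n m (A B : 'M[k]_(m, n)) : (forall v : 'cV[k]_n, A *m v = B *m v) -> A = B.
Proof.
move=> h; apply/matrixP => i j; have /colP/(_ i) := h (delta_mx j 0).
by rewrite -!colE !mxE.
Qed.

Section Coordinates.
Variables (V : vectType k) (U : {vspace V}).
Let n := \dim U.

Definition enc (v : V) : 'cV[k]_n := \col_i coord (vbasis U) i v.
Definition dec (c : 'cV[k]_n) : V := \sum_i c i 0 *: (vbasis U)`_i.

Lemma dec_mem c : dec c \in U.
Proof.
apply: rpred_sum => i _; apply: rpredZ; apply: vbasis_mem.
by apply: mem_nth; rewrite size_tuple.
Qed.

Lemma encK c : enc (dec c) = c.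
Proof.
apply/colP => i; rewrite mxE /dec.
by rewrite coord_sum_free // (basis_free (vbasisP U)).
Qed.

Lemma decK v : v \in U -> dec (enc v) = v.
Proof.
move=> vU; rewrite {2}(coord_vbasis vU) /dec; apply: eq_bigr => i _; by rewrite mxE.
Qed.

Lemma enc_lin a u v : enc (a *: u + v) = a *: enc u + enc v.
Proof. by apply/colP => i; rewrite !mxE linearP. Qed.

Lemma dec_lin a u v : dec (a *: u + v) = a *: dec u + dec v.
Proof.
rewrite /dec scaler_sumr -big_split; apply: eq_bigr => i _ /=.
by rewrite !mxE scalerDl scalerA.
Qed.

End Coordinates.
End ColumnMaps.

(** * Polynomial columns modulo powers of t *)

Section PolyColumns.
Variables (k : fieldType) (h : nat).

Definition cf l n (v : 'cV[{poly k}]_l) : 'cV[k]_l := \col_i (v i 0)`_n.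
Definition tr l (v : 'cV[{poly k}]_l) : 'M[k]_(l, h) := \matrix_(i, j) (v i 0)`_j.
Definition to_poly l (q : 'M[k]_(l, h)) : 'cV[{poly k}]_l :=
  \col_i \poly_(j < h) (if insub j is Some j' then q i j' else 0).
Definition pc m n (A : 'M[k]_(m, n)) : 'M[{poly k}]_(m, n) := map_mx polyC A.
Definition eqv l N (u v : 'cV[{poly k}]_l) := forall n, (n < N)%N -> cf n u = cf n v.

Lemma cf_lin l n a (u v : 'cV[{poly k}]_l) : cf n (a%:P *: u + v) = a *: cf n u + cf n v.
Proof. by apply/colP => i; rewrite !mxE coefD coefCM. Qed.

Lemma cfD l n (u v : 'cV[{poly k}]_l) : cf n (u + v) = cf n u + cf n v.
Proof. by apply/colP => i; rewrite !mxE coefD. Qed.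

Lemma cf_pc l m n (A : 'M[k]_(m, l)) v : cf n (pc A *m v) = A *m cf n v.
Proof.
apply/colP => i; rewrite !mxE coef_sum; apply: eq_bigr => j _.
by rewrite !mxE coefCM.
Qed.

Lemma cf_const l n (m : 'cV[k]_l) : cf n (pc m) = if n == 0%N then m else 0.
Proof. by apply/colP => i; rewrite !mxE coefC; case: eqP => _; rewrite ?mxE. Qed.

Lemma cfXn l n N (v : 'cV[{poly k}]_l) : cf n ('X^N *: v) = if (n < N)%N then 0 else cf (n - N) v.
Proof. by apply/colP => i; rewrite !mxE coefXnM; case: ltnP => _; rewrite ?mxE. Qed.

Lemma cfX l n (v : 'cV[{poly k}]_l) : cf n ('X *: v) = if n is n'.+1 then cf n' v else 0.
Proof. by apply/colP => i; rewrite !mxE coefXM; case: n => [|n]; rewrite !mxE. Qed.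

Lemma cf_to_poly l n (q : 'M[k]_(l, h)) i (nh : (n < h)%N) :
  cf n (to_poly q) i 0 = q i (Ordinal nh).
Proof. by rewrite !mxE coef_poly nh insubT. Qed.

Lemma cf_to_poly_ge l n (q : 'M[k]_(l, h)) : (h <= n)%N -> cf n (to_poly q) = 0.
Proof. by move=> hn; apply/colP => i; rewrite !mxE coef_poly ltnNge hn. Qed.

Lemma to_poly_tr l (v : 'cV[{poly k}]_l) : eqv h (to_poly (tr v)) v.
Proof. by move=> n nh; apply/colP => i; rewrite (cf_to_poly _ _ nh) !mxE. Qed.

Lemma tr_to_poly l (q : 'M[k]_(l, h)) : tr (to_poly q) = q.
Proof.
apply/matrixP => i j; rewrite mxE; have := cf_to_poly q i (ltn_ord j).
by rewrite mxE => ->; congr (q _ _); exact: val_inj.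
Qed.

Lemma tr_eqv l (u v : 'cV[{poly k}]_l) : eqv h u v -> tr u = tr v.
Proof.
by move=> uv; apply/matrixP => i j; have /colP/(_ i) := uv j (ltn_ord j); rewrite !mxE.
Qed.

Lemma tr_lin l a (u v : 'cV[{poly k}]_l) : tr (a%:P *: u + v) = a *: tr u + tr v.
Proof. by apply/matrixP => i j; rewrite !mxE coefD coefCM. Qed.

Lemma cf_inj l (u v : 'cV[{poly k}]_l) : (forall n, cf n u = cf n v) -> u = v.
Proof. by move=> uv; apply/colP => i; apply/polyP => n; have /colP/(_ i) := uv n; rewrite !mxE. Qed.

Lemma to_poly_lin l a (u v : 'M[k]_(l, h)) :
  to_poly (a *: u + v) = a%:P *: to_poly u + to_poly v.
Proof.
apply: cf_inj => n; rewrite cf_lin; have [nh|hn] := ltnP n h.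
  apply/colP => i; transitivity (a * cf n (to_poly u) i 0 + cf n (to_poly v) i 0).
    by rewrite !(cf_to_poly _ _ nh) !mxE.
  by rewrite !mxE.
by rewrite !cf_to_poly_ge // scaler0 addr0.
Qed.

Lemma to_poly_mul l m (A : 'M[k]_(m, l)) (q : 'M[k]_(l, h)) :
  to_poly (A *m q) = pc A *m to_poly q.
Proof.
apply: cf_inj => n; rewrite cf_pc; have [nh|hn] := ltnP n h.
  apply/colP => i; rewrite (cf_to_poly _ _ nh) !mxE; apply: eq_bigr => j _.
  by rewrite (cf_to_poly _ _ nh).
by rewrite !cf_to_poly_ge // mulmx0.
Qed.

Lemma tr_mul l m (A : 'M[k]_(m, l)) v : tr (pc A *m v) = A *m tr v.
Proof.
apply/matrixP => i j; have /colP/(_ i) := cf_pc j A v; rewrite !mxE => ->.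
by apply: eq_bigr => l' _; rewrite !mxE.
Qed.

Lemma eqv_trans l N (u v w : 'cV[{poly k}]_l) : eqv N u v -> eqv N v w -> eqv N u w.
Proof. by move=> uv vw n nN; rewrite uv // vw. Qed.

Lemma eqv_le l N M (u v : 'cV[{poly k}]_l) : (N <= M)%N -> eqv M u v -> eqv N u v.
Proof. by move=> NM uv n nN; apply: uv; exact: leq_trans NM. Qed.

Lemma eqv_mul l m N (A B : 'M[{poly k}]_(m, l)) u v : eqm N A B -> eqv N u v ->
  eqv N (A *m u) (B *m v).
Proof.
move=> AB uv n nN; apply/colP => i; rewrite !mxE !coef_sum; apply: eq_bigr => j _.
rewrite !coefM; apply: eq_bigr => x _; congr (_ * _).
  by apply: AB; apply: leq_ltn_trans nN; rewrite -ltnS.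
have /colP/(_ j) := uv (n - x)%N (leq_ltn_trans (leq_subr _ _) nN).
by rewrite !mxE.
Qed.

Lemma eqvX l N (u v : 'cV[{poly k}]_l) : eqv N u v -> eqv N.+1 ('X *: u) ('X *: v).
Proof. by move=> uv [|n] nN; rewrite !cfX // uv. Qed.

Definition drop_col l (v : 'cV[{poly k}]_l) : 'cV[{poly k}]_l := \col_i drop_poly 1 (v i 0).

Lemma drop_colK l (v : 'cV[{poly k}]_l) : cf 0 v = 0 -> v = 'X *: drop_col v.
Proof.
move=> v0; apply: cf_inj => -[|n]; rewrite cfX //.
by apply/colP => i; rewrite !mxE coef_drop_poly addn1.
Qed.

End PolyColumns.

Lemma scaler_swap (R : comPzRingType) (V : lmodType R) (a b : R) (v : V) :
  a *: (b *: v) = b *: (a *: v).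
Proof. by rewrite !scalerA mulrC. Qed.

Definition lattice_map (k : fieldType) (h l : nat) (P : 'M[{poly k}]_l) (q : 'M[k]_(l, h)) :
  'M[k]_(l, h) := tr h (P *m to_poly q).

Lemma lattice_map_lin (k : fieldType) (h l : nat) (P : 'M[{poly k}]_l) : linear (@lattice_map k h l P).
Proof.
by move=> a u v; rewrite /lattice_map to_poly_lin mulmxDr -scalemxAr tr_lin.
Qed.
HB.instance Definition _ (k : fieldType) h l (P : 'M[{poly k}]_l) :=
  GRing.isLinear.Build k 'M[k]_(l, h) 'M[k]_(l, h) _ (@lattice_map k h l P) (@lattice_map_lin k h l P).

(* [P k[[t]]^l / t^h k[[t]]^l], whose elements are the matrices of the coefficients of [1], ..., [t^(h-1)]. *)
Definition lattice (k : fieldType) (h l : nat) (P : 'M[{poly k}]_l) : {vspace 'M[k]_(l, h)} :=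
  limg (linfun (@lattice_map k h l P)).
Arguments lattice {k} h {l} P.

Lemma latticeP (k : fieldType) (h l : nat) (P : 'M[{poly k}]_l) q :
  q \in lattice h P <-> exists v, q = tr h (P *m v).
Proof.
split=> [/memv_imgP[u _ ->]|[v ->]].
  by exists (to_poly u); rewrite lfunE.
apply/memv_imgP; exists (tr h v); rewrite ?memvf // lfunE /= /lattice_map.
by apply: tr_eqv; apply: eqv_mul => // n nh; rewrite to_poly_tr.
Qed.

Definition shift (k : fieldType) (h l : nat) (q : 'M[k]_(l, h)) : 'M[k]_(l, h) :=
  tr h ('X *: to_poly q).

(* [q + t^h m], which identifies [k[[t]]^l / t^(h+1)] with the sum of [k[[t]]^l / t^h] and [k^l]. *)
Definition lift_col (k : fieldType) (h l : nat) (q : 'M[k]_(l, h)) (m : 'cV[k]_l) :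
  'cV[{poly k}]_l := to_poly q + 'X^h *: pc m.

Definition lat_rep (k : fieldType) (L : falgType k) h l (P : 'M[{poly k}]_l) (mu : L -> 'M[k]_l)
  (a : L) : 'M[k]_(\dim (lattice h P)) :=
  col_lin (fun c => enc (lattice h P) (mu a *m dec c)).

(* Multiplication by [t] into [k[[t]]^l / t^(h+1)]. *)
Definition lat_A (k : fieldType) h l (P : 'M[{poly k}]_l) :
    'M[k]_(\dim (lattice h P) + l, \dim (lattice h P)) :=
  col_lin (fun c : 'cV[k]_(\dim (lattice h P)) =>
    col_mx (enc (lattice h P) (shift (dec c))) (cf h ('X *: to_poly (dec c)))).

(* [x = P v] is sent to [v mod t], which is the coefficient of [t^h] in [Q x = t^h v]. *)
Definition lat_B (k : fieldType) h l (P Q : 'M[{poly k}]_l) :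
    'M[k]_(l, \dim (lattice h P) + l) :=
  col_lin (fun w : 'cV[k]_(\dim (lattice h P) + l) =>
    cf h (Q *m lift_col (dec (usubmx w)) (dsubmx w))).

Definition lat_h (k : fieldType) h l m (P : 'M[{poly k}]_l) (P' : 'M[{poly k}]_m) (I : 'M[k]_(m, l)) :
    'M[k]_(\dim (lattice h P'), \dim (lattice h P)) :=
  col_lin (fun c => enc (lattice h P') (I *m dec c)).

Section Linearity.
Variables (k : fieldType) (h l : nat) (P Q : 'M[{poly k}]_l).

Lemma shift_lin a (u v : 'M[k]_(l, h)) : shift (a *: u + v) = a *: shift u + shift v.
Proof. by rewrite /shift to_poly_lin scalerDr scaler_swap tr_lin. Qed.

Lemma lift_lin a (q q' : 'M[k]_(l, h)) m m' :
  lift_col (a *: q + q') (a *: m + m') = a%:P *: lift_col q m + lift_col q' m'.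
Proof.
rewrite /lift_col to_poly_lin /pc map_mxD map_mxZ /= !scalerDr scaler_swap.
by rewrite addrACA.
Qed.

Lemma cf_mul_lin n m (M : 'M[{poly k}]_(m, l)) a u v :
  cf n (M *m (a%:P *: u + v)) = a *: cf n (M *m u) + cf n (M *m v).
Proof. by rewrite mulmxDr -scalemxAr cf_lin. Qed.

Lemma lat_AE c : lat_A h P *m c =
  col_mx (enc (lattice h P) (shift (dec c))) (cf h ('X *: to_poly (dec c))).
Proof.
apply: col_linE => a u v; rewrite dec_lin shift_lin enc_lin to_poly_lin.
by rewrite scalerDr scaler_swap cf_lin scale_col_mx add_col_mx.
Qed.

Lemma lat_BE w : lat_B h P Q *m w = cf h (Q *m lift_col (dec (usubmx w)) (dsubmx w)).
Proof.
apply: col_linE => a u v; rewrite [usubmx (_ + _)]linearP [dsubmx (_ + _)]linearP /= dec_lin.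
by rewrite lift_lin cf_mul_lin.
Qed.

Lemma lat_hE m (P' : 'M[{poly k}]_m) (I : 'M[k]_(m, l)) c :
  lat_h h P P' I *m c = enc (lattice h P') (I *m dec c).
Proof. by apply: col_linE => a u v; rewrite dec_lin mulmxDr -scalemxAr enc_lin. Qed.

Lemma lat_repE (L : falgType k) (mu : L -> 'M[k]_l) a c :
  lat_rep h P mu a *m c = enc (lattice h P) (mu a *m dec c).
Proof. by apply: col_linE => b u v; rewrite dec_lin mulmxDr -scalemxAr enc_lin. Qed.

Lemma shift_lattice q : q \in lattice h P -> shift q \in lattice h P.
Proof.
move=> /latticeP[v ->]; apply/latticeP; exists ('X *: v); rewrite /shift -scalemxAr.
by apply: tr_eqv; apply: eqv_le (eqvX _); [exact: leqnSn|exact: to_poly_tr].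
Qed.

Lemma shift_mul m (A : 'M[k]_(m, l)) (q : 'M[k]_(l, h)) : shift (A *m q) = A *m shift q.
Proof. by rewrite /shift to_poly_mul -tr_mul scalemxAr. Qed.

Lemma lift_mul m (A : 'M[k]_(m, l)) (q : 'M[k]_(l, h)) x :
  lift_col (A *m q) (A *m x) = pc A *m lift_col q x.
Proof. by rewrite /lift_col to_poly_mul /pc map_mxM mulmxDr scalemxAr. Qed.

(** In the coordinates of [lift_col], the map [lat_A] is multiplication by [t]. *)
Lemma lift_shift (q : 'M[k]_(l, h)) :
  lift_col (shift q) (cf h ('X *: to_poly q)) = 'X *: to_poly q.
Proof.
apply: cf_inj => n; rewrite cfD cfXn cf_const.
have [nh|hn] := ltnP n h; first by rewrite addr0 to_poly_tr.
rewrite cf_to_poly_ge // add0r subn_eq0; have [nh|nh] := leqP n h.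
  by have -> : n = h by apply/eqP; rewrite eqn_leq nh.
by rewrite cfX; case: n hn nh => // n _; rewrite ltnS => nh; rewrite cf_to_poly_ge.
Qed.

End Linearity.

Section Level.
Variables (k : fieldType) (L : falgType k) (h l : nat) (P Q : 'M[{poly k}]_l).
Variables (mu nu : L -> 'M[k]_l).
Hypothesis PQ : eqm h.+1 (P *m Q) ('X^h)%:M.
Hypothesis QP : eqm h.+1 (Q *m P) ('X^h)%:M.
Hypothesis muP : forall a, exists R, eqm h.+1 (pc (mu a) *m P) (P *m R) /\
  forall i j, (R i j)`_0 = nu a i j.
Hypothesis repmu : is_rep mu.
Notation X := (lattice h P).

Lemma mul_lattice a (q : 'M[k]_(l, h)) : q \in X -> mu a *m q \in X.
Proof.
move=> /latticeP[v ->]; have [R [hR _]] := muP a; apply/latticeP; exists (R *m v).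
rewrite -tr_mul !mulmxA; apply: tr_eqv; apply: eqv_le (leqnSn h) _; exact: eqv_mul.
Qed.

(** As [P Q] is [t^h], the lattice contains all multiples of [t^h], and the coefficient of [t^h] can
    be prescribed: [Q m'] corrects it. *)
Lemma lift_lattice (q : 'M[k]_(l, h)) m : q \in X -> exists v, eqv h.+1 (lift_col q m) (P *m v).
Proof.
move=> /latticeP[v ->]; pose m' := m - cf h (P *m v).
exists (v + Q *m pc m') => n nh; rewrite mulmxDr mulmxA !cfD.
rewrite (eqv_mul PQ (u := pc m') (v := pc m')) // mul_scalar_mx !cfXn !cf_const.
move: nh; rewrite ltnS leq_eqVlt => /predU1P[->|nh].
  rewrite ltnn subnn /= cf_to_poly_ge // add0r /m'.
  by rewrite addrC subrK.
by rewrite nh !addr0 to_poly_tr.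
Qed.

Lemma lat_B_lift (q : 'M[k]_(l, h)) v m : eqv h.+1 (lift_col q m) (P *m v) ->
  cf h (Q *m lift_col q m) = cf 0 v.
Proof.
move=> qv; have -> : cf h (Q *m lift_col q m) = cf h (Q *m (P *m v)).
  by apply: (@eqv_mul _ _ _ h.+1) => //.
rewrite mulmxA (eqv_mul QP (u := v) (v := v)) // mul_scalar_mx cfXn ltnn subnn //.
Qed.

Lemma lat_is_rep : is_rep (lat_rep h P mu).
Proof.
have [lin mul one] := repmu; split.
- move=> c a b; apply: mulmx_ext => v; rewrite mulmxDl -scalemxAl !lat_repE lin.
  by rewrite mulmxDl -scalemxAl enc_lin.
- move=> a b; apply: mulmx_ext => v; rewrite -mulmxA !lat_repE mul decK ?mulmxA //.
  by apply: mul_lattice; exact: dec_mem.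
- by apply: mulmx_ext => v; rewrite lat_repE one !mul1mx encK.
Qed.

(** Pairs [(q, m)] amount to vectors [P v] modulo [t^(h+1)]. Multiplication by [t] from order [h] to
    order [h + 1] is injective, and its image consists of the pairs with [v(0) = 0], which is the
    kernel of [lat_B]. *)
Lemma lat_short_exact :
  short_exact (lat_rep h P mu) (dsum_rep (lat_rep h P mu) mu) nu (lat_A h P) (lat_B h P Q).
Proof.
split.
- move=> a; apply: mulmx_ext => c; rewrite -!mulmxA lat_AE lat_repE decK; last first.
    by apply: mul_lattice; exact: dec_mem.
  rewrite lat_AE /dsum_rep mul_block_col !mul0mx addr0 add0r lat_repE decK; last first.
    by apply: shift_lattice; exact: dec_mem.
  by rewrite shift_mul to_poly_mul scalemxAr cf_pc.
- move=> a; apply: mulmx_ext => w; rewrite -!mulmxA !lat_BE -[w]vsubmxK.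
  rewrite /dsum_rep mul_block_col !mul0mx addr0 add0r !col_mxKu !col_mxKd.
  rewrite lat_repE decK; last by apply: mul_lattice; exact: dec_mem.
  (* The action of [a] turns [P v] into [P R v], and [R(0)] is [nu a]. *)
  have [v hv] := lift_lattice (dsubmx w) (dec_mem (usubmx w)); have [R [hR R0]] := muP a.
  rewrite (lat_B_lift hv) (@lat_B_lift _ (R *m v)).
    apply/colP => i; rewrite !mxE coef_sum; apply: eq_bigr => j _.
    by rewrite coef0M R0 !mxE.
  rewrite lift_mul mulmxA; apply: eqv_trans (_ : eqv h.+1 (pc (mu a) *m (P *m v)) _).
    exact: eqv_mul.
  by rewrite mulmxA; exact: eqv_mul.
- move=> c; rewrite lat_AE => /eqP; rewrite -[0]vsubmxK !linear0 => /eqP/eq_col_mx[E1 E2].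
  have Xq := dec_mem c; rewrite -[c]encK; suff -> : dec c = 0.
    by apply/colP => i; rewrite !mxE linear0.
  have : 'X *: to_poly (dec c) = 0.
    rewrite -lift_shift E2 -(decK (shift_lattice Xq)) E1.
    have -> : dec (0 : 'cV[k]_(\dim X)) = 0.
      by rewrite /dec big1 // => i _; rewrite mxE scale0r.
    apply: cf_inj => n; rewrite cfD /pc map_mx0 scaler0.
    have [nh|hn] := ltnP n h; last first.
      by rewrite cf_to_poly_ge // add0r.
    by apply/colP => i; rewrite mxE (cf_to_poly _ _ nh) !mxE !coef0 addr0.
  move=> Xq0; rewrite -(tr_to_poly (dec c)).
  apply/matrixP => i j; rewrite !mxE.
  have /colP/(_ i) := congr1 (cf j.+1) Xq0; by rewrite cfX !mxE coef0.
- move=> w; pose x := P *m pc w.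
  exists (col_mx (enc X (tr h x)) (cf h x)).
  rewrite lat_BE col_mxKu col_mxKd decK; last by apply/latticeP; exists (pc w).
  rewrite (@lat_B_lift _ (pc w)) ?cf_const // => n.
  rewrite ltnS leq_eqVlt cfD cfXn cf_const => /predU1P[->|nh].
    by rewrite ltnn subnn /= cf_to_poly_ge // add0r.
  by rewrite nh addr0 to_poly_tr.
- move=> w; rewrite lat_BE; split.
    move=> Bw; have [v hv] := lift_lattice (dsubmx w) (dec_mem (usubmx w)).
    (* Here [v(0) = 0], so [v] can be divided by [t]. *)
    rewrite (lat_B_lift hv) in Bw; pose v' := drop_col v.
    have Ev : v = 'X *: v' by exact: drop_colK.
    pose q := tr h (P *m v'); have Xq : q \in X by apply/latticeP; exists v'.
    exists (enc X q); rewrite lat_AE decK //.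
    have hq : eqv h.+1 (lift_col (dec (usubmx w)) (dsubmx w)) ('X *: to_poly q).
      apply: eqv_trans hv _; rewrite Ev -scalemxAr; apply: eqvX => n nh.
      by rewrite to_poly_tr.
    rewrite -[w in LHS]vsubmxK; congr col_mx.
      rewrite -[LHS]encK; congr enc; rewrite -[LHS]tr_to_poly; apply: tr_eqv => n nh.
      have := hq n (ltnW nh); rewrite cfD cfXn nh addr0 //.
    have := hq h (ltnSn h); rewrite cfD cfXn ltnn subnn cf_const cf_to_poly_ge //.
    by rewrite add0r.
  move=> [c ->]; rewrite lat_AE col_mxKu col_mxKd decK; last first.
    by apply: shift_lattice; exact: dec_mem.
  have /latticeP[v Ev] := dec_mem c.
  rewrite (@lat_B_lift _ ('X *: v)); first by rewrite cfX.
  rewrite lift_shift -scalemxAr; apply: eqvX => n nh.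
  by rewrite Ev to_poly_tr.
Qed.

End Level.

(** * Corner blocks of triangular matrices *)

Section Blocks.
Variables (R : pzSemiRingType) (d : nat).
Implicit Types A B : 'M[R]_d.

(** The analogue of [mx_get] for matrices over a semiring, polynomials in particular; over [k] the
    two are convertible. *)
Definition entry A (p q : nat) : R :=
  if insub p : option 'I_d is Some p' then
    if insub q : option 'I_d is Some q' then A p' q' else 0
  else 0.

Definition blk A l : 'M[R]_l := \matrix_(p < l, q < l) entry A p q.

Lemma entryE A (i j : 'I_d) : A i j = entry A i j.
Proof. by rewrite /entry !valK. Qed.

Lemma entry_upper A (p q : nat) : upper_mx A -> (q < p)%N -> entry A p q = 0.
Proof.
move=> uA qp; rewrite /entry; case: insubP => // p' _ Ep; case: insubP => // q' _ Eq.
by apply: uA; rewrite Ep Eq.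
Qed.

(** The first [l] columns of [B] vanish from row [l] on, so indices beyond the block contribute
    nothing. *)
Lemma blkM A B l : (l <= d)%N -> upper_mx B -> blk (A *m B) l = blk A l *m blk B l.
Proof.
move=> ld uB; apply/matrixP => i j; rewrite !mxE.
have -> : entry (A *m B) i j = \sum_(x < d) entry A i x * entry B x j.
  rewrite -[i : nat]/(nat_of_ord (widen_ord ld i)) -[j : nat]/(nat_of_ord (widen_ord ld j)).
  by rewrite -entryE mxE; apply: eq_bigr => x _; rewrite -!entryE.
under [RHS]eq_bigr do rewrite !mxE.
rewrite (big_ord_widen d (fun x => entry A i x * entry B x j) ld) [LHS](bigID (fun x : 'I_d => (x < l)%N)) /=.
rewrite [X in _ + X]big1 ?addr0 // => x; rewrite -leqNgt => lx.
by rewrite [entry B _ _]entry_upper ?mulr0 // (leq_trans (ltn_ord j)).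
Qed.

Lemma blk_scalar c l : (l <= d)%N -> blk c%:M l = c%:M.
Proof.
move=> ld; apply/matrixP => i j; rewrite mxE.
rewrite -[i : nat]/(nat_of_ord (widen_ord ld i)) -[j : nat]/(nat_of_ord (widen_ord ld j)).
by rewrite -entryE !mxE -val_eqE.
Qed.

End Blocks.

Lemma entry_map (R R' : pzSemiRingType) d (f : R -> R') (A : 'M[R]_d) p q :
  f 0 = 0 -> entry (map_mx f A) p q = f (entry A p q).
Proof. by move=> f0; rewrite /entry; case: insub => // p'; case: insub => // q'; rewrite mxE. Qed.

Lemma blk_eqm (k : fieldType) d N (A B : 'M[{poly k}]_d) l : eqm N A B -> eqm N (blk A l) (blk B l).
Proof.
move=> AB i j n nN; rewrite !mxE /entry; case: insub => // p'; case: insub => // q'.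
exact: AB.
Qed.

Lemma sub_repE (k : fieldType) (L : falgType k) d (mu : L -> 'M[k]_d) l a :
  sub_rep mu l a = blk (mu a) l.
Proof. by []. Qed.

Section Inclusion.
Variables (k : fieldType) (d : nat).

Lemma blk_incl (A : 'M[k]_d) l : upper_mx A -> blk A l.+1 *m incl_mx k l = incl_mx k l *m blk A l.
Proof.
move=> uA; apply/matrixP => i j; rewrite !mxE.
under eq_bigr do rewrite !mxE; under [RHS]eq_bigr do rewrite !mxE.
rewrite (bigD1 (widen_ord (leqnSn l) j)) //= eqxx mulr1 big1 ?addr0; last first.
  by move=> x xj; rewrite -(inj_eq val_inj) /= in xj; rewrite (negbTE xj) mulr0.
have [il|li] := ltnP i l.
  rewrite (bigD1 (Ordinal il)) //= eqxx mul1r big1 ?addr0 // => x xi.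
  by rewrite eq_sym -[x == i :> nat]/(x == Ordinal il) (negbTE xi) mul0r.
rewrite entry_upper ?(leq_trans (ltn_ord j)) // big1 // => x _.
by rewrite gtn_eqF ?mul0r // (leq_trans (ltn_ord x)).
Qed.

Lemma blk_poly_incl (A : 'M[{poly k}]_d) l : upper_mx A ->
  blk A l.+1 *m pc (incl_mx k l) = pc (incl_mx k l) *m blk A l.
Proof.
move=> uA; apply/matrixP => i j; rewrite !mxE.
under eq_bigr do rewrite !mxE polyC_natr; under [RHS]eq_bigr do rewrite !mxE polyC_natr.
rewrite (bigD1 (widen_ord (leqnSn l) j)) //= eqxx mulr1 big1 ?addr0; last first.
  by move=> x xj; rewrite -(inj_eq val_inj) /= in xj; rewrite (negbTE xj) mulr0.
have [il|li] := ltnP i l.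
  rewrite (bigD1 (Ordinal il)) //= eqxx mul1r big1 ?addr0 // => x xi.
  by rewrite eq_sym -[x == i :> nat]/(x == Ordinal il) (negbTE xi) mul0r.
rewrite entry_upper ?(leq_trans (ltn_ord j)) // big1 // => x _.
by rewrite gtn_eqF ?mul0r // (leq_trans (ltn_ord x)).
Qed.

End Inclusion.

Lemma sub_rep_is_rep (k : fieldType) (L : falgType k) d (mu : L -> 'M[k]_d) l :
  triangular_rep mu -> (l <= d)%N -> is_rep (sub_rep mu l).
Proof.
move=> [[lin mul one] tri] ld; split.
- move=> c a b; apply/matrixP => i j.
  rewrite !mxE -[mx_get _ _ _]/(entry _ _ _) lin /entry.
  rewrite -![mx_get _ _ _]/(entry _ _ _) /entry.
  case: insub => [p'|]; last by rewrite mulr0 addr0.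
  by case: insub => [q'|]; rewrite ?mxE ?mulr0 ?addr0.
- by move=> a b; rewrite !sub_repE mul blkM //; exact: tri.
- by rewrite sub_repE one blk_scalar.
Qed.

Section Family.
Variables (k : fieldType) (L : falgType k) (d : nat) (mu nu : L -> 'M[k]_d).
Hypotheses (mu_tri : triangular_rep mu) (nu_tri : triangular_rep nu).

(** The corner blocks of [P] and [Q] satisfy the same congruences at every level and commute with
    the inclusions, which therefore map each lattice into the next. *)
Theorem exact_sequences_of_degeneration : formal_degeneration mu nu ->
  exists (xd : nat -> nat) (X : forall l, L -> 'M[k]_(xd l))
         (h : forall l, 'M[k]_(xd l.+1, xd l))
         (A : forall l, 'M[k]_(xd l + l, xd l))
         (B : forall l, 'M[k]_(l, xd l + l)),
    [/\ (forall l, (1 <= l <= d)%N -> is_rep (X l)),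
        (forall l, (1 <= l < d)%N -> is_hom (X l) (X l.+1) (h l)),
        (forall l, (1 <= l <= d)%N ->
           short_exact (X l) (dsum_rep (X l) (sub_rep mu l)) (sub_rep nu l) (A l) (B l)),
        (forall l, (1 <= l < d)%N ->
           block_mx (h l) 0 0 (incl_mx k l) *m A l = A l.+1 *m h l) &
        (forall l, (1 <= l < d)%N ->
           incl_mx k l *m B l = B l.+1 *m block_mx (h l) 0 0 (incl_mx k l))].
Proof.
move=> [h [P [Q [[uP uQ] PQ QP muP]]]].
have PQl l : (l <= d)%N -> eqm h.+1 (blk P l *m blk Q l) ('X^h)%:M.
  by move=> ld; rewrite -blkM // -(blk_scalar _ ld); exact: blk_eqm.
have QPl l : (l <= d)%N -> eqm h.+1 (blk Q l *m blk P l) ('X^h)%:M.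
  by move=> ld; rewrite -blkM // -(blk_scalar _ ld); exact: blk_eqm.
have muPl l : (l <= d)%N -> forall a, exists R,
    eqm h.+1 (pc (sub_rep mu l a) *m blk P l) (blk P l *m R) /\
    forall i j, (R i j)`_0 = sub_rep nu l a i j.
  move=> ld a; have [R [uR ER R0]] := muP a; exists (blk R l); split.
    have -> : pc (sub_rep mu l a) = blk (map_mx polyC (mu a)) l.
      by apply/matrixP => i j; rewrite !mxE -[mx_get _ _ _]/(entry _ _ _) entry_map.
    by rewrite -!blkM //; exact: blk_eqm.
  move=> i j; rewrite !mxE -[mx_get _ _ _]/(entry _ _ _) /entry.
  by case: insub => [p|]; rewrite ?coef0 //; case: insub => [q|]; rewrite ?coef0.
pose I l := incl_mx k l.
have Ilat l (q : 'M[k]_(l, h)) : q \in lattice h (blk P l) -> I l *m q \in lattice h (blk P l.+1).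
  move=> /latticeP[v ->]; apply/latticeP; exists (pc (I l) *m v).
  by rewrite -tr_mul !mulmxA blk_poly_incl.
exists (fun l => \dim (lattice h (blk P l))), (fun l => lat_rep h (blk P l) (sub_rep mu l)),
  (fun l => lat_h h (blk P l) (blk P l.+1) (I l)), (fun l => lat_A h (blk P l)),
  (fun l => lat_B h (blk P l) (blk Q l)).
split.
- move=> l /andP[_ ld]; apply: (lat_is_rep (muPl l ld)); exact: sub_rep_is_rep.
- move=> l /andP[_ ld] a; apply: mulmx_ext => c; rewrite -!mulmxA !(lat_hE, lat_repE).
  rewrite decK; last by apply: (mul_lattice (muPl l (ltnW ld))); exact: dec_mem.
  rewrite decK; last by apply: Ilat; exact: dec_mem.
  by rewrite !mulmxA !sub_repE blk_incl //; case: mu_tri => _; exact.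
- move=> l /andP[_ ld]; apply: lat_short_exact; first exact: PQl.
  + exact: QPl.
  + exact: muPl.
- move=> l /andP[_ ld]; apply: mulmx_ext => c; rewrite -!mulmxA !lat_AE !lat_hE.
  rewrite mul_block_col !mul0mx addr0 add0r lat_hE decK; last first.
    by apply: shift_lattice; exact: dec_mem.
  rewrite decK; last by apply: Ilat; exact: dec_mem.
  by rewrite shift_mul to_poly_mul scalemxAr cf_pc.
- move=> l /andP[_ ld]; apply: mulmx_ext => w; rewrite -!mulmxA !lat_BE -[w]vsubmxK.
  rewrite mul_block_col !mul0mx addr0 add0r !col_mxKu !col_mxKd lat_hE decK; last first.
    by apply: Ilat; exact: dec_mem.
  by rewrite lift_mul mulmxA blk_poly_incl // -mulmxA cf_pc.
Qed.

End Family.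

(** * From exact sequences to a curve *)

Section PencilLevel.
Variables (k : fieldType) (L : falgType k) (n l : nat).
Variables (A : 'M[k]_(n + l, n)) (B : 'M[k]_(l, n + l)) (V : 'M[k]_(n + l, l)).
Variables (X : L -> 'M[k]_n) (mu nu : L -> 'M[k]_l).
Hypothesis homA : is_hom X (dsum_rep X mu) A.
Hypothesis homB : is_hom (dsum_rep X mu) nu B.
Hypothesis injA : forall v : 'cV[k]_n, A *m v = 0 -> v = 0.
Hypothesis BA : B *m A = 0.
Hypothesis BV : B *m V = 1%:M.

Definition inl_mx : 'M[k]_(n + l, n) := col_mx 1%:M 0.
Definition inr_mx : 'M[k]_(n + l, l) := col_mx 0 1%:M.

(** The first columns span the image of [a + t (1, 0)], the last ones are the section [V]; the
    determinant tells for which [t] the two are complementary. *)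
Definition pencil_poly : 'M[{poly k}]_(n + l) :=
  row_mx (pc A + 'X *: pc inl_mx) (pc V).
Definition pencil (t : k) : 'M[k]_(n + l) := row_mx (A + t *: inl_mx) V.

Lemma ev_pencil t : map_mx (horner_eval t) pencil_poly = pencil t.
Proof.
rewrite /pencil_poly /pencil map_row_mx; congr row_mx; apply/matrixP => i j.
  by rewrite !mxE /= /horner_eval hornerD hornerM hornerX !hornerC.
by rewrite !mxE /= /horner_eval hornerC.
Qed.

Lemma pencil_unit0 : pencil 0 \in unitmx.
Proof.
rewrite -unitmx_tr -row_free_unit -kermx_eq0; apply/eqP/row_matrixP => i; rewrite row0.
set u := row i _; have : pencil 0 *m u^T = 0.
  by apply: trmx_inj; rewrite trmx_mul trmxK trmx0; exact/sub_kermxP/row_sub.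
rewrite /pencil scale0r addr0 -[u^T]vsubmxK mul_row_col => Pu.
have := congr1 (mulmx B) Pu; rewrite mulmxDr !mulmxA BA BV mul0mx add0r mul1mx mulmx0 => u2.
rewrite u2 mulmx0 addr0 in Pu; have u1 := injA Pu.
by apply: trmx_inj; rewrite trmx0 -[LHS]vsubmxK u1 u2 col_mx0.
Qed.

(** The projection along the image of the pencil, in the coordinates given by [V]: all cokernels are
    modelled on the same [k^l]. *)
Definition coker_mx (t : k) : 'M[k]_(l, n + l) := dsubmx (invmx (pencil t)).
Definition coker_rep (t : k) (a : L) : 'M[k]_l := coker_mx t *m dsum_rep X mu a *m V.
Definition coker_iso (t : k) : 'M[k]_l := coker_mx t *m inr_mx.

Section Invertible.
Variable t : k.
Hypothesis Pt : pencil t \in unitmx.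

Lemma coker_mx_pencil : coker_mx t *m (A + t *: inl_mx) = 0 /\ coker_mx t *m V = 1%:M.
Proof.
have : coker_mx t *m pencil t = row_mx 0 1%:M.
  rewrite /coker_mx mul_dsub_mx mulVmx //.
  by rewrite (@scalar_mx_block _ n l) /block_mx col_mxKd.
by rewrite mul_mx_row => /eq_row_mx.
Qed.

Lemma pencil_ext m (M N : 'M[k]_(m, n + l)) :
  M *m (A + t *: inl_mx) = N *m (A + t *: inl_mx) -> M *m V = N *m V -> M = N.
Proof.
move=> E1 E2; rewrite -(mulmxK Pt M) -(mulmxK Pt N); congr (_ *m _).
by rewrite !mul_mx_row E1 E2.
Qed.

Lemma pencil_decomp v : exists u : 'cV[k]_n, v = (A + t *: inl_mx) *m u + V *m (coker_mx t *m v).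
Proof.
exists (usubmx (invmx (pencil t) *m v)).
rewrite /coker_mx mul_dsub_mx -mul_row_col vsubmxK mulmxA -/(pencil t) mulmxV //.
by rewrite mul1mx.
Qed.

Lemma inl_hom a : dsum_rep X mu a *m inl_mx = inl_mx *m X a.
Proof.
by rewrite /dsum_rep /inl_mx mul_block_col mul_col_mx !mulmx1 !mul0mx mulmx0 mul1mx !addr0.
Qed.

Lemma inr_hom a : dsum_rep X mu a *m inr_mx = inr_mx *m mu a.
Proof.
by rewrite /dsum_rep /inr_mx mul_block_col mul_col_mx !mulmx1 !mul0mx !mulmx0 mul1mx addr0 add0r.
Qed.

Lemma coker_mx_hom a : coker_mx t *m dsum_rep X mu a = coker_rep t a *m coker_mx t.
Proof.
have [E1 E2] := coker_mx_pencil; apply: pencil_ext; last first.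
  by rewrite -[RHS]mulmxA E2 mulmx1.
rewrite -[RHS]mulmxA E1 mulmx0 -mulmxA mulmxDr -homA -scalemxAr inl_hom scalemxAl -mulmxDl.
by rewrite mulmxA E1 mul0mx.
Qed.

Lemma coker_iso_hom a : coker_iso t *m mu a = coker_rep t a *m coker_iso t.
Proof. by rewrite /coker_iso mulmxA -coker_mx_hom -!mulmxA inr_hom. Qed.

(** If [(0, y)] is the image of [u] under the pencil, then [usubmx A + t] kills [u]; where it is
    invertible, [u] and [y] vanish. *)
Lemma coker_iso_unit : \det (usubmx A + t%:M) != 0 -> coker_iso t \in unitmx.
Proof.
move=> dC; rewrite -unitmx_tr -row_free_unit -kermx_eq0; apply/eqP/row_matrixP => i; rewrite row0.
set y := row i _; have : coker_iso t *m y^T = 0.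
  by apply: trmx_inj; rewrite trmx_mul trmxK trmx0; exact/sub_kermxP/row_sub.
rewrite /coker_iso -mulmxA => Zy; have [u] := pencil_decomp (inr_mx *m y^T).
rewrite Zy mulmx0 addr0 -[A]vsubmxK /inl_mx /inr_mx mul_col_mx mul0mx mul1mx.
rewrite scale_col_mx scaler0 add_col_mx addr0 mul_col_mx scalemx1 => /eq_col_mx[E1 E2].
have u0 : u = 0.
  have uC : usubmx A + t%:M \in unitmx by rewrite unitmxE unitfE.
  by rewrite -(mulKmx uC u) -E1 mulmx0.
by apply: trmx_inj; rewrite E2 u0 mulmx0 trmx0.
Qed.

End Invertible.

(** [B] too kills the image of [A] and is the identity on the section. *)
Lemma coker_mx0 : coker_mx 0 = B.
Proof.
have P0 := pencil_unit0; have [E1 E2] := coker_mx_pencil P0.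
apply: (pencil_ext P0); last by rewrite E2 BV.
by rewrite E1 scale0r addr0 BA.
Qed.

Lemma coker_rep0 a : coker_rep 0 a = nu a.
Proof. by rewrite /coker_rep coker_mx0 homB -mulmxA BV mulmx1. Qed.

Lemma pencil_poly_det t : (\det pencil_poly).[t] = \det (pencil t).
Proof. by rewrite -ev_pencil det_map_mx. Qed.

(** By Cramer's rule the entries of [coker_rep t] have the determinant of the pencil as denominator,
    and a power of it clears any polynomial in them. *)
Lemma coker_polyfun (f : (L -> 'M[k]_l) -> k) : polyfun f ->
  exists q N, forall t, pencil t \in unitmx ->
    f (coker_rep t) * (\det pencil_poly).[t] ^+ N = q.[t].
Proof.
elim=> [c|a i j|f1 f2 _ [q1 [N1 h1]] _ [q2 [N2 h2]]|f1 f2 _ [q1 [N1 h1]] _ [q2 [N2 h2]]].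
- by exists c%:P, 0%N => t _; rewrite expr0 mulr1 hornerC.
- exists ((dsubmx (\adj pencil_poly) *m pc (dsum_rep X mu a *m V)) i j), 1%N => t Pt.
  rewrite expr1 pencil_poly_det -[RHS]/(horner_eval t _).
  transitivity ((map_mx (horner_eval t)
     (dsubmx (\adj pencil_poly) *m pc (dsum_rep X mu a *m V))) i j); last by rewrite mxE.
  rewrite map_mxM map_dsubmx map_mx_adj ev_pencil.
  have -> : map_mx (horner_eval t) (pc (dsum_rep X mu a *m V)) = dsum_rep X mu a *m V.
    by apply/matrixP => x y; rewrite !mxE /= /horner_eval hornerC.
  rewrite /coker_rep /coker_mx /invmx Pt linearZ /= -!scalemxAl mxE mulrC mulrA -mulmxA.
  by rewrite mulfV ?mul1r // -unitfE -unitmxE.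
- exists (q1 * \det pencil_poly ^+ N2 + q2 * \det pencil_poly ^+ N1), (N1 + N2)%N => t Pt.
  rewrite hornerD !hornerM !horner_exp -h1 // -h2 // exprD; ring.
- exists (q1 * q2), (N1 + N2)%N => t Pt.
  by rewrite hornerM -h1 // -h2 // exprD; ring.
Qed.

End PencilLevel.

Section Converse.
Variables (k : closedFieldType) (L : falgType k) (d : nat) (mu nu : L -> 'M[k]_d).
Hypothesis d0 : (0 < d)%N.
Variables (xd : nat -> nat) (X : forall l, L -> 'M[k]_(xd l)).
Variables (h : forall l, 'M[k]_(xd l.+1, xd l)) (A : forall l, 'M[k]_(xd l + l, xd l)).
Variable B : forall l, 'M[k]_(l, xd l + l).
Hypothesis Xexact : forall l, (1 <= l <= d)%N ->
  short_exact (X l) (dsum_rep (X l) (sub_rep mu l)) (sub_rep nu l) (A l) (B l).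
Hypothesis hA : forall l, (1 <= l < d)%N ->
  block_mx (h l) 0 0 (incl_mx k l) *m A l = A l.+1 *m h l.
Hypothesis hB : forall l, (1 <= l < d)%N ->
  incl_mx k l *m B l = B l.+1 *m block_mx (h l) 0 0 (incl_mx k l).

Let push l := block_mx (h l) 0 0 (incl_mx k l).

Lemma incl_tr_mul l : (incl_mx k l)^T *m incl_mx k l = 1%:M.
Proof.
apply/matrixP => i j; rewrite !mxE (bigD1 (widen_ord (leqnSn l) j)) //= big1 ?addr0.
  by rewrite !mxE eqxx mulr1 eq_sym.
move=> x xj; rewrite !mxE -(inj_eq val_inj) /= in xj *.
by rewrite (negbTE xj) mulr0.
Qed.

Lemma right_inverse_ex l : (1 <= l <= d)%N -> exists W, B l *m W = 1%:M.
Proof.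
move=> ld; have [_ _ _ surj _] := Xexact ld.
have /choice[w hw] : forall j : 'I_l, exists v : 'cV[k]_(xd l + l), B l *m v = delta_mx j 0.
  by move=> j; exact: surj.
exists (\matrix_(i, j) w j i 0); apply/matrixP => i j.
have /colP/(_ i) := hw j; rewrite !mxE andbT => <-.
by apply: eq_bigr => x _; rewrite !mxE.
Qed.

(** On the first [l] coordinates, cut out by the projection [incl incl^T], the previous section is
    pushed forward, which is a right inverse by [hB]; on the last coordinate any right inverse
    serves. *)
Lemma compatible_sections : exists V : forall l, 'M[k]_(xd l + l, l),
  (forall l, (1 <= l <= d)%N -> B l *m V l = 1%:M) /\
  (forall l, push l *m V l = V l.+1 *m incl_mx k l).
Proof.
have W l : {W : 'M[k]_(xd l + l, l) | (1 <= l <= d)%N -> B l *m W = 1%:M}.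
  apply: cid; have [ld|] := boolP (1 <= l <= d)%N; last by exists 0.
  by have [W hW] := right_inverse_ex ld; exists W.
pose V := fix V l : 'M[k]_(xd l + l, l) := if l is l'.+1 then
   push l' *m V l' *m (incl_mx k l')^T + sval (W l'.+1) *m (1%:M - incl_mx k l' *m (incl_mx k l')^T)
  else 0.
have VE l : V l.+1 = push l *m V l *m (incl_mx k l)^T +
    sval (W l.+1) *m (1%:M - incl_mx k l *m (incl_mx k l)^T) by [].
exists V; split; last first.
  move=> l; rewrite VE mulmxDl -!mulmxA incl_tr_mul mulmx1 mulmxBl mul1mx.
  by rewrite -mulmxA incl_tr_mul mulmx1 subrr mulmx0 addr0.
elim=> [//|l IH] ld; rewrite VE mulmxDr (mulmxA _ (sval _)) (svalP (W l.+1)) // mul1mx.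
suff -> : B l.+1 *m (push l *m V l *m (incl_mx k l)^T) = incl_mx k l *m (incl_mx k l)^T.
  by rewrite addrC subrK.
case: l IH ld {VE} => [|l] IH ld.
  (* There is no level 0 to appeal to, but its inclusion has no columns and both sides vanish. *)
  by rewrite (thinmx0 (incl_mx k 0)) trmx0 !mulmx0.
by rewrite !mulmxA -hB ?(andP ld).2 // -(mulmxA _ (B _)) IH ?(ltnW (andP ld).2) // mulmx1.
Qed.

Theorem degeneration_of_exact_sequences : zariski_closure (Ud_orbit mu) nu.
Proof.
have [V [BV pushV]] := compatible_sections.
have lvl l : (1 <= l <= d)%N -> [/\ is_hom (X l) (dsum_rep (X l) (sub_rep mu l)) (A l),
    is_hom (dsum_rep (X l) (sub_rep mu l)) (sub_rep nu l) (B l),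
    forall v : 'cV[k]_(xd l), A l *m v = 0 -> v = 0 & B l *m A l = 0].
  move=> ld; have [homA homB inj _ ex] := Xexact ld; split=> //.
  apply: mulmx_ext => v; rewrite -mulmxA mul0mx; apply/ex; by exists v.
have dd : (1 <= d <= d)%N by rewrite d0 leqnn.
pose pd l := \det (pencil_poly (A l) (V l)).
pose cd l := char_poly (- usubmx (A l)).
have cdE l t : (cd l).[t] = \det (usubmx (A l) + t%:M).
  rewrite /cd /char_poly -[LHS]/(horner_eval t _) -det_map_mx; congr (\det _).
  apply/matrixP => i j; rewrite !mxE raddfB /= rmorphMn /= /horner_eval hornerX hornerC.
  by rewrite opprK addrC.
(* All levels are needed: the top one gives [rho], the lower ones make the conjugating matrix [w d]
   triangular. *)
pose good := \prod_(l < d) (pd l.+1 * cd l.+1).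
have good0 : good != 0.
  apply/prodf_neq0 => l _; have ld : (1 <= l.+1 <= d)%N by rewrite ltn_ord.
  have [homA homB inj BA] := lvl _ ld; rewrite mulf_neq0 //; last first.
    by rewrite monic_neq0 // char_poly_monic.
  apply/eqP => pd0; have := pencil_unit0 inj BA (BV _ ld).
  by rewrite unitmxE -pencil_poly_det -/(pd _) pd0 horner0 unitr0.
have goodP t : good.[t] != 0 -> forall l, (1 <= l <= d)%N ->
    pencil (A l) (V l) t \in unitmx /\ \det (usubmx (A l) + t%:M) != 0.
  move=> gt [//|l] /= ld; move: gt; rewrite horner_prod => /prodf_neq0/(_ (Ordinal ld) isT) /=.
  rewrite hornerM mulf_eq0 negb_or cdE => /andP[pdt ->]; split=> //.
  by rewrite unitmxE unitfE -pencil_poly_det.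
pose rho t := coker_rep (A d) (V d) (X d) (sub_rep mu d) t.
have subd (m : L -> 'M[k]_d) a : sub_rep m d a = m a.
  by apply/matrixP => i j; rewrite sub_repE mxE -entryE.
have rho_orbit t : good.[t] != 0 -> Ud_orbit mu (rho t).
  move=> gt; pose w l := coker_iso (A l) (V l) t.
  have [Pd cdt] := goodP t gt d dd; have [homA homB inj BA] := lvl _ dd.
  have wu : w d \in unitmx by exact: coker_iso_unit Pd cdt.
  exists (w d); split; last first.
    apply/funext => a; rewrite /conj_rep -{1}(subd mu).
    by rewrite (coker_iso_hom homA Pd) mulmxK.
  split=> //; suff : forall l, (1 <= l <= d)%N -> upper_triangular (w l) by apply.
  have wstep l : (1 <= l < d)%N -> incl_mx k l *m w l = w l.+1 *m incl_mx k l.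
    move=> ld; have ld1 : (1 <= l <= d)%N by case/andP: ld => -> /ltnW.
    have ld2 : (1 <= l.+1 <= d)%N by case/andP: ld.
    have [Pl _] := goodP t gt l ld1; have [Pl' _] := goodP t gt l.+1 ld2.
    have [E1 E2] := coker_mx_pencil Pl; have [E1' E2'] := coker_mx_pencil Pl'.
    have Zpush : incl_mx k l *m coker_mx (A l) (V l) t = coker_mx (A l.+1) (V l.+1) t *m push l.
      apply: (pencil_ext Pl); last by rewrite -!mulmxA E2 mulmx1 pushV mulmxA E2' mul1mx.
      rewrite -!mulmxA E1 mulmx0; have -> : push l *m (A l + t *: inl_mx k (xd l) l) =
          (A l.+1 + t *: inl_mx k (xd l.+1) l.+1) *m h l.
        rewrite mulmxDr mulmxDl hA // -scalemxAr -scalemxAl /push /inl_mx.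
        by rewrite mul_block_col mul_col_mx !mulmx1 !mul0mx !mulmx0 mul1mx !addr0.
      by rewrite mulmxA E1' mul0mx.
    rewrite /w /coker_iso mulmxA Zpush -!mulmxA; congr (_ *m _).
    by rewrite /push /inr_mx mul_block_col mul_col_mx !mulmx1 !mul0mx !mulmx0 mul1mx addr0 add0r.
  (* By [wstep], a column [j < l] of [w l.+1] is that of [w l] extended by 0. *)
  elim=> [//|l IH] ld i j ji; have jl : (j < l)%N by apply: leq_trans ji _; rewrite -ltnS.
  have l0 : (0 < l)%N := leq_ltn_trans (leq0n _) jl.
  have lld : (1 <= l < d)%N by rewrite l0.
  have inclE x y : incl_mx k l x y = ((x : nat) == y)%:R by rewrite mxE.
  have lld' : (1 <= l <= d)%N by case/andP: lld => -> /ltnW.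
  have /matrixP/(_ i (Ordinal jl)) := wstep l lld; move: (IH lld') => {IH}.
  move: (w l) (w l.+1) => u u' IH; rewrite !mxE [RHS](bigD1 j) //= inclE eqxx mulr1.
  rewrite [X in _ = _ + X]big1 ?addr0; last first.
    by move=> x xj; rewrite inclE -[x == j :> nat]/(x == j) (negbTE xj) mulr0.
  move=> <-; apply: big1 => x _; rewrite inclE; case: eqP => [ix|_]; last by rewrite mul0r.
  by rewrite IH ?mulr0 //= -ix.
have rho0 : rho 0 = nu.
  have [homA homB inj BA] := lvl _ dd.
  by apply/funext => a; rewrite /rho (coker_rep0 homB inj BA (BV _ dd)) subd.
move=> f pf fS; have [homA homB inj BA] := lvl _ dd.
have [q [N hq]] := coker_polyfun (A d) (V d) (X d) (sub_rep mu d) pf.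
(* [q] vanishes wherever [good] does not, hence identically. At [t = 0] only the top pencil has to
   be invertible, so [f nu = 0] follows even if [good] vanishes there. *)
have q0 : q = 0.
  apply/eqP; apply: contrapT => /negP q0.
  have /closed_nonrootP[t] : q * good != 0 by rewrite mulf_neq0.
  rewrite rootM negb_or => /andP[qt gt]; case/negP: qt; rewrite rootE.
  have [Pd _] := goodP t gt d dd; rewrite -hq //.
  by rewrite -/(rho t) fS ?mul0r //; exact: rho_orbit.
have P0 := pencil_unit0 inj BA (BV _ dd); have := hq 0 P0.
rewrite q0 horner0 -/(rho 0) rho0 => /eqP; rewrite mulf_eq0 => /orP[/eqP//|].
rewrite expf_eq0 => /andP[_]; rewrite pencil_poly_det.
by move: P0; rewrite unitmxE unitfE => /negbTE ->.
Qed.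

End Converse.

Theorem theorem1p6 (k : closedFieldType) (L : falgType k) (d : nat)
  (mu nu : L -> 'M[k]_d) :
  basic_algebra L -> (0 < d)%N ->
  triangular_rep mu -> triangular_rep nu ->
  zariski_closure (Ud_orbit mu) nu <->
  exists (xd : nat -> nat) (X : forall l, L -> 'M[k]_(xd l))
         (h : forall l, 'M[k]_(xd l.+1, xd l))
         (A : forall l, 'M[k]_(xd l + l, xd l))
         (B : forall l, 'M[k]_(l, xd l + l)),
    [/\ (forall l, (1 <= l <= d)%N -> is_rep (X l)),
        (forall l, (1 <= l < d)%N -> is_hom (X l) (X l.+1) (h l)),
        (forall l, (1 <= l <= d)%N ->
           short_exact (X l) (dsum_rep (X l) (sub_rep mu l)) (sub_rep nu l) (A l) (B l)),
        (forall l, (1 <= l < d)%N ->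
           block_mx (h l) 0 0 (incl_mx k l) *m A l = A l.+1 *m h l) &
        (forall l, (1 <= l < d)%N ->
           incl_mx k l *m B l = B l.+1 *m block_mx (h l) 0 0 (incl_mx k l))].
Proof.
move=> _ d0 mu_tri nu_tri; split=> [/(curve_selection mu_tri nu_tri)|].
  exact: exact_sequences_of_degeneration.
move=> [xd [X [h [A [B [_ _ Xexact hA hB]]]]]].
exact: (degeneration_of_exact_sequences d0 Xexact hA hB).
Qed.
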